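(* Let $\nu\in(0,1]$, $t>t_0\ge0$, and let $\mathfrak{T}^\nu_t(x)=T(\mathfrak{B}^x_\nu(t))$ be the composition of a zero-mean isotropic random field $T$ on $\mathbb{S}^2_1$ with angular power spectrum $(C_l)_{l\ge0}$ and independent time-changed rotational Brownian motions $\mathfrak{B}^x_\nu$ started at $x$ at time $t_0$. Then for all $x,y\in\mathbb{S}^2_1$ with $x\neq y$, the space-covariance of $\mathfrak{T}^\nu_t$ is $$\Gamma_\nu(\langle x,y\rangle,t):=\mathbb{E}\big[\mathfrak{T}^\nu_t(x)\,\mathfrak{T}^\nu_t(y)\big]=\sum_{l\ge0}\frac{2l+1}{4\pi}\,C_l\,\Big(E_\nu\big(-\mu_l(t-t_0)^\nu\big)\Big)^2P_l(\langle x,y\rangle).$$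
   Context: $\mathbb{S}^2_1$ is the unit sphere in $\mathbb{R}^3$ with surface measure $\lambda$ ($\lambda(\mathbb{S}^2_1)=4\pi$), $\langle\cdot,\cdot\rangle$ is the inner product of $\mathbb{R}^3$, $\triangle_{\mathbb{S}^2_1}$ the Laplace–Beltrami operator, $\mu_l=l(l+1)$, $P_l$ the Legendre polynomials, $Y_{lm}$ ($l\ge0$, $|m|\le l$) the orthonormal complex spherical harmonics, $\triangle_{\mathbb{S}^2_1}Y_{lm}=-\mu_lY_{lm}$, $Y^*_{lm}=(-1)^mY_{l,-m}$. $E_\nu(z)=\sum_{n\ge0}z^n/\Gamma(1+n\nu)$ is the Mittag-Leffler function. Random field: $T=\{T(x):x\in\mathbb{S}^2_1\}$ is a real-valued (measurable) random field with $\mathbb{E}T(x)=0$, isotropic ($T(g\,\cdot)$ and $T(\cdot)$ have the same law for all $g\in SO(3)$) and $2$-weakly isotropic: $\mathbb{E}|T(gx)|^2<\infty$ and $\mathbb{E}[T(x_1)T(x_2)]=\mathbb{E}[T(gx_1)T(gx_2)]$ for all $x,x_1,x_2\in\mathbb{S}^2_1$, $g\in SO(3)$. It admits the spectral representation $T(x)=\sum_{l\ge0}\sum_{|m|\le l}a_{lm}Y_{lm}(x)$, $a_{lm}=\int_{\mathbb{S}^2_1}T(x)Y^*_{lm}(x)\lambda(dx)$, convergent in $L^2(P)$ for each $x$ and in $L^2(P\otimes\lambda)$, and its angular power spectrum $(C_l)$ is defined by $\mathbb{E}[a_{l_1m_1}a^*_{l_2m_2}]=\delta_{l_1}^{l_2}\delta_{m_1}^{m_2}C_{l_1}$;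 $\sum_l(2l+1)C_l<\infty$. Time-changed rotational Brownian motion: $\mathfrak{B}^x(t)$ is Brownian motion on $\mathbb{S}^2_1$ started at $x$ (the diffusion with generator $\triangle_{\mathbb{S}^2_1}$, with no factor $1/2$). For $\nu\in(0,1)$, $\mathfrak{H}^\nu_t$ is the stable subordinator with $\mathbb{E}e^{-s\mathfrak{H}^\nu_t}=e^{-ts^\nu}$ and $\mathfrak{L}^\nu_t=\inf\{\tau>0:\mathfrak{H}^\nu_\tau>t\}$, independent of $\mathfrak{B}^x$; $\mathfrak{L}^1_t=t$. Then $\mathfrak{B}^x_\nu(t)=\mathfrak{B}^x(\mathfrak{L}^\nu_{t-t_0})$, $t\ge t_0$. Standing assumptions: $T$ is independent of the processes $\mathfrak{B}^x_\nu$, and for $x\neq y$ the processes $\mathfrak{B}^x_\nu$ and $\mathfrak{B}^y_\nu$ are independent. *)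

(* Defs.v *)
From HB Require Import structures.
From mathcomp Require Import all_boot all_order all_algebra.
From mathcomp Require Import all_classical all_reals all_analysis.
From mathcomp Require Import measurable_realfun.
From mathcomp Require Import complex.

Set Implicit Arguments.
Unset Strict Implicit.
Unset Printing Implicit Defensive.

Import Order.TTheory GRing.Theory Num.Theory.
Import numFieldNormedType.Exports.

Local Open Scope classical_set_scope.
Local Open Scope ring_scope.

Section Sphere.
Variable R : realType.

Definition inner (p q : 'rV[R]_3) : R := \sum_(i < 3) p 0 i * q 0 i.

Record sphere := Sphere { pos :> 'rV[R]_3; _ : inner pos pos == 1 }.

HB.instance Definition _ := [isSub for pos].
HB.instance Definition _ := [Choice of sphere by <:].

Definition vec3 (a b c : R) : 'rV[R]_3 :=
  \row_(i < 3) (if i == 0 :> nat then a else if i == 1 :> nat then b else c).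

Definition coord (k : nat) (x : 'rV[R]_3) : R := x 0 (inord k).

Lemma inner_vec3 (a b c : R) :
  inner (vec3 a b c) (vec3 a b c) = a ^+ 2 + b ^+ 2 + c ^+ 2.
Proof.
by rewrite /inner !big_ord_recl big_ord0 !mxE /= addr0 addrA !expr2.
Qed.

Lemma north_subproof : inner (vec3 0 0 1) (vec3 0 0 1) == 1.
Proof. by rewrite inner_vec3 expr0n expr1n /= !add0r. Qed.

Definition north : sphere := Sphere north_subproof.

HB.instance Definition _ := isPointed.Build sphere north.

(* The Borel sigma-algebra: the trace of that of R^3, i.e. the one generated by
   the coordinate functions. *)
Definition coords (x : sphere) : R * R * R :=
  (coord 0 x, coord 1 x, coord 2 x).

HB.instance Definition _ :=
  Measurable.copy sphere (g_sigma_algebra_preimageType coords).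

Lemma spherical_subproof (a : R * R) :
  let v := vec3 (sin a.1 * cos a.2) (sin a.1 * sin a.2) (cos a.1) in
  inner v v == 1.
Proof.
by rewrite /= inner_vec3 !exprMn -mulrDr cos2Dsin2 mulr1 addrC cos2Dsin2.
Qed.

(* Colatitude a.1 and longitude a.2. *)
Definition spherical (a : R * R) : sphere := Sphere (spherical_subproof a).

Definition surface_measure (A : set sphere) : \bar R :=
  (\int[lebesgue_measure \x lebesgue_measure]_(a in
      (`[0%R, pi] `*` `[0%R, (2 * pi)%R]) `&` spherical @^-1` A)
    (sin a.1)%:E)%E.

Lemma measurable_spherical : measurable_fun setT spherical.
Proof.
have msc (f : R -> R) (k : R * R -> R) :
    continuous f -> measurable_fun setT k -> measurable_fun setT (f \o k).
  by move=> cf mk; apply: measurableT_comp => //; exact: continuous_measurable_fun.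
have m1 : measurable_fun setT (fst : R * R -> R) by exact: measurable_fst.
have m2 : measurable_fun setT (snd : R * R -> R) by exact: measurable_snd.
have mc : measurable_fun setT (coords \o spherical).
  rewrite (_ : coords \o spherical = fun a => (sin a.1 * cos a.2,
      sin a.1 * sin a.2, cos a.1)); last first.
    by apply/funext => a; rewrite /coords /coord /= !mxE !inordK.
  apply/measurable_fun_pair; first apply/measurable_fun_pair.
  - apply: measurable_funM.
      exact: (msc _ _ (@continuous_sin R) m1).
    exact: (msc _ _ (@continuous_cos R) m2).
  - apply: measurable_funM.
      exact: (msc _ _ (@continuous_sin R) m1).
    exact: (msc _ _ (@continuous_sin R) m2).
  - exact: (msc _ _ (@continuous_cos R) m1).
move=> _ A [B mB <-]; rewrite !setTI -comp_preimage -[X in measurable X]setTI.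
exact: mc.
Qed.

Let box : set (R * R) := `[0%R, pi] `*` `[0%R, (2 * pi)%R].

Let mbox (A : set sphere) : measurable A -> measurable (box `&` spherical @^-1` A).
Proof.
move=> mA; apply: measurableI; first exact: measurableX.
by rewrite -[X in measurable X]setTI; exact: measurable_spherical.
Qed.

Let msin : measurable_fun setT (fun a : R * R => (sin a.1)%:E).
Proof.
apply/measurable_EFinP.
apply: (@measurableT_comp _ _ _ _ _ _ (@sin R) _ fst); last exact: measurable_fst.
by apply: continuous_measurable_fun; exact: continuous_sin.
Qed.

Let sin_ge0 (A : set sphere) (a : R * R) :
  (box `&` spherical @^-1` A) a -> (0 <= (sin a.1)%:E)%E.
Proof.
by case=> -[/= + _] _; rewrite in_itv/= => a0pi; rewrite lee_fin sin_ge0_pi.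
Qed.

Let surface_measure0 : surface_measure set0 = 0%E.
Proof. by rewrite /surface_measure preimage_set0 setI0 integral_set0. Qed.

Let surface_measure_ge0 A : (0 <= surface_measure A)%E.
Proof. by apply: integral_ge0 => a; exact: sin_ge0. Qed.

Let surface_measure_sigma_additive : semi_sigma_additive surface_measure.
Proof.
move=> F mF tF mUF; rewrite /surface_measure -/box preimage_bigcup setI_bigcupr.
rewrite ge0_integral_bigcup//=.
- by apply: is_cvg_ereal_nneg_natsum_cond => n _ _; exact: surface_measure_ge0.
- by move=> k; exact: mbox.
- exact: measurable_funTS.
- by move=> a [k _ ka]; exact: sin_ge0 ka.
- apply: trivIset_setIl; apply/trivIsetP => i j _ _ ij; rewrite -preimage_setI.
  by move/trivIsetP : tF => /(_ _ _ _ _ ij) ->//; rewrite preimage_set0.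
Qed.

HB.instance Definition _ := isMeasure.Build _ _ _ surface_measure
  surface_measure0 surface_measure_ge0 surface_measure_sigma_additive.

Let surface_measure_fin : fin_num_fun surface_measure.
Proof.
move=> A mA; rewrite ge0_fin_numE//.
apply: (@le_lt_trans _ _
    (\int[lebesgue_measure \x lebesgue_measure]_(a in box) 1)%E).
  apply: (@le_trans _ _ (\int[lebesgue_measure \x lebesgue_measure]_(a in
      box `&` spherical @^-1` A) 1)%E).
    apply: ge0_le_integral => //; [exact: mbox|exact: sin_ge0|
      exact: measurable_funTS|].
    by move=> a _; rewrite lee_fin sin_le1.
  by apply: ge0_subset_integral => //; [exact: mbox|exact: measurableX].
rewrite integral_cst//; last exact: measurableX.
rewrite mul1e [ltLHS](_ : _ = @lebesgue_measure R `[0%R, pi] *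
  @lebesgue_measure R `[0%R, (2 * pi)%R])%E; last exact: product_measure1E.
rewrite !lebesgue_measure_itv/=.
by do 2 case: ifPn => _; rewrite ?mule0 ?mul0e// -!EFinB -?EFinM ltry.
Qed.

HB.instance Definition _ := Measure_isFinite.Build _ _ _ surface_measure
  surface_measure_fin.

(* Matrices act on row vectors from the right, so the rotation x |-> g x is
   x *m g^T. *)
Record SO3 := MkSO3 {
  so3_mx : 'M[R]_3;
  so3_orthogonal : so3_mx *m so3_mx^T = 1%:M;
  so3_det : \det so3_mx = 1 }.

Lemma innerE (p q : 'rV[R]_3) : inner p q = (p *m q^T) 0 0.
Proof. by rewrite !mxE; apply: eq_bigr => i _; rewrite mxE. Qed.

Lemma rotate_subproof (g : SO3) (x : sphere) :
  inner (x *m (so3_mx g)^T) (x *m (so3_mx g)^T) == 1.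
Proof.
have gTg : (so3_mx g)^T *m so3_mx g = 1%:M.
  exact/mulmx1C/so3_orthogonal.
rewrite innerE trmx_mul trmxK mulmxA -(mulmxA (x : 'rV_3)) gTg mulmx1 -innerE.
by case: x.
Qed.

Definition rotate (g : SO3) (x : sphere) : sphere :=
  Sphere (rotate_subproof g x).

End Sphere.

Section LaplaceBeltrami.
Variable R : realType.
Implicit Types (f : sphere R -> R) (F : 'rV[R]_3 -> R).

Definition normalize (p : 'rV[R]_3) : sphere R :=
  insubd (@north R) ((Num.sqrt (inner p p))^-1 *: p).

Definition radial f : 'rV[R]_3 -> R := fun p => f (normalize p).

Definition partial (i : 'I_3) F : 'rV[R]_3 -> R :=
  fun p => 'D_(delta_mx 0 i) F p.

Definition C1_off_origin F :=
  forall i p, p != 0 ->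
    derivable F p (delta_mx 0 i) /\ {for p, continuous (partial i F)}.

(* C^2 functions on the sphere: those whose extension constant along rays is
   C^2 on R^3 \ {0}. *)
Definition C2_sphere f :=
  C1_off_origin (radial f) /\ forall i, C1_off_origin (partial i (radial f)).

(* On the unit sphere, the Laplace-Beltrami operator is the restriction of the
   Euclidean Laplacian of the radially constant extension. *)
Definition laplace_beltrami f (x : sphere R) : R :=
  \sum_(i < 3) partial i (partial i (radial f)) x.

End LaplaceBeltrami.

Section SpecialFunctions.
Variable R : realType.

Definition mu_ (l : nat) : R := (l * l.+1)%:R.

(* Rodrigues' formula. *)
Definition legendre (l : nat) : {poly R} :=
  ((2 ^ l * l`!)%N%:R)^-1 *: derivn l (('X ^+ 2 - 1) ^+ l).

(* On the unit sphere sin(theta) e^{i phi} = x_0 + i x_1 and cos(theta) = x_2, so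
   this is
   sqrt((2l+1)/(4 pi) (l-m)!/(l+m)!) P_l^m(cos theta) e^{i m phi}, where
   P_l^m = (-1)^m (1 - z^2)^{m/2} (d/dz)^m P_l. *)
Definition Ylm_nneg (l m : nat) (x : sphere R) : R[i] :=
  (Num.sqrt ((2 * l + 1)%:R / (4 * pi) * (l - m)`!%:R / (l + m)`!%:R)
    * (-1) ^+ m * (derivn m (legendre l)).[coord 2 x])%:C%C
  * (coord 0 x +i* coord 1 x)%C ^+ m.

Definition Ylm (l : nat) (m : int) (x : sphere R) : R[i] :=
  match m with
  | Posz k => Ylm_nneg l k x
  | Negz k => (-1) ^+ k.+1 * conjc (Ylm_nneg l k.+1 x)
  end.

Definition Gamma (s : R) : R :=
  \int[lebesgue_measure]_(u in `]0%R, +oo[) (u `^ (s - 1) * expR (- u)).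

Definition mittag_leffler (nu z : R) : R :=
  limn (series (fun n => z ^+ n / Gamma (1 + n%:R * nu))).

End SpecialFunctions.

Section Processes.
Context (R : realType) (d : measure_display) (Omega : measurableType d).
Variable P : probability Omega R.

Definition sigma_process (I : Type) (d' : measure_display)
    (E : measurableType d') (D : set I) (X : I -> Omega -> E) :
    set (set Omega) :=
  <<s \bigcup_(i in D) preimage_set_system setT (X i) measurable >>.

Definition indep_sigma (F G : set (set Omega)) :=
  forall A B, F A -> G B -> P (A `&` B) = (P A * P B)%E.

Definition martingale (F : R -> set (set Omega)) (M : R -> Omega -> R) :=
  [/\ forall t, 0 <= t -> forall A : set R, measurable A -> F t (M t @^-1` A),
      forall t, 0 <= t -> P.-integrable setT (EFin \o M t)
    & forall s t, 0 <= s -> s <= t -> forall A, F s A ->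
        (\int[P]_(w in A) (M t w)%:E = \int[P]_(w in A) (M s w)%:E)%E].

(* The diffusion with generator [laplace_beltrami], in the sense of the
   martingale problem in the natural filtration. *)
Record sphere_brownian_motion (x : sphere R) (B : R -> Omega -> sphere R) := {
  sbm_measurable : forall t, 0 <= t -> measurable_fun setT (B t);
  sbm_start : forall w, B 0 w = x;
  sbm_continuous : forall w,
    {within `[0, +oo[, continuous (fun t => B t w : 'rV[R]_3)};
  sbm_martingale : forall f, C2_sphere f ->
    martingale (fun t => sigma_process `[0, t] B)
      (fun t w => f (B t w) - f (B 0 w)
        - \int[lebesgue_measure]_(s in `[0, t]) laplace_beltrami f (B s w)) }.

Record stable_subordinator (nu : R) (H : R -> Omega -> R) := {
  sub_measurable : forall t, 0 <= t -> measurable_fun setT (H t);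
  sub_start : forall w, H 0 w = 0;
  sub_nondecreasing : forall w s t, 0 <= s -> s <= t -> H s w <= H t w;
  sub_right_continuous : forall w t, 0 <= t -> H s w @[s --> t^'+] --> H t w;
  sub_stationary : forall s t, 0 <= s -> s <= t ->
    forall A : set R, measurable A ->
      P [set w | A (H t w - H s w)] = P [set w | A (H (t - s) w)];
  sub_indep_increments : forall s t, 0 <= s -> s <= t ->
    indep_sigma (sigma_process `[0, s] H)
      (preimage_set_system setT (fun w => H t w - H s w) measurable);
  sub_laplace : forall s t, 0 <= s -> 0 <= t ->
    ('E_P[fun w => expR (- (s * H t w))] = (expR (- (t * s `^ nu)))%:E)%E }.

(* [inf set0 = 0], but almost surely no such set is empty, as H is almost
   surely unbounded. *)
Definition inverse_subordinator (nu : R) (H : R -> Omega -> R) (t : R)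
    (w : Omega) : R :=
  if nu == 1 then t else inf [set tau | 0 < tau /\ t < H tau w].

Definition time_changed (nu t0 : R) (B : R -> Omega -> sphere R)
    (H : R -> Omega -> R) (t : R) (w : Omega) : sphere R :=
  B (inverse_subordinator nu H (t - t0) w) w.

End Processes.

Section RandomFields.
Context (R : realType) (d : measure_display) (Omega : measurableType d).
Variable P : probability Omega R.
Implicit Types (T : sphere R -> Omega -> R) (C : nat -> R).

Definition measurable_field T :=
  measurable_fun setT (fun z : Omega * sphere R => T z.2 z.1).

Definition isotropic T :=
  forall (g : SO3 R) (n : nat) (x : 'I_n -> sphere R) (A : set (n.-tuple R)),
    measurable A ->
    P [set w | A [tuple T (rotate g (x i)) w | i < n]] =
    P [set w | A [tuple T (x i) w | i < n]].

Definition weakly_isotropic2 T :=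
  (forall (g : SO3 R) x, ('E_P[fun w => ((T (rotate g x) w) ^+ 2)%R] < +oo)%E) /\
  (forall (g : SO3 R) x1 x2, 'E_P[fun w => (T x1 w * T x2 w)%R] =
     'E_P[fun w => (T (rotate g x1) w * T (rotate g x2) w)%R])%E.

Definition alm T (l : nat) (m : int) (w : Omega) : R[i] :=
  ((\int[@surface_measure R]_x (T x w * complex.Re (conjc (Ylm l m x))))
   +i* (\int[@surface_measure R]_x (T x w * complex.Im (conjc (Ylm l m x)))))%C.

(* The index k stands for m = k - l, -l <= m <= l. *)
Definition harmonic_sum T (n : nat) (x : sphere R) (w : Omega) : R[i] :=
  \sum_(0 <= l < n) \sum_(0 <= k < l.*2.+1)
    alm T l (k%:Z - l%:Z) w * Ylm l (k%:Z - l%:Z) x.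

Definition sqnormc (z : R[i]) : R := complex.Re z ^+ 2 + complex.Im z ^+ 2.

Definition remainder T (n : nat) (x : sphere R) (w : Omega) : R :=
  sqnormc ((T x w)%:C%C - harmonic_sum T n x w).

Definition spectral_representation T :=
  (forall x, 'E_P[remainder T n x]%E @[n --> \oo] --> 0%E) /\
  (\int[P \x @surface_measure R]_z (remainder T n z.2 z.1)%:E)%E
    @[n --> \oo] --> 0%E.

Definition expectationC_eq (X : Omega -> R[i]) (z : R[i]) :=
  ('E_P[fun w => complex.Re (X w)] = (complex.Re z)%:E)%E /\
  ('E_P[fun w => complex.Im (X w)] = (complex.Im z)%:E)%E.

Definition angular_power_spectrum T C :=
  (forall (l1 l2 : nat) (m1 m2 : int), (`|m1| <= l1)%N -> (`|m2| <= l2)%N ->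
    expectationC_eq (fun w => alm T l1 m1 w * conjc (alm T l2 m2 w))
      (((l1 == l2) && (m1 == m2))%:R * (C l1)%:C%C)) /\
  cvgn (series (fun l => (2 * l + 1)%:R * C l)).

Record isotropic_field T C := {
  if_measurable : measurable_field T;
  if_centered : forall x, ('E_P[T x] = 0)%E;
  if_isotropic : isotropic T;
  if_weakly_isotropic2 : weakly_isotropic2 T;
  if_spectral : spectral_representation T;
  if_spectrum : angular_power_spectrum T C }.

(* Independence of the measurable field T from a sigma-algebra F: the
   sigma-algebra G carrying T must make T jointly measurable in (w, x). The one
   generated by the single variables T x need not, and independence from it says
   nothing about T evaluated at a random point. *)
Definition field_indep T (F : set (set Omega)) :=
  exists G : set (set Omega), [/\ sigma_algebra setT G, G `<=` measurable,
    measurable_fun setT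
      (fun z : g_sigma_algebraType G * sphere R => T z.2 z.1)
    & indep_sigma P G F].

Definition composed_field T (Y : Omega -> sphere R) (w : Omega) : R := T (Y w) w.

End RandomFields.

(* Main.v *)
From HB Require Import structures.
Require Import Defs.
From mathcomp Require Import all_boot all_order all_algebra.
From mathcomp Require Import all_classical all_reals all_analysis.
From mathcomp Require Import measurable_realfun.
From mathcomp Require Import complex ring lra zify.

Set Implicit Arguments.
Unset Strict Implicit.
Unset Printing Implicit Defensive.

Import Order.TTheory GRing.Theory Num.Theory.
Import numFieldNormedType.Exports.

Local Open Scope classical_set_scope.
Local Open Scope ring_scope.

(** The two points are frozen one randomness at a time. Write X and Y for the
    positions at time t of the two time-changed Brownian motions, and
    K(u, v) = E[T(u) T(v)] for the covariance of the field.

    - Since T is independent of (X, Y), Fubini's theorem gives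
      E[T(X) T(Y)] = E[K(X, Y)] ([expectation_composed_field]).

    - K(u, v) is the sum over l of (2l+1)/(4 pi) C_l P_l(<u, v>)
      ([covariance_series]). Weak isotropy allows v to be rotated to the north
      pole, where the harmonics Y_lm with m <> 0 vanish; there the spectral
      expansion of T only involves the coefficients a_l0, whose correlation with
      T(u) is C_l Y_l0(u). As |P_l| <= 1 ([legendre_le1]) and the nonnegative
      (2l+1) C_l are summable, the partial sums are uniformly bounded and the
      expectation can be taken term by term.

    - u |-> P_l(<u, v>) is an eigenfunction of the Laplace-Beltrami operator with
      eigenvalue -mu_l, by Legendre's equation
      ([laplace_beltrami_legendre]). The martingale problem then turns into the
      integral equation m(s) = m(0) - mu_l int_0^s m for
      m(s) = E[P_l(<B_s, v>)], so that m(s) = e^(-mu_l s) m(0)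
      ([expectation_zonal_brownian]).

    - The independent clock L replaces e^(-mu_l s) by its average
      E[e^(-mu_l L)] = E_nu(-mu_l (t-t0)^nu) ([laplace_inverse_subordinator]).
      Indeed the stable subordinator is self-similar, hence L has the law of
      ((t-t0) / H_1)^nu ([law_L]); its n-th moment is
      n! (t-t0)^(n nu) / Gamma(1 + n nu), by integrating s^(n nu - 1) e^(-s H_1)
      in two orders ([negative_moment]); and the exponential series of these
      moments is the Mittag-Leffler series.

    - Averaging P_l(<X, Y>) over X with Y frozen therefore gives
      E_nu(-mu_l (t-t0)^nu) P_l(<x, Y>), which is a zonal function of Y, and
      averaging over Y produces the second factor ([expectation_zonal_pair]). *)

(** * Legendre polynomials *)

Section Legendre.
Variable R : realType.
Implicit Types (p q : {poly R}) (l k : nat) (z : R).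

(** Differentiating [k + 1] times the first-order equation
    (X^2 - 1) w' = 2 l X w satisfied by w = (X^2 - 1)^l; at [k = l] this is
    Legendre's equation. *)
Lemma derivn_rodrigues l k :
  let w := ('X ^+ 2 - 1 : {poly R}) ^+ l in
  ('X ^+ 2 - 1) * w^`(k.+2) =
    (2 * l%:R - 2 * k.+1%:R) * 'X * w^`(k.+1)
    + (2 * l%:R * k.+1%:R - k%:R * k.+1%:R) * w^`(k).
Proof.
move=> w.
have dq : ('X ^+ 2 - 1 : {poly R})^`() = 2 * 'X.
  by rewrite derivB derivXn derivC subr0 /= expr1 -mulr_natl.
have w1 : ('X ^+ 2 - 1) * w^`() = 2 * l%:R * 'X * w.
  rewrite /w; case: l {w} => [|l]; first by rewrite expr0 derivC; ring.
  by rewrite deriv_exp /= dq [(_ - 1) ^+ _.+1]exprS -mulr_natr; ring.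
have dn (m n : nat) : ((m%:R - n%:R) : {poly R})^`() = 0.
  by rewrite derivB -!polyC_natr !derivC subrr.
elim: k => [|k IH].
  have := congr1 (@deriv R) w1.
  rewrite -(natrM _ 2 l) -(subr0 (2 * l)%:R).
  rewrite -[X in (_ - X) * 'X]/(0%:R) !derivM dn derivX dq.
  rewrite !derivnS derivn0 => h.
  transitivity ((0 * 'X + ((2 * l)%:R - 0%:R) * 1) * w +
    ((2 * l)%:R - 0%:R) * 'X * w^`() - (2 * 'X) * w^`()); first by rewrite -h; ring.
  by rewrite natrM; ring.
have := congr1 (@deriv R) IH.
rewrite -!(natrM _ 2) -!natrM derivD !derivM dq !dn derivX -!derivnS => h.
transitivity ((0 * 'X + ((2 * l)%:R - (2 * k.+1)%:R) * 1) * w^`(k.+1) +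
    ((2 * l)%:R - (2 * k.+1)%:R) * 'X * w^`(k.+2) +
    (0 * w^`(k) + ((2 * l * k.+1)%:R - (k * k.+1)%:R) * w^`(k.+1))
    - (2 * 'X) * w^`(k.+2)); first by rewrite -h; ring.
by rewrite !natrM -!natr1; ring.
Qed.

Lemma legendre_ode l z :
  (1 - z ^+ 2) * (legendre R l)^`()^`().[z] - 2 * z * (legendre R l)^`().[z]
  = - mu_ R l * (legendre R l).[z].
Proof.
have hn (n : nat) : (n%:R : {poly R}).[z] = n%:R by rewrite -polyC_natr hornerC.
rewrite /legendre /mu_ !derivZ !hornerZ -!derivnS.
have := congr1 (fun p => p.[z]) (derivn_rodrigues l l).
rewrite !(hornerM, hornerD, hornerN, hornerXn, hornerX, hornerC) !hn.
set c := (_ ^-1); set w0 := _^`(l).[z]; set w1 := _^`(l.+1).[z].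
set w2 := _^`(l.+2).[z] => h.
transitivity (- c * ((z ^+ 2 - 1) * w2) - 2 * z * (c * w1)); first by ring.
by rewrite h natrM -natr1; ring.
Qed.

(** Only the term where all [l] derivatives fall on [('X - a%:P) ^+ l] survives
    at [a]. *)
Lemma derivn_root_power (a : R) l q :
  ((('X - a%:P) ^+ l * q)^`(l)).[a] = (l`!)%:R * q.[a].
Proof.
elim: l q => [|l IH] q; first by rewrite expr0 mul1r derivn0 fact0 mul1r.
rewrite derivSn derivM deriv_exp derivXsubC /= mul1r.
rewrite (_ : _ + _ = ('X - a%:P) ^+ l * (l.+1%:R%:P * q + ('X - a%:P) * q^`())).
  by rewrite IH !hornerE subrr mul0r addr0 factS natrM; ring.
by rewrite exprS -mulr_natr polyC_natr; ring.
Qed.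

Lemma legendre1 l : (legendre R l).[1] = 1.
Proof.
rewrite /legendre hornerZ.
rewrite (_ : 'X^2 - 1 = ('X - 1%:P) * ('X + 1)); last by ring.
rewrite exprMn derivn_root_power horner_exp hornerD hornerX hornerC.
by rewrite -[1 + 1]/(2%:R) -natrX -natrM mulnC mulVf// pnatr_eq0 -lt0n muln_gt0
  fact_gt0 expn_gt0.
Qed.

Lemma legendreN1_sqr l : (legendre R l).[-1] ^+ 2 = 1.
Proof.
rewrite /legendre hornerZ.
rewrite (_ : 'X^2 - 1 = ('X - (-1)%:P) * ('X - 1)); last by rewrite polyCN; ring.
rewrite [(_ * _) ^+ l]exprMn derivn_root_power horner_exp hornerD hornerN hornerX hornerC.
rewrite -opprD -[1 + 1]/(2%:R).
by rewrite exprNn !exprMn sqrr_sign mul1r -!exprMn mulrC -natrX -natrM mulnC divff ?expr1n//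
  pnatr_eq0 -lt0n muln_gt0 fact_gt0 expn_gt0.
Qed.

(** Legendre's equation makes mu_l P^2 + (1 - z^2) P'^2 nondecreasing away from
    0, so it is at most its value mu_l at the endpoints. *)
Lemma legendre_le1 l z : -1 <= z <= 1 -> `|(legendre R l).[z]| <= 1.
Proof.
move=> /andP[z1 z2]; set p := legendre R l.
have [l0|l0] := eqVneq l 0%N.
  rewrite /p l0 /legendre derivn0 expr0 hornerZ hornerC mulr1 ger0_norm ?invr_ge0//.
  by rewrite fact0 mulr1n invr1.
have mu0 : 0 < mu_ R l by rewrite /mu_ ltr0n muln_gt0 lt0n l0.
pose F := (mu_ R l)%:P * p ^+ 2 + (1 - 'X ^+ 2) * p^`() ^+ 2.
have FE w : F.[w] = mu_ R l * p.[w] ^+ 2 + (1 - w ^+ 2) * p^`().[w] ^+ 2.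
  by rewrite !(hornerM, hornerD, hornerN, hornerXn, hornerX, hornerC, horner_exp).
have dF w : F^`().[w] = 2 * w * p^`().[w] ^+ 2.
  rewrite /F derivD !derivM derivB derivXn !derivC sub0r !mul0r add0r /= expr1.
  rewrite !(hornerMn, hornerM, hornerD, hornerN, hornerXn, hornerX, hornerC, horner_exp).
  have h := legendre_ode l w; rewrite -/p in h.
  transitivity (2 * p^`().[w] * ((1 - w ^+ 2) * p^`()^`().[w]
      - 2 * w * p^`().[w] + mu_ R l * p.[w]) + 2 * w * p^`().[w] ^+ 2).
    by ring.
  by rewrite h; ring.
suff Fz : F.[z] <= mu_ R l.
  have : mu_ R l * p.[z] ^+ 2 <= mu_ R l * 1.
    rewrite mulr1 (le_trans _ Fz)// FE lerDl mulr_ge0 ?sqr_ge0//.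
    by rewrite subr_ge0 -[leRHS](expr1n _ 2) -[_ ^+ 2]real_normK ?num_real//
      lerXn2r ?nnegrE// ler_norml z1.
  by rewrite ler_pM2l// -[in X in _ -> X]ler_sqr ?nnegrE// expr1n real_normK ?num_real.
have mvt a b : a <= b -> exists2 c, c \in `[a, b] & F.[b] - F.[a] = F^`().[c] * (b - a).
  move=> ab; apply: (@MVT_segment R (horner F) (horner F^`())) => //.
  apply: continuous_subspaceT; exact: continuous_horner.
have [z0|z0] := leP 0 z.
  have [c + h] := mvt _ _ z2; rewrite in_itv/= => /andP[zc _].
  have -> : mu_ R l = F.[1] by rewrite FE legendre1; ring.
  rewrite -subr_ge0 h dF mulr_ge0 ?subr_ge0// mulr_ge0 ?sqr_ge0// mulr_ge0//.
  exact: le_trans zc.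
have [c + h] := mvt _ _ z1; rewrite in_itv/= => /andP[_ zc].
have -> : mu_ R l = F.[-1] by rewrite FE legendreN1_sqr; ring.
rewrite -subr_le0 h dF mulr_le0_ge0 ?subr_ge0// mulr_le0_ge0 ?sqr_ge0//.
by rewrite mulr_ge0_le0// (le_trans zc)// ltW.
Qed.

End Legendre.

(** * The sphere *)

Section Inner.
Variable R : realType.
Implicit Types (p q r : 'rV[R]_3) (x : sphere R).

Lemma innerC p q : inner p q = inner q p.
Proof. by apply: eq_bigr => i _; rewrite mulrC. Qed.

Lemma innerDl p q r : inner (p + q) r = inner p r + inner q r.
Proof. by rewrite /inner -big_split; apply: eq_bigr => i _; rewrite mxE mulrDl. Qed.

Lemma innerZl (a : R) p q : inner (a *: p) q = a * inner p q.
Proof. by rewrite /inner mulr_sumr; apply: eq_bigr => i _; rewrite mxE mulrA. Qed.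

Lemma innerZr (a : R) p q : inner p (a *: q) = a * inner p q.
Proof. by rewrite innerC innerZl innerC. Qed.

Lemma inner_delta i p : inner (delta_mx 0 i) p = p 0 i.
Proof.
rewrite /inner (bigD1 i)//= mxE !eqxx mul1r big1 ?addr0// => j ji.
by rewrite mxE (negbTE ji) andbF mul0r.
Qed.

Lemma inner_gt0 p : p != 0 -> 0 < inner p p.
Proof.
move=> p0; rewrite lt_neqAle; apply/andP; split; last first.
  by apply: sumr_ge0 => i _; rewrite -expr2 sqr_ge0.
apply: contra p0 => /eqP/esym h; apply/eqP/rowP => i; rewrite mxE.
have /psumr_eq0P := h; move=> /(_ _ i isT) => hi.
by apply/eqP; rewrite -sqrf_eq0 expr2 hi// => j _; rewrite -expr2 sqr_ge0.
Qed.

Lemma inner_pos x : inner x x = 1.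
Proof. by case: x => p /= /eqP. Qed.

Lemma pos_neq0 x : (x : 'rV_3) != 0.
Proof.
apply/eqP => x0; have := inner_pos x; rewrite x0 -(scale0r 0) innerZl mul0r.
by move/eqP; rewrite eq_sym oner_eq0.
Qed.

Lemma inner_sphere_le1 (x y : sphere R) : -1 <= inner x y <= 1.
Proof.
have sq (z : 'rV[R]_3) : 0 <= inner z z by apply: sumr_ge0 => i _; rewrite -expr2 sqr_ge0.
have := sq ((x : 'rV_3) + y); have := sq ((x : 'rV_3) + (-1) *: (y : 'rV_3)).
rewrite !(innerDl, innerC _ (_ + _), innerZl, innerZr) !inner_pos.
by rewrite (innerC y x); lra.
Qed.

Lemma pos_normalize p : p != 0 ->
  normalize p = (Num.sqrt (inner p p))^-1 *: p :> 'rV_3.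
Proof.
move=> p0; rewrite /normalize /insubd insubT//=.
rewrite innerZl innerZr mulrA -expr2 exprVn sqr_sqrtr; last exact/ltW/inner_gt0.
by rewrite mulVf// gt_eqF// inner_gt0.
Qed.

End Inner.

(** * Calculus off the origin *)

Section DirectionalChainRule.
Variables (R : realType) (V : normedModType R).
Implicit Types (g : V -> R) (p v : V).

(** Directional derivatives are derivatives of real functions, for which the
    chain rule is available. *)
Lemma is_derive_line g p v dg :
  is_derive p v g dg <-> is_derive (0 : R) 1 (fun t : R => g (t *: v + p)) dg.
Proof.
have E : (fun h : R => h^-1 *: ((g \o shift p) (h *: v) - g p)) =
  (fun h : R => h^-1 *: (((fun t : R => g (t *: v + p)) \o shift (0 : R)) (h *: (1 : R))
     - g ((0 : R) *: v + p))).
  by apply/funext => h /=; rewrite scale0r add0r addr0 -[h%:A]/(h * 1) mulr1.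
split=> -[dv de]; apply: DeriveDef.
- by rewrite /derivable -E.
- by rewrite /derive -E.
- by rewrite /derivable E.
- by rewrite /derive E.
Qed.

Lemma is_derive_comp_real (h : R -> R) g p v dg dh :
  is_derive (g p) 1 h dh -> is_derive p v g dg ->
  is_derive p v (h \o g) (dh * dg).
Proof.
move=> Dh /is_derive_line Dg; apply/is_derive_line.
have := @is_derive1_comp _ h (fun t => g (t *: v + p)) 0 dh dg.
by apply => //; rewrite scale0r add0r.
Qed.

End DirectionalChainRule.

Section RadialCalculus.
Variable R : realType.
Implicit Types (p v : 'rV[R]_3) (i : 'I_3) (P : {poly R}).

(** Reified functions on the punctured space. The set is closed under partial
    derivatives, which makes smoothness off the origin an induction, and it
    contains the radial extension of the zonal functions. *)
Inductive rexpr :=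
  | RCst of R
  | RLin of 'rV[R]_3
  | RInvNorm
  | RAdd of rexpr & rexpr
  | RMul of rexpr & rexpr
  | RPoly of {poly R} & rexpr.

Fixpoint reval (e : rexpr) p : R :=
  match e with
  | RCst a => a
  | RLin v => inner p v
  | RInvNorm => (Num.sqrt (inner p p))^-1
  | RAdd e1 e2 => reval e1 p + reval e2 p
  | RMul e1 e2 => reval e1 p * reval e2 p
  | RPoly P e1 => P.[reval e1 p]
  end.

Fixpoint rder i (e : rexpr) : rexpr :=
  match e with
  | RCst _ => RCst 0
  | RLin v => RCst (v 0 i)
  | RInvNorm => RMul (RCst (-1)) (RMul (RLin (delta_mx 0 i))
      (RMul RInvNorm (RMul RInvNorm RInvNorm)))
  | RAdd e1 e2 => RAdd (rder i e1) (rder i e2)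
  | RMul e1 e2 => RAdd (RMul e1 (rder i e2)) (RMul e2 (rder i e1))
  | RPoly P e1 => RMul (RPoly P^`() e1) (rder i e1)
  end.

Lemma is_derive_inner p v d : is_derive p d (fun q => inner q v) (inner d v).
Proof.
have E : (fun h : R => h^-1 *: (((fun q => inner q v) \o shift p) (h *: d) - inner p v))
    @ 0^' --> inner d v.
  apply: cvg_near_cst; near=> h => /=.
  rewrite innerDl innerZl addrK -[_ *: _]/(_ * _) mulKf//.
  by near: h; exact: nbhs_dnbhs_neq.
by apply: DeriveDef; [apply/cvg_ex; exists (inner d v)|exact/cvg_lim].
Unshelve. all: by end_near. Qed.

Lemma is_derive_inner_sqr p d :
  is_derive p d (fun q => inner q q) (2 * inner p d).
Proof.
have E : (fun h : R => h^-1 *: (((fun q => inner q q) \o shift p) (h *: d) - inner p p))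
    @ 0^' --> 2 * inner p d.
  have cE : (fun h : R => h * inner d d + 2 * inner p d) @ 0^' --> 2 * inner p d.
    rewrite -[X in _ --> X]add0r -[X in X + _](mul0r (inner d d)).
    apply: cvgD; last exact: cvg_cst.
    by apply: cvgMl; apply: cvg_within_filter; exact: cvg_id.
  apply: cvg_trans cE; apply: near_eq_cvg; near=> h => /=.
  rewrite innerDl !(innerC _ (_ + p)) !innerDl !innerZl !innerZr (innerC d p).
  have h0 : h != 0 by near: h; exact: nbhs_dnbhs_neq.
  by rewrite -[_ *: _]/(_ * _); field.
by apply: DeriveDef; [apply/cvg_ex; exists (2 * inner p d)|exact/cvg_lim].
Unshelve. all: by end_near. Qed.

Lemma is_derive_reval i e p : p != 0 ->
  is_derive p (delta_mx 0 i) (reval e) (reval (rder i e) p).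
Proof.
move=> p0; have pp := inner_gt0 p0.
elim: e => [a|v||e1 IH1 e2 IH2|e1 IH1 e2 IH2|P e IH] /=.
- exact: is_derive_cst.
- by rewrite -(inner_delta i v); exact: is_derive_inner.
- have sp : Num.sqrt (inner p p) != 0 by rewrite gt_eqF// sqrtr_gt0.
  apply: is_derive_eq.
    apply: (@is_derive_comp_real _ _ (fun x => (Num.sqrt x)^-1) (fun q => inner q q)).
      by apply: is_deriveV => //; exact: is_derive1_sqrt.
    exact: is_derive_inner_sqr.
  by rewrite -[_ *: _]/(_ * _); field.
- exact: is_deriveD.
- exact: (is_deriveM IH1 IH2).
- exact: (@is_derive_comp_real _ _ (horner P) (reval e)).
Qed.

Lemma continuous_reval e p : p != 0 -> {for p, continuous (reval e)}.
Proof.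
move=> p0; have pp := inner_gt0 p0; have FFp : Filter (nbhs p) by exact: nbhs_filter.
have cin (f g : 'rV[R]_3 -> 'rV[R]_3) : continuous f -> continuous g ->
    continuous (fun q => inner (f q) (g q)).
  move=> cf cg q; have FF : Filter (nbhs q) by exact: nbhs_filter.
  apply: (@cvg_big _ _ _ _ _ _ _ (nbhs q)) => [|j _]; first exact: add_continuous.
  apply: cvgM.
    by apply: (@continuous_comp _ _ _ f (fun M : 'rV[R]_3 => M 0 j));
      [exact: cf|exact: coord_continuous].
  by apply: (@continuous_comp _ _ _ g (fun M : 'rV[R]_3 => M 0 j));
      [exact: cg|exact: coord_continuous].
elim: e => [a|v||e1 IH1 e2 IH2|e1 IH1 e2 IH2|P e IH] /=.
- exact: cvg_cst.
- by apply: (cin id (cst v)); [move=> q; exact: cvg_id|exact: cst_continuous].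
- apply: cvgV; first by rewrite gt_eqF// sqrtr_gt0.
  apply: (@continuous_comp _ _ _ (fun q => inner q q) Num.sqrt).
    by apply: (cin id id) => q; exact: cvg_id.
  exact: sqrt_continuous.
- exact: cvgD.
- exact: cvgM.
- apply: (@continuous_comp _ _ _ (reval e) (horner P)) => //.
  exact: continuous_horner.
Qed.

End RadialCalculus.

Section ZonalHarmonics.
Variable R : realType.
Implicit Types (p : 'rV[R]_3) (v x : sphere R) (P : {poly R}).

Definition zonal (P : {poly R}) (v u : sphere R) : R := P.[inner u v].

Lemma zonalC P v x : zonal P v x = zonal P x v.
Proof. by rewrite /zonal innerC. Qed.

Lemma reval_off_origin (F : 'rV[R]_3 -> R) e :
  (forall p, p != 0 -> F p = reval e p) ->
  C1_off_origin F /\ forall i p, p != 0 -> partial i F p = reval (rder i e) p.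
Proof.
move=> FE.
have op : open [set p : 'rV[R]_3 | p != 0].
  rewrite (_ : mkset _ = ~` [set 0]); last by apply/seteqP; split=> p /= /eqP.
  by apply: closed_openC; apply: accessible_closed_set1; apply: hausdorff_accessible;
    exact: norm_hausdorff.
have nF p : p != 0 -> \forall q \near p, reval e q = F q.
  move=> p0; apply: (@filterS _ _ _ [set q : 'rV[R]_3 | q != 0]) => [q /FE //|].
  exact: open_nbhs_nbhs.
have dF i p : p != 0 -> is_derive p (delta_mx 0 i) F (reval (rder i e) p).
  by move=> p0; apply: near_eq_is_derive (nF _ p0) _; exact: is_derive_reval.
have pF i p : p != 0 -> partial i F p = reval (rder i e) p.
  by move=> p0; have [_] := dF i p p0.
split=> // i p p0; split; first by have [] := dF i p p0.
rewrite /prop_for /continuous_at pF//.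
have FFp : Filter (nbhs p) by exact: nbhs_filter.
have := @continuous_reval _ (rder i e) p p0; apply: cvg_trans; apply: near_eq_cvg.
apply: (@filterS _ (nbhs p) _ [set q : 'rV[R]_3 | q != 0]) => [q /pF //|].
exact: open_nbhs_nbhs.
Qed.

Let zonal_expr P v : rexpr R := RPoly P (RMul (RLin (pos v)) (@RInvNorm R)).

Let radial_zonalE P v p : p != 0 -> radial (zonal P v) p = reval (zonal_expr P v) p.
Proof. by move=> p0; rewrite /radial /zonal pos_normalize// innerZl/= mulrC. Qed.

Lemma C2_zonal P v : C2_sphere (zonal P v).
Proof.
have [C1 dE] := reval_off_origin (@radial_zonalE P v).
by split=> // i; have [] := reval_off_origin (dE i).
Qed.

(** With q = <p, v> / |p|, summing the second derivatives of P(q) at a unit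
    vector gives (1 - q^2) P''(q) - 2 q P'(q). *)
Lemma laplace_beltrami_zonal P v x : let q := inner x v in
  laplace_beltrami (zonal P v) x = (1 - q ^+ 2) * P^`()^`().[q] - 2 * q * P^`().[q].
Proof.
move=> q.
have [_ dE] := reval_off_origin (@radial_zonalE P v).
rewrite /laplace_beltrami.
under eq_bigr => i _.
  have [_ ->] := reval_off_origin (dE i); last exact: pos_neq0.
  rewrite /= !mxE !eqxx inner_pos sqrtr1 invr1 !mulr1 -/q innerC inner_delta.
  over.
have hx := inner_pos x; have hv := inner_pos v.
have hq : inner x v = q by [].
move: hx hv hq; rewrite /inner !big_ord_recl !big_ord0 !addr0.
set x0 := (x : 'rV_3) _ _; set x1 := (x : 'rV_3) _ _; set x2 := (x : 'rV_3) _ _.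
set v0 := (v : 'rV_3) _ _; set v1 := (v : 'rV_3) _ _; set v2 := (v : 'rV_3) _ _.
set P1 := P^`().[q]; set P2 := P^`()^`().[q] => hx hv hq.
pose X := x0 * x0 + (x1 * x1 + x2 * x2); pose S := x0 * v0 + (x1 * v1 + x2 * v2).
pose V := v0 * v0 + (v1 * v1 + v2 * v2).
transitivity (P1 * (q * (3 * X - 3) - 2 * S) + P2 * (q ^+ 2 * X - 2 * q * S + V)).
  by rewrite /X /S /V; ring.
by rewrite /X /S /V hx hv hq; ring.
Qed.

(** The zonal functions of [legendre R l] are eigenfunctions, by Legendre's
    equation. *)
Lemma laplace_beltrami_legendre l v x :
  laplace_beltrami (zonal (legendre R l) v) x = - mu_ R l * zonal (legendre R l) v x.
Proof. by rewrite laplace_beltrami_zonal legendre_ode. Qed.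

End ZonalHarmonics.

(** * Independence and joint measurability *)

(** The positive and the negative parts are transferred separately, so that the
    formula can serve to establish integrability. *)
Lemma integral_distribution_measurable (R : realType) d d' (Omega : measurableType d)
    (E : measurableType d') (P : probability Omega R) (X : {RV P >-> E})
    (f : E -> \bar R) : measurable_fun setT f ->
  (\int[distribution P X]_y f y = \int[P]_w f (X w))%E.
Proof.
move=> mf; rewrite integralE [RHS]integralE.
rewrite !ge0_integral_distribution//;
  [by rewrite -funepos_comp -funeneg_comp|exact: measurable_funeneg|].
exact: measurable_funepos.
Qed.

Section IndependentPair.
Context (R : realType) (d d1 d2 : measure_display) (Omega : measurableType d)
  (E1 : measurableType d1) (E2 : measurableType d2) (P : probability Omega R)
  (X : Omega -> E1) (Y : Omega -> E2).
Hypotheses (mX : measurable_fun setT X) (mY : measurable_fun setT Y).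
Hypothesis XY : forall A B, measurable A -> measurable B ->
  (P (X @^-1` A `&` Y @^-1` B) = P (X @^-1` A) * P (Y @^-1` B))%E.
Implicit Types f : E1 * E2 -> \bar R.

Let XYm : measurable_fun setT (fun w => (X w, Y w)).
Proof. exact: measurable_fun_pair. Qed.

Let X' : {mfun Omega >-> E1} := HB.pack X (isMeasurableFun.Build _ _ _ _ _ mX).
Let Y' : {mfun Omega >-> E2} := HB.pack Y (isMeasurableFun.Build _ _ _ _ _ mY).
Let XY' : {mfun Omega >-> (E1 * E2)%type} :=
  HB.pack (fun w => (X w, Y w)) (isMeasurableFun.Build _ _ _ _ _ XYm).

Let joint_law A : measurable A ->
  distribution P XY' A = (distribution P X' \x distribution P Y')%E A.
Proof. by move=> mA; apply/esym/product_measure_unique => // B C mB mC; exact: XY. Qed.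

(** The joint law is the product of the marginals, so Tonelli's theorem applies. *)
Lemma indep_ge0_integral f : measurable_fun setT f -> (forall z, 0 <= f z)%E ->
  (\int[P]_w f (X w, Y w) = \int[P]_w \int[P]_w' f (X w', Y w))%E.
Proof.
move=> mf f0.
rewrite -[LHS](@ge0_integral_distribution _ _ _ _ _ P XY')//.
rewrite (eq_measure_integral (distribution P X' \x distribution P Y')%E); last first.
  by move=> A mA _; exact: joint_law.
rewrite fubini_tonelli2// ge0_integral_distribution//=; last 2 first.
- exact: measurable_fun_fubini_tonelli_G.
- by move=> y; exact: integral_ge0.
apply: eq_integral => w _ /=.
rewrite /fubini_G ge0_integral_distribution//.
exact: measurableT_comp.
Qed.

(** A function of two independent variables can be averaged over the first one
    with the second one frozen. *)
Lemma indep_integral f : measurable_fun setT f ->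
  (\int[P]_w \int[P]_w' `|f (X w', Y w)| < +oo)%E ->
  P.-integrable setT (fun w => f (X w, Y w)) /\
  (\int[P]_w f (X w, Y w) = \int[P]_w \int[P]_w' f (X w', Y w))%E.
Proof.
move=> mf fint.
have maf : measurable_fun setT (abse \o f) by exact: measurableT_comp.
have pint : P.-integrable setT (fun w => f (X w, Y w)).
  apply/integrableP; split; first exact: (measurableT_comp mf XYm).
  by rewrite (indep_ge0_integral maf)// => z; exact: abse_ge0.
have prodint : (distribution P X' \x distribution P Y')%E.-integrable setT f.
  apply/integrable21ltyP => //.
  rewrite (integral_distribution_measurable Y'); last first.
    exact: (@measurable_fun_fubini_tonelli_G _ _ _ _ _ (distribution P X') _ maf
      (fun=> abse_ge0 _)).
  under eq_integral => w _.
    rewrite (integral_distribution_measurable X' (f := fun x => `|f (x, Y' w)|%E));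
      last by do 2 apply: measurableT_comp => //.
    over.
  exact: fint.
split=> //.
rewrite -[LHS](integral_distribution_measurable XY')//.
rewrite (eq_measure_integral (distribution P X' \x distribution P Y')%E); last first.
  by move=> A mA _; exact: joint_law.
rewrite -integral21_prod_meas1// (integral_distribution_measurable Y'); last first.
  exact: (measurable_fubini_G prodint).
apply: eq_integral => w _ /=.
rewrite /fubini_G (integral_distribution_measurable X')//.
exact: measurableT_comp.
Qed.

Lemma indep_integral_bound f (M : R) : measurable_fun setT f ->
  (forall w, \int[P]_w' `|f (X w', Y w)| <= M%:E)%E ->
  P.-integrable setT (fun w => f (X w, Y w)) /\
  (\int[P]_w f (X w, Y w) = \int[P]_w \int[P]_w' f (X w', Y w))%E.
Proof.
move=> mf fM; apply: indep_integral => //.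
have maf : measurable_fun setT (abse \o f) by exact: measurableT_comp.
have mk : measurable_fun setT (fun w => \int[P]_w' `|f (X w', Y w)|)%E.
  have mG := @measurable_fun_fubini_tonelli_G _ _ _ _ _ (distribution P X') _ maf
    (fun=> abse_ge0 _).
  have := measurableT_comp mG mY; apply: eq_measurable_fun => w _ /=.
  rewrite /fubini_G (integral_distribution_measurable X')//.
  exact: measurableT_comp.
apply: (@le_lt_trans _ _ (\int[P]_w M%:E)%E); last first.
  by rewrite integral_cst// [X in (_ * X)%E](probability_setT P) mule1 ltry.
apply: ge0_le_integral => //.
by move=> w _; apply: integral_ge0 => w' _; exact: abse_ge0.
Qed.

End IndependentPair.

Section JointMeasurability.
Context (R : realType) (d : measure_display) (Omega : measurableType d).

Lemma measurable_countable_choice d1 d2 (X : measurableType d1) (E : measurableType d2)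
    (g : nat -> Omega -> E) (N : X -> nat) (h : X -> Omega) :
  (forall k, measurable_fun setT (g k)) -> (forall k, measurable [set z | N z = k]) ->
  measurable_fun setT h -> measurable_fun setT (fun z => g (N z) (h z)).
Proof.
move=> mg mN mh _ A mA; rewrite setTI.
rewrite (_ : _ @^-1` A = \bigcup_k ([set z | N z = k] `&` (g k \o h) @^-1` A)).
  apply: bigcupT_measurable => k; apply: measurableI => //.
  by rewrite -[X in measurable X]setTI; exact: (measurableT_comp (mg k) mh).
by apply/seteqP; split=> [z Az|z [k _ [<-]]//]; exists (N z).
Qed.

(** A continuous process is the limit of its samples at the times truncn(n t) / n,
    which take countably many values; the negative times, where nothing is known
    of the process, are sent to 0. *)
Lemma measurable_continuous_process (b : R -> Omega -> R) :
  (forall t, 0 <= t -> measurable_fun setT (b t)) ->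
  (forall w, {within `[0, +oo[, continuous (fun t => b t w)}) ->
  measurable_fun setT (fun z : Omega * R => b (Num.max 0 z.2) z.1).
Proof.
move=> mb cb.
pose N n (z : Omega * R) := Num.truncn (n.+1%:R * Num.max 0 z.2).
have mN n k : measurable [set z | N n z = k].
  rewrite (_ : mkset _ = (fun z => n.+1%:R * Num.max 0 z.2) @^-1`
      `[k%:R, k.+1%:R[); last first.
    apply/seteqP; split=> z /=; rewrite in_itv/= -truncn_eq ?mulr_ge0// ?le_max ?lexx//.
      by move=> <-.
    by move/eqP.
  rewrite -[X in measurable X]setTI.
  have mm : measurable_fun setT (fun z : Omega * R => n.+1%:R * Num.max 0 z.2).
    apply: measurable_funM => //.
    by apply: (measurable_maxr (f := cst 0) (g := snd)); [|exact: measurable_snd].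
  exact: mm.
pose h n (z : Omega * R) := b ((N n z)%:R / n.+1%:R) z.1.
apply: (@measurable_fun_cvg _ _ _ _ h) => [n|z _].
  apply: (@measurable_countable_choice _ _ _ _ (fun k => b (k%:R / n.+1%:R)) (N n) fst).
  - by move=> k; apply: mb; rewrite divr_ge0.
  - exact: mN.
  - exact: measurable_fst.
set s := Num.max 0 z.2.
have s0 : 0 <= s by rewrite le_max lexx.
have /subspace_continuousP/(_ s) := cb z.1.
rewrite /= in_itv/= s0 => /(_ isT) cs.
apply: (cvg_comp (fun n => (N n z)%:R / n.+1%:R) (fun t => b t z.1) _ cs).
have N_s n : `|s - (N n z)%:R / n.+1%:R| <= n.+1%:R^-1.
  have n0 : 0 < n.+1%:R :> R by [].
  have /truncn_itv/andP[] : 0 <= n.+1%:R * s by rewrite mulr_ge0.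
  rewrite -/(N n z) => h1 h2.
  rewrite ler_norml; apply/andP; split.
    rewrite (@le_trans _ _ 0) ?oppr_le0 ?invr_ge0// subr_ge0 ler_pdivrMr//.
    by rewrite mulrC.
  rewrite lerBlDr -[X in X + _]mul1r -mulrDl ler_pdivlMr// mulrC addrC natr1.
  exact: ltW.
move=> U /= [e /= e0 eU].
near=> n; apply: eU => /=; last by rewrite in_itv/= divr_ge0.
apply: le_lt_trans (N_s n) _.
near: n.
have : (fun n => n.+1%:R^-1 : R) @ \oo --> (0 : R) by exact: cvg_harmonic.
move=> /cvgrPdist_lt/(_ e e0); apply: filterS => n.
by rewrite sub0r normrN ger0_norm.
Unshelve. all: by end_near. Qed.

End JointMeasurability.

Section SphereMeasurability.
Context (R : realType).

Lemma measurable_coords : measurable_fun setT (@coords R).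
Proof. by move=> _ A mA; rewrite setTI; exists A => //; rewrite setTI. Qed.

Lemma measurable_coord k : measurable_fun setT (fun u : sphere R => Defs.coord k u).
Proof.
have mcs : measurable_fun setT (@coords R) := measurable_coords.
have [k0|[k1|k2]] : inord k = inord 0 :> 'I_3 \/ inord k = inord 1 :> 'I_3 \/
    inord k = inord 2 :> 'I_3.
- by case: (inord k) => -[|[|[|//]]] i; [left|right; left|right; right];
    apply/val_inj; rewrite /= inordK.
- rewrite (_ : (fun u => _) = fst \o fst \o @coords R); last first.
    by apply/funext => u; rewrite /Defs.coord k0.
  by do 2 apply: measurableT_comp => //.
- rewrite (_ : (fun u => _) = snd \o fst \o @coords R); last first.
    by apply/funext => u; rewrite /Defs.coord k1.
  by do 2 apply: measurableT_comp => //.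
- rewrite (_ : (fun u => _) = snd \o @coords R); last first.
    by apply/funext => u; rewrite /Defs.coord k2.
  by apply: measurableT_comp => //.
Qed.

Lemma coordE (i : 'I_3) (u : 'rV[R]_3) : u 0 i = Defs.coord i u.
Proof. by rewrite /Defs.coord inord_val. Qed.

Lemma measurable_fun_sphere d (X : measurableType d) (f : X -> sphere R) :
  (forall i : 'I_3, measurable_fun setT (fun x => (f x : 'rV_3) 0 i)) ->
  measurable_fun setT f.
Proof.
move=> mf.
have mc : measurable_fun setT (@coords R \o f).
  by apply/measurable_fun_pair; [apply/measurable_fun_pair|]; exact: mf.
move=> _ A [B mB <-]; rewrite !setTI -comp_preimage -[X in measurable X]setTI.
exact: mc.
Qed.

Lemma measurable_zonal2 (Q : {poly R}) :
  measurable_fun setT (fun z : sphere R * sphere R => zonal Q z.2 z.1).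
Proof.
have mQ : measurable_fun setT (horner Q).
  by apply: continuous_measurable_fun; exact: continuous_horner.
apply: (measurableT_comp mQ).
rewrite /inner; apply: measurable_sum => i.
apply: measurable_funM.
  under eq_fun do rewrite coordE.
  apply: (@measurableT_comp _ _ _ _ _ _ (fun u : sphere R => Defs.coord i u) _ fst).
    exact: measurable_coord.
  exact: measurable_fst.
under eq_fun do rewrite coordE.
apply: (@measurableT_comp _ _ _ _ _ _ (fun u : sphere R => Defs.coord i u) _ snd).
    exact: measurable_coord.
  exact: measurable_snd.
Qed.

Lemma measurable_zonal (Q : {poly R}) v : measurable_fun setT (zonal Q v).
Proof. exact: (measurable_fun_pair1 v (measurable_zonal2 Q)).
Qed.

Lemma measurable_sphere_process d (Omega : measurableType d) (B : R -> Omega -> sphere R) :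
  (forall t, 0 <= t -> measurable_fun setT (B t)) ->
  (forall w, {within `[0, +oo[, continuous (fun t => B t w : 'rV[R]_3)}) ->
  measurable_fun setT (fun z : Omega * R => B (Num.max 0 z.2) z.1).
Proof.
move=> mB cB; apply: measurable_fun_sphere => i.
apply: (measurable_continuous_process (b := fun t w => (B t w : 'rV_3) 0 i)).
  move=> t t0; under eq_fun do rewrite coordE.
  apply: (@measurableT_comp _ _ _ _ _ _ (fun u : sphere R => Defs.coord i u) _ (B t)).
    exact: measurable_coord.
  exact: mB.
move=> w; apply/subspace_continuousP => s s0.
have /subspace_continuousP/(_ s s0) := cB w.
move=> /(cvg_comp _ (fun M : 'rV[R]_3 => M 0 i)); apply; exact: coord_continuous.
Qed.

End SphereMeasurability.

Section InverseSubordinatorMeasurability.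
Context (R : realType) (d : measure_display) (Omega : measurableType d).
Variables (H : R -> Omega -> R) (nu t : R).
Hypothesis ndH : forall w s u, 0 <= s -> s <= u -> H s w <= H u w.

Let passage w := [set tau | 0 < tau /\ t < H tau w].

Let passage_lb w : lbound (passage w) 0.
Proof. by move=> tau [/ltW]. Qed.

Lemma inverse_subordinator_ge0 w : 0 <= t -> 0 <= inverse_subordinator nu H t w.
Proof.
rewrite /inverse_subordinator; case: ifPn => // _ _.
rewrite -[X in inf X]/(passage w).
have [->|/set0P n0] := eqVneq (passage w) set0; first by rewrite inf0.
exact: lb_le_inf.
Qed.

Hypothesis nu1 : nu != 1.

(** The second alternative comes from the convention that the infimum of the
    empty set is 0. *)
Lemma lt_inverse_subordinator a w : 0 < a ->
  inverse_subordinator nu H t w < a <->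
  (exists2 tau, 0 < tau < a & t < H tau w) \/ (forall n : nat, H n.+1%:R w <= t).
Proof.
move=> a0; rewrite /inverse_subordinator (negbTE nu1) -[X in inf X]/(passage w).
have [e|/set0P n0] := eqVneq (passage w) set0.
  rewrite e inf0; split=> // _; right => n; rewrite leNgt; apply/negP => tH.
  by have : passage w n.+1%:R by []; rewrite e.
split=> [/(inf_lt n0)|[[tau /andP[tau0 taua] tH]|h]].
- move=> [tau [tau0 tH] taua].
  by left; exists tau => //; rewrite tau0.
- apply: le_lt_trans taua; apply: ge_inf => //; by exists 0.
- case: n0 => tau [tau0 tH]; exfalso.
  have := h (Num.truncn tau); rewrite leNgt => /negP; apply.
  apply: (lt_le_trans tH); apply: ndH; first exact: ltW.
  by apply/ltW/truncnS_gt.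
Qed.

Lemma measurable_inverse_subordinator : 0 <= t ->
  (forall s, 0 <= s -> measurable_fun setT (H s)) ->
  measurable_fun setT (inverse_subordinator nu H t).
Proof.
move=> t0 mH _; apply: (measurability _ (RGenInftyO.measurableE R)) => //.
move=> _ [_ [a ->] <-]; rewrite setTI.
have mray s : 0 <= s -> measurable [set w | t < H s w].
  move=> s0; rewrite -[X in measurable X]setTI.
  rewrite (_ : mkset _ = H s @^-1` `]t, +oo[); first exact: mH.
  by apply/seteqP; split=> w /=; rewrite in_itv/= andbT.
have [a0|a0] := leP a 0; last first.
  (* By monotonicity of H, the times tau < a can be taken in a sequence
     increasing to a. *)
  pose q n : R := a * (n.+1%:R / n.+2%:R).
  rewrite (_ : _ @^-1` _ = \bigcup_n [set w | t < H (q n) w] `|`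
      \bigcap_n ~` [set w | t < H n.+1%:R w]); last first.
    apply/seteqP; split=> w /=; rewrite in_itv/=.
      move=> /(lt_inverse_subordinator _ a0)[[tau /andP[tau0 taua] tH]|h]; last first.
        by right => n _ /=; apply/negP; rewrite -leNgt.
      left; exists (Num.truncn (a / (a - tau))) => //=.
      apply: (lt_le_trans tH); apply: ndH; first exact: ltW.
      set m := Num.truncn _.
      have h : a / (a - tau) < m.+1%:R by apply: truncnS_gt.
      rewrite ltr_pdivrMr ?subr_gt0// in h.
      rewrite /q mulrA ler_pdivlMr// -[m.+2%:R]natr1.
      by move: (m.+1%:R) h => M h; nra.
    move=> [[n _ /= tH]|h]; apply/(lt_inverse_subordinator _ a0); [left|right].
      exists (q n) => //; rewrite /q pmulr_rgt0// divr_gt0//= gtr_pMr//.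
      by rewrite ltr_pdivrMr// mul1r ltr_nat.
    by move=> n; rewrite leNgt; apply/negP/h.
  apply: measurableU.
    by apply: bigcupT_measurable => n; apply: mray; rewrite /q mulr_ge0 ?divr_ge0// ltW.
  by apply: bigcapT_measurable => n; apply: measurableC; exact: mray.
rewrite (_ : _ @^-1` _ = set0)//; apply/seteqP; split=> w //=; rewrite in_itv/=.
by rewrite ltNge (le_trans a0)// inverse_subordinator_ge0.
Qed.

End InverseSubordinatorMeasurability.

(** * The heat semigroup on zonal harmonics *)

Section HeatSemigroup.
Context (R : realType).
Local Notation lambda := (@lebesgue_measure R).

(** An integrable solution is continuous, being an integral, hence differentiable,
    and then m e^(k x) has zero derivative. *)
Lemma exp_of_integral_eq (m : R -> R) (c k : R) :
  (forall s, 0 <= s -> lambda.-integrable `[0, s] (EFin \o m)) ->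
  (forall s, 0 <= s -> m s = c - k * \int[lambda]_(r in `[0, s]) m r) ->
  forall s, 0 <= s -> m s = c * expR (- (k * s)).
Proof.
move=> im hm s; rewrite le_eqVlt => /predU1P[<-|s0].
  by rewrite hm// set_itv1 Rintegral_set1 !mulr0 oppr0 addr0 expR0 mulr1.
pose I x := \int[lambda]_(r in `[0, x]) m r.
pose m2 x := c - k * I x.
have m2E (x : R) : 0 <= x -> m2 x = m x by move=> x0; rewrite hm.
have cI : {within `[0, s], continuous I}.
  by apply: parameterized_integral_continuous; [exact: ltW|exact/im/ltW].
have cm2 : {within `[0, s], continuous m2}.
  move=> x; apply: cvgB; first exact: cvg_cst.
  by apply: cvgM; [exact: cvg_cst|exact: cI].
have near0 (x : R) : 0 < x -> \forall y \near x, m2 y = m y.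
  by move=> x0; near=> y; apply: m2E; apply/ltW; near: y; exact: lt_nbhsr.
have dI (x : R) : x \in `]0, s[ -> is_derive x 1 I (m x).
  rewrite in_itv/= => /andP[x0 xs].
  have cm : {for x, continuous m}.
    rewrite /prop_for /continuous_at -m2E; last exact: ltW.
    have : m2 @ x --> m2 x.
      by apply: (within_continuous_continuous s0 cm2); rewrite in_itv/= x0.
    by apply: cvg_trans; apply: near_eq_cvg; apply: filterS (near0 _ x0) => y ->.
  have [dIx I'x] := continuous_FTC1_closed xs (im _ (ltW s0)) x0 cm.
  by apply: DeriveDef => //; rewrite -derive1E.
pose f x := m2 x * expR (k * x).
have df (x : R) : x \in `]0, s[ -> is_derive x 1 f 0.
  move=> xs; have dIx := dI x xs.
  have x0 : 0 <= x by move: xs; rewrite in_itv/= => /andP[/ltW].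
  have dm2 : is_derive x 1 m2 (0 - k *: m x).
    exact: (is_deriveB (is_derive_cst c x 1) (is_deriveZ k dIx)).
  have de : is_derive x 1 (fun r => expR (k * r)) (expR (k * x) * (k *: 1)).
    exact: (@is_derive1_comp _ expR ( *%R k) x _ _ _ (is_deriveZ k (is_derive_id x 1))).
  apply: (is_derive_eq (is_deriveM dm2 de)).
  by rewrite /= -[_ *: (_ *: _)]/(_ * (_ * _)) -[expR _ *: _]/(_ * _) m2E//
    -[k *: 1]/(k * 1) -[k *: m x]/(k * m x); ring.
have ce : continuous (fun r => expR (k * r)).
  move=> r; apply: (@continuous_comp _ _ _ ( *%R k) expR); last exact: continuous_expR.
  by apply: cvgM; [exact: cvg_cst|exact: cvg_id].
have cf : {within `[0, s], continuous f}.
  move=> x; apply: cvgM; first exact: cm2.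
  by move: x; apply: continuous_subspaceT.
have [z _] := MVT s0 df cf; rewrite mul0r => /eqP; rewrite subr_eq0 => /eqP.
rewrite /f m2E ?ltW// mulr0 expR0 mulr1.
rewrite (_ : m2 0 = c); last by rewrite m2E// hm// set_itv1 Rintegral_set1 mulr0 subr0.
by rewrite expRN => <-; rewrite mulfK// gt_eqF// expR_gt0.
Unshelve. all: by end_near. Qed.

Lemma zonal_legendre_le1 l (v u : sphere R) : `|zonal (legendre R l) v u| <= 1.
Proof. exact/legendre_le1/inner_sphere_le1. Qed.

Context (d : measure_display) (Omega : measurableType d) (P : probability Omega R).

Lemma bounded_probability_integrable (f : Omega -> R) M :
  measurable_fun setT f -> (forall w, `|f w| <= M) -> P.-integrable setT (EFin \o f).
Proof.
move=> mf fM; apply: measurable_bounded_integrable => //.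
  by rewrite [X in (X < _)%E](probability_setT P) ltry.
exists M; split; first exact: num_real.
by move=> x Mx w _; apply: le_trans (fM w) _; exact: ltW.
Qed.

(** Exchanges the expectation with the time integral of the martingale problem:
    restricted to the times of [0, s], a bounded process is integrable for the
    product measure. *)
Lemma Fubini_bounded_process (G : Omega * R -> R) s : 0 <= s ->
  measurable_fun setT G -> (forall z, `|G z| <= 1) ->
  [/\ P.-integrable setT (fun w => (\int[lambda]_(r in `[0%R, s]) G (w, r))%R%:E),
      lambda.-integrable `[0, s] (fun r => (\int[P]_w G (w, r))%R%:E) &
      (\int[P]_w (\int[lambda]_(r in `[0%R, s]) G (w, r))%R%:E =
       (\int[lambda]_(r in `[0%R, s]) \int[P]_w G (w, r))%R%:E)%E].
Proof.
move=> s0 mG G1.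
have lamS : (lambda `[0%R, s] < +oo)%E.
  by rewrite lebesgue_measure_itv/=; case: ifP => _; rewrite ?ltry// -EFinB ltry.
pose F : Omega * R -> \bar R := (EFin \o G) \_ (setT `*` `[0, s]).
have mF : measurable_fun setT F.
  apply/(measurable_restrictT _ _).1; first exact: measurableX.
  by apply: measurable_funTS; exact: measurableT_comp.
have maF : measurable_fun setT (abse \o F) by exact: measurableT_comp.
have FE w : (fun r => F (w, r)) = (fun r => (G (w, r))%:E) \_ `[0, s].
  by apply/funext => r; rewrite /F !patchE in_setX in_setT.
have iw w : lambda.-integrable `[0, s] (EFin \o (fun r => G (w, r))).
  apply: measurable_bounded_integrable => //=.
  - apply: measurable_funTS; exact: (measurable_fun_pair2 w mG).
  - exists 1; split; first exact: num_real.
    by move=> y y1 z _; apply: le_trans (G1 _) _; exact: ltW.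
have ir r : P.-integrable setT (fun w => (G (w, r))%:E).
  apply: (@bounded_probability_integrable _ 1) => //.
  exact: (measurable_fun_pair1 r mG).
have intF w : (\int[lambda]_r F (w, r) = (\int[lambda]_(r in `[0%R, s]) G (w, r))%R%:E)%E.
  rewrite FE -integral_mkcond /Rintegral fineK//.
  exact: (integrable_fin_num _ (iw w)).
have iF : (P \x lambda)%E.-integrable setT F.
  apply/integrable12ltyP => //.
  apply: (@le_lt_trans _ _ (\int[P]_w (cst (lambda `[0%R, s]) w))%E).
    apply: ge0_le_integral => //.
    - by move=> w _; exact: integral_ge0.
    - have h := @measurable_fun_fubini_tonelli_F _ _ _ _ _ lambda (abse \o F) maF
        (fun=> abse_ge0 _).
      exact: h.
    - move=> w _ /=.
      have -> : (fun r => `|F (w, r)|%E) = (fun r => `|(G (w, r))%:E|%E) \_ `[0, s].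
        apply/funext => r; rewrite /F !patchE in_setX in_setT /=.
        by case: ifP => // _; exact: abse0.
      rewrite -integral_mkcond -[leRHS]mul1e.
      apply: integral_le_bound => //; last by apply: aeW => r _; rewrite lee_fin.
      exact: (measurable_int lambda (iw w)).
  by rewrite integral_cst// [X in (_ * X)%E](probability_setT P) mule1.
have mE r : r \in `[0, s] -> (\int[P]_w F (w, r) = (\int[P]_w G (w, r))%R%:E)%E.
  move=> r0s; rewrite /Rintegral fineK; last exact: (integrable_fin_num measurableT (ir r)).
  by apply: eq_integral => w _; rewrite /F patchE in_setX in_setT mem_set.
have im : lambda.-integrable `[0, s] (fun r => (\int[P]_w G (w, r))%R%:E).
  apply: measurable_bounded_integrable => //=.
    have mfine : measurable_fun setT (@fine R) by [].
    have := measurableT_comp mfine (measurable_fubini_G iF).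
    move=> /(measurable_funTS (D := `[0, s])); apply: eq_measurable_fun => r rs.
    by rewrite /fubini_G /= mE//; move: rs; rewrite inE.
  exists 1; split; first exact: num_real.
  move=> y y1 r _ /=; apply: le_trans (ltW y1).
  apply: (le_trans (le_normr_Rintegral measurableT (ir r))).
  have -> : 1 = \int[P]_(w in setT) (1 : R).
    by rewrite Rintegral_cst// mul1r [X in fine X](probability_setT P).
  apply: le_Rintegral => //.
  - exact: (integrable_norm (ir r)).
  - exact: finite_measure_integrable_cst.
split=> //.
- have := integrable_fubini_F iF; congr (_.-integrable _ _); apply/funext => w.
  exact: intF.
- under eq_integral do rewrite -intF.
  rewrite (Fubini iF) [in RHS]/Rintegral fineK; last exact: integrable_fin_num im.
  rewrite [RHS]integral_mkcond; apply: eq_integral => r _; rewrite patchE.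
  case: ifPn => rs; first by rewrite mE//; move: rs; rewrite inE.
  rewrite integral0_eq// => w _.
  by rewrite /F patchE in_setX (negbTE rs) andbF.
Qed.

(** As g is an eigenfunction of the generator, the martingale of the martingale
    problem is g(B_u) - g(x) + mu_l int_0^u g(B_r) dr; its mean vanishes, which
    is an integral equation for E g(B_u). *)
Lemma expectation_zonal_brownian l (v x : sphere R) (B : R -> Omega -> sphere R) s :
  sphere_brownian_motion P x B -> 0 <= s ->
  (\int[P]_w (zonal (legendre R l) v (B s w))%:E =
   (expR (- (mu_ R l * s)) * zonal (legendre R l) v x)%:E)%E.
Proof.
move=> [mB B0 cB mart] s0.
set g := zonal (legendre R l) v.
pose G (z : Omega * R) := g (B (Num.max 0 z.2) z.1).
have mG : measurable_fun setT G.
  exact: (measurableT_comp (measurable_zonal _ v) (measurable_sphere_process mB cB)).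
have G1 z : `|G z| <= 1 by exact: zonal_legendre_le1.
have GE r w : 0 <= r -> G (w, r) = g (B r w) by move=> r0; rewrite /G/= max_r.
pose m r := \int[P]_w G (w, r).
have iG r : P.-integrable setT (fun w => (G (w, r))%:E).
  apply: (@bounded_probability_integrable _ 1) => //.
  exact: (measurable_fun_pair1 r mG).
have mE r : 0 <= r -> (\int[P]_w (g (B r w))%:E = (m r)%:E)%E.
  move=> r0; rewrite /m /Rintegral fineK; last exact: (integrable_fin_num measurableT (iG r)).
  by apply: eq_integral => w _; rewrite GE.
rewrite mE//; congr EFin; rewrite [RHS]mulrC -mulNr mulNr.
apply: exp_of_integral_eq => // r r0; first by have [] := Fubini_bounded_process r0 mG G1.
have [iI _ FI] := Fubini_bounded_process r0 mG G1.
have [_ iM martM] := mart _ (C2_zonal (legendre R l) v).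
have Mr u w : 0 <= u -> g (B u w) - g (B 0 w) - \int[lambda]_(r in `[0, u])
    laplace_beltrami g (B r w) =
    G (w, u) - g x + mu_ R l * \int[lambda]_(r in `[0, u]) G (w, r).
  move=> u0; rewrite B0 GE//.
  have iw : lambda.-integrable `[0, u] (EFin \o (fun r => G (w, r))).
    apply: measurable_bounded_integrable => //=.
    - by rewrite lebesgue_measure_itv/=; case: ifP => _; rewrite ?ltry// -EFinB ltry.
    - apply: measurable_funTS; exact: (measurable_fun_pair2 w mG).
    - exists 1; split; first exact: num_real.
      by move=> y y1 z _; apply: le_trans (G1 _) _; exact: ltW.
  have -> : \int[lambda]_(r in `[0, u]) laplace_beltrami g (B r w) =
      \int[lambda]_(r in `[0, u]) (- mu_ R l * G (w, r)).
    apply: eq_Rintegral => z; rewrite inE/= in_itv/= => /andP[z0 _].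
    by rewrite laplace_beltrami_legendre GE.
  by rewrite RintegralZl// mulNr opprK.
have FT : sigma_process `[0, 0] B setT.
  have [h0 hC _] := smallest_sigma_algebra setT
    (\bigcup_(i in `[0, 0]) preimage_set_system setT (B i) measurable).
  by rewrite -[setT]setD0; exact: hC.
have := martM 0 r (lexx 0) r0 setT FT.
under eq_integral do rewrite Mr//.
under [in X in _ = X -> _]eq_integral do rewrite Mr// set_itv1 Rintegral_set1 mulr0 addr0
  GE// B0 subrr.
rewrite integral0.
have ig : P.-integrable setT (fun w => (G (w, r) - g x)%:E).
  exact: (integrableB measurableT (iG r) (finite_measure_integrable_cst P (g x) measurableT)).
have iI' : P.-integrable setT
    (fun w => (mu_ R l * \int[lambda]_(r0 in `[0, r]) G (w, r0))%:E).
  exact: (integrableZl measurableT _ iI).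
rewrite integralD_EFin// integralB_EFin//;
  [|exact: (iG r)|exact: finite_measure_integrable_cst].
rewrite /=; under [X in (_ + X)%E]eq_integral do rewrite EFinM.
rewrite integralZl// FI integral_cst// [X in (_ * X)%E](probability_setT P) mule1.
rewrite [X in (X - _ + _)%E](_ : _ = (m r)%:E); last first.
  by rewrite /m /Rintegral fineK//; exact: (integrable_fin_num measurableT (iG r)).
by rewrite -EFinB -EFinM -EFinD => -[h]; apply/eqP; rewrite -subr_eq0; apply/eqP;
  apply: etrans h; ring.
Qed.

End HeatSemigroup.

(** * The Gamma integral *)

Section GammaIntegral.
Context (R : realType).
Local Notation lambda := (@lebesgue_measure R).
Implicit Types (q c k b : R).

Lemma continuous_powR q x : 0 < x -> {for x, continuous (@powR R ^~ q)}.
Proof.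
by move=> x0; apply/differentiable_continuous/derivable1_diffP; have [] := is_derive1_powR q x0.
Qed.

Lemma integral_powR_segment q a b : 0 < q -> 0 < a -> a < b ->
  (\int[lambda]_(s in `[a, b]) (s `^ (q - 1))%:E = (b `^ q / q - a `^ q / q)%:E)%E.
Proof.
move=> q0 a0 ab.
have d (x : R) : 0 < x -> is_derive x 1 (fun s => s `^ q / q) (x `^ (q - 1)).
  move=> x0; have D := is_derive1_powR q x0.
  have -> : (fun s => s `^ q / q) = q^-1 *: (@powR R ^~ q).
    by apply/funext => s /=; rewrite mulrC.
  apply: is_derive_eq (is_deriveZ q^-1 D) _.
  by rewrite -[_ *: _]/(_ * _) mulKf// gt_eqF.
have cF (x : R) : 0 < x -> {for x, continuous (fun s => s `^ q / q)}.
  by move=> x0; apply/differentiable_continuous/derivable1_diffP; have [] := d x x0.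
rewrite (@continuous_FTC2 _ _ (fun s => s `^ q / q) a b)//.
- apply: continuous_in_subspaceT => x; rewrite inE/= in_itv/= => /andP[ax _].
  by apply: continuous_powR; exact: lt_le_trans ax.
- split.
  + move=> x; rewrite in_itv/= => /andP[ax _].
    by have [] := d x (lt_trans a0 ax).
  + by apply: cvg_at_right_filter; exact: cF.
  + by apply: cvg_at_left_filter; apply: cF; exact: lt_trans ab.
- move=> x; rewrite in_itv/= => /andP[ax _].
  by rewrite derive1E; have [_ ->] := d x (lt_trans a0 ax).
Qed.

Lemma integral_powR0 q b : 0 < q -> 0 < b ->
  (\int[lambda]_(s in `]0%R, b]) (s `^ (q - 1))%:E = (b `^ q / q)%:E)%E.
Proof.
move=> q0 b0.
(* The integrand is unbounded at 0 when q < 1. The lower ends e n decrease to 0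
   and are chosen so that their q-th powers are rational multiples of b^q. *)
pose e n : R := (b `^ q / n.+2%:R) `^ q^-1.
have bq0 : 0 < b `^ q by exact: powR_gt0.
have e0 n : 0 < e n by apply: powR_gt0; rewrite divr_gt0.
have eq n : e n `^ q = b `^ q / n.+2%:R.
  by rewrite /e -powRrM mulVf ?gt_eqF// powRr1// divr_ge0// ltW.
have le_e n x : 0 < x -> (e n <= x) = (b `^ q / n.+2%:R <= x `^ q).
  move=> x0; rewrite -eq; apply/idP/idP => h.
    by apply: (ge0_ler_powR (ltW q0)) => //; rewrite nnegrE ltW.
  rewrite leNgt; apply/negP => xe.
  by move: h; rewrite leNgt gt0_ltr_powR// nnegrE ltW.
have eb n : e n < b.
  rewrite ltNge; apply/negP => be.
  have : b `^ q <= e n `^ q by apply: (ge0_ler_powR (ltW q0)) => //; rewrite nnegrE ltW.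
  by rewrite eq ler_pdivlMr// ger_pMr// lern1.
have m s : measurable_fun s (fun s => (s `^ (q - 1))%:E : \bar R).
  by apply/measurable_EFinP; apply: measurable_funTS; exact: measurable_powR.
have := @ge0_nondecreasing_set_cvg_integral _ (measurableTypeR R) R (fun n => `[e n, b]%classic)
  (fun s => (s `^ (q - 1))%:E) lambda.
have -> : \bigcup_i `[e i, b]%classic = `]0, b]%classic.
  apply/seteqP; split=> [x [n _]|x] /=; rewrite !in_itv/=.
    by move=> /andP[ex ->]; rewrite (lt_le_trans (e0 n)).
  move=> /andP[x0 xb].
  have xq0 : 0 < x `^ q by exact: powR_gt0.
  exists (Num.truncn (b `^ q / x `^ q)) => //=; rewrite in_itv/= xb andbT le_e//.
  rewrite ler_pdivrMr// mulrC -ler_pdivrMr//.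
  by apply/ltW/(lt_le_trans (truncnS_gt _)); rewrite ler_nat.
move=> H.
have {}H : (\int[lambda]_(x in `[e n, b]) (x `^ (q - 1))%:E)%E @[n --> \oo] -->
    (\int[lambda]_(x in `]0%R, b]) (x `^ (q - 1))%:E)%E.
  apply: H => //.
  - apply/nondecreasing_seqP => n; apply/subsetPset => x /=; rewrite !in_itv/=.
    move=> /andP[ex ->]; rewrite andbT.
    have x0 := lt_le_trans (e0 n) ex.
    move: ex; rewrite !le_e//; apply: le_trans.
    by rewrite ler_pM2l// lef_pV2 ?posrE// ler_nat.
  - by move=> n; exact: m.
  - by move=> n x _; rewrite lee_fin powR_ge0.
have <- := cvg_lim (@ereal_hausdorff R) H; apply: cvg_lim => //.
under eq_fun do rewrite integral_powR_segment// eq.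
apply: cvg_EFin; first exact: nearW.
rewrite (_ : fine \o _ = (fun n => b `^ q / q - b `^ q / q * n.+2%:R^-1)); last first.
  by apply/funext => n /=; rewrite mulrAC.
rewrite -[X in _ --> X]subr0; apply: cvgB; first exact: cvg_cst.
rewrite -[X in _ --> X](mulr0 (b `^ q / q)); apply: cvgMr.
have := @cvg_harmonic R; rewrite -(cvg_shiftS (@harmonic R)); exact.
Qed.

Lemma measurable_expRN : measurable_fun setT (fun u : R => expR (- u)).
Proof.
apply: continuous_measurable_fun => x.
by apply: continuous_comp; [exact: continuousN|exact: continuous_expR].
Qed.

Lemma integral_expRN_tail (y : R) :
  (\int[lambda]_(u in `[y, +oo[) (expR (- u))%:E = (expR (- y))%:E)%E.
Proof.
have d (x : R) : is_derive x 1 (fun u => - expR (- u)) (expR (- x)).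
  have dN : is_derive x 1 (fun u => expR (- u)) (expR (- x) * - 1).
    exact: (@is_derive1_comp _ expR -%R x _ _ _ (is_deriveNid x 1)).
  apply: (is_derive_eq (is_deriveN dN)).
  by rewrite mulrN1 opprK.
have cE : continuous (fun u : R => expR (- u)).
  by move=> x; apply: continuous_comp; [exact: continuousN|exact: continuous_expR].
rewrite (@ge0_continuous_FTC2y _ _ (fun u => - expR (- u)) _ 0)//.
- by rewrite EFinN oppeK add0e.
- exact: continuous_subspaceT.
- rewrite -[X in _ --> X]oppr0; apply: cvgN; exact: cvgr_expR.
- by apply: cvgN; apply: cvg_at_right_filter; exact: cE.
- by move=> x _; rewrite derive1E; have [_ ->] := d x.
Qed.

(** Both sides are the integral of s^(q-1) e^(-u) over the region c s^k <= u:
    integrating first in u produces e^(-c s^k), first in s the power of u. With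
    suitable parameters this is the functional equation of the Gamma function,
    its scaling rule, and the Mellin transform of a stable law. *)
Lemma integral_powR_expR q c k : 0 < q -> 0 < c -> 0 < k ->
  (\int[lambda]_(s in `]0%R, +oo[) (s `^ (q - 1) * expR (- (c * s `^ k)))%:E =
   (c `^ (- (q / k)) / q)%:E *
   \int[lambda]_(u in `]0%R, +oo[) (u `^ (q / k) * expR (- u))%:E)%E.
Proof.
move=> q0 c0 k0.
pose K (z : R * R) : \bar R :=
  if (0 < z.1) && (c * z.1 `^ k <= z.2) then (z.1 `^ (q - 1) * expR (- z.2))%:E else 0%E.
have mp a : measurable_fun setT (fun z : R * R => z.1 `^ a).
  by apply: (measurableT_comp (measurable_powR a)); exact: measurable_fst.
have mK : measurable_fun setT K.
  apply: measurable_fun_ifT.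
  - apply: measurable_and.
      by apply: measurable_fun_ltr => //; exact: measurable_fst.
    apply: measurable_fun_ler; last exact: measurable_snd.
    by apply: measurable_funM.
  - apply/measurable_EFinP; apply: measurable_funM => //.
    exact: (measurableT_comp measurable_expRN measurable_snd).
  - exact: measurable_cst.
have K0 z : (0 <= K z)%E.
  by rewrite /K; case: ifP => // _; rewrite lee_fin mulr_ge0 ?powR_ge0 ?expR_ge0.
have inner1 s : (\int[lambda]_u K (s, u) =
    ((fun s => (s `^ (q - 1) * expR (- (c * s `^ k)))%:E) \_ `]0%R, +oo[) s)%E.
  rewrite patchE mem_setE/= in_itv/= andbT; case: ifPn => s0; last first.
    by apply: integral0_eq => u _; rewrite /K/= (negbTE s0).
  transitivity (\int[lambda]_(u in `[(c * s `^ k)%R, +oo[)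
      ((s `^ (q - 1))%:E * (expR (- u))%:E))%E.
    rewrite [RHS]integral_mkcond; apply: eq_integral => u _.
    by rewrite patchE mem_setE/= in_itv/= andbT /K/= s0/=.
  rewrite ge0_integralZl_EFin; last exact: powR_ge0.
  - by rewrite integral_expRN_tail -EFinM.
  - exact: measurable_itv.
  - by move=> u _; rewrite lee_fin expR_ge0.
  - apply/measurable_EFinP; apply: measurable_funTS; exact: measurable_expRN.
rewrite [LHS]integral_mkcond; under eq_integral do rewrite -inner1.
rewrite (@fubini_tonelli _ _ _ _ R lambda lambda K mK K0) => {inner1}.
pose b u : R := (u / c) `^ k^-1.
have inner2 u : (\int[lambda]_s K (s, u) =
    (c `^ (- (q / k)) / q)%:E *
    ((fun u => (u `^ (q / k) * expR (- u))%:E) \_ `]0%R, +oo[) u)%E.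
  rewrite patchE mem_setE/= in_itv/= andbT; case: ifPn => u0; last first.
    rewrite mule0; apply: integral0_eq => s _; rewrite /K/=.
    case: ifPn => // /andP[s0 h]; exfalso; move/negP: u0; apply.
    by apply: lt_le_trans h; rewrite mulr_gt0 ?powR_gt0.
  have uc0 : 0 < u / c by rewrite divr_gt0.
  have b0 : 0 < b u by exact: powR_gt0.
  have bk : b u `^ k = u / c by rewrite /b -powRrM mulVf ?gt_eqF// powRr1// ltW.
  transitivity (\int[lambda]_(s in `]0%R, b u])
      ((expR (- u))%:E * (s `^ (q - 1))%:E))%E.
    rewrite [RHS]integral_mkcond; apply: eq_integral => s _.
    rewrite patchE mem_setE/= in_itv/= /K/=; case: (ltP 0 s) => //= s0.
    have -> : (c * s `^ k <= u) = (s <= b u).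
      rewrite mulrC -ler_pdivlMr// -bk; apply/idP/idP => h; last first.
        by apply: (ge0_ler_powR (ltW k0)) => //; rewrite nnegrE ltW.
      rewrite leNgt; apply/negP => xe.
      by move: h; rewrite leNgt gt0_ltr_powR// nnegrE ltW.
    by case: ifP => // _; rewrite -EFinM mulrC.
  rewrite ge0_integralZl_EFin; last exact: expR_ge0.
  - rewrite integral_powR0// -!EFinM; congr EFin.
    rewrite /b -powRrM mulrC [_ * q]mulrC powRM ?invr_ge0 ?ltW//.
    by rewrite -[c^-1]powR_inv1 ?ltW// -powRrM mulN1r -!mulrA; ring.
  - exact: measurable_itv.
  - by move=> s _; rewrite lee_fin powR_ge0.
  - apply/measurable_EFinP; apply: measurable_funTS; exact: measurable_powR.
under eq_integral do rewrite inner2.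
rewrite ge0_integralZl_EFin; last by rewrite divr_ge0 ?powR_ge0// ltW.
- by rewrite -integral_mkcond.
- exact: measurableT.
- move=> u _; rewrite patchE; case: ifP => // _.
  by rewrite lee_fin mulr_ge0 ?powR_ge0 ?expR_ge0.
- apply/(measurable_restrictT _ _).1 => //.
  apply/measurable_EFinP; apply: measurable_funTS; apply: measurable_funM.
    exact: measurable_powR.
  exact: measurable_expRN.
Qed.

End GammaIntegral.

Section GammaFunction.
Context (R : realType).
Local Notation lambda := (@lebesgue_measure R).
Implicit Types (q c k : R).

(** Gamma (q + 1), as an extended real: the functional equation comes out of
    Tonelli's theorem and itself yields finiteness. *)
Definition gamma_integral q : \bar R :=
  (\int[lambda]_(u in `]0%R, +oo[) (u `^ q * expR (- u))%:E)%E.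

Lemma measurable_gamma_integrand q (D : set R) :
  measurable_fun D (fun u : R => (u `^ q * expR (- u))%:E).
Proof.
apply/measurable_EFinP/measurable_funTS; apply: measurable_funM.
  exact: measurable_powR.
exact: measurable_expRN.
Qed.

Lemma gamma_integral_ge0 q : (0 <= gamma_integral q)%E.
Proof. by apply: integral_ge0 => u _; rewrite lee_fin mulr_ge0 ?powR_ge0 ?expR_ge0. Qed.

Lemma gamma_integralS q : 0 < q ->
  gamma_integral q = (q%:E * gamma_integral (q - 1))%E.
Proof.
move=> q0; have := integral_powR_expR q0 ltr01 ltr01.
rewrite powR1 divr1 div1r => h.
have -> : gamma_integral (q - 1) = (q^-1%:E * gamma_integral q)%E.
  rewrite -h; apply: eq_integral => s; rewrite inE/= in_itv/= andbT => s0.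
  by rewrite powRr1 ?ltW// mul1r.
by rewrite muleA -EFinM divff ?gt_eqF// mul1e.
Qed.

Lemma gamma_integral_nat (n : nat) : gamma_integral n%:R = (n`!%:R)%:E.
Proof.
elim: n => [|n IH]; last first.
  by rewrite gamma_integralS// -natr1 addrK IH -EFinM natr1 factS natrM.
rewrite /gamma_integral.
under eq_integral do rewrite powRr0 mul1r.
rewrite integral_itv_obnd_cbnd; last first.
  by apply/measurable_EFinP/measurable_funTS; exact: measurable_expRN.
by rewrite integral_expRN_tail oppr0 expR0.
Qed.

(** u^q <= 1 + u^n for an integer n > q, and the right-hand side integrates to
    1 + n!. *)
Lemma gamma_integral_lty q : 0 <= q -> (gamma_integral q < +oo)%E.
Proof.
move=> q0; pose n := (Num.truncn q).+1.
apply: (@le_lt_trans _ _ (gamma_integral 0%:R + gamma_integral n%:R)%E); last first.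
  by rewrite !gamma_integral_nat -EFinD ltry.
rewrite /gamma_integral -ge0_integralD//; first last.
- exact: measurable_gamma_integrand.
- by move=> u _; rewrite lee_fin mulr_ge0 ?powR_ge0 ?expR_ge0.
- exact: measurable_gamma_integrand.
- by move=> u _; rewrite lee_fin mulr_ge0 ?powR_ge0 ?expR_ge0.
apply: ge0_le_integral => //.
- by move=> u _; rewrite lee_fin mulr_ge0 ?powR_ge0 ?expR_ge0.
- exact: measurable_gamma_integrand.
- by apply: emeasurable_funD; exact: measurable_gamma_integrand.
move=> u /=; rewrite in_itv/= andbT => u0.
rewrite -EFinD lee_fin -mulrDl ler_wpM2r ?expR_ge0// powRr0.
have [u1|u1] := leP 1 u.
  rewrite (@le_trans _ _ (u `^ n%:R)) ?lerDr//.
  by apply: ler_powR => //; exact/ltW/truncnS_gt.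
rewrite (@le_trans _ _ 1) ?lerDl ?powR_ge0//.
by rewrite -(powRr0 u) ger_powR// u0 ltW.
Qed.

Lemma gamma_integralE q : 0 <= q -> gamma_integral q = (Defs.Gamma (1 + q))%:E.
Proof.
move=> q0; rewrite /Defs.Gamma addrC addKr /Rintegral fineK//.
by rewrite ge0_fin_numE ?gamma_integral_lty ?gamma_integral_ge0.
Qed.

Lemma Gamma_nat (n : nat) : Defs.Gamma (1 + n%:R) = n`!%:R :> R.
Proof. by have := gamma_integralE (ler0n R n); rewrite gamma_integral_nat => -[]. Qed.

(** Restricting the integral to [A, A + 1] shows that Gamma (1 + q) outgrows every
    exponential A^q; this is what makes the Mittag-Leffler series converge. *)
Lemma Gamma_lower_bound q (A : R) : 0 <= q -> 0 < A ->
  A `^ q * expR (- (A + 1)) <= Defs.Gamma (1 + q).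
Proof.
move=> q0 A0; rewrite -lee_fin -gamma_integralE//.
apply: (@le_trans _ _
    (\int[lambda]_(u in `[A, (A + 1)%R]) (A `^ q * expR (- (A + 1)))%:E)%E).
  have l1 : lambda `[A, A + 1] = 1%E.
    by rewrite lebesgue_measure_itv/= lte_fin ltrDl ltr01 -EFinB addrC addKr.
  by rewrite integral_cst// [X in (_ * X)%E]l1 mule1.
apply: (@le_trans _ _
    (\int[lambda]_(u in `[A, (A + 1)%R]) (u `^ q * expR (- u))%:E)%E).
  apply: ge0_le_integral => //.
  - by move=> u _; rewrite lee_fin mulr_ge0 ?powR_ge0 ?expR_ge0.
  - exact: measurable_gamma_integrand.
  move=> u /=; rewrite in_itv/= => /andP[Au uA].
  rewrite lee_fin ler_pM ?powR_ge0 ?expR_ge0// ?ler_expR ?lerN2//.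
  by apply: ge0_ler_powR => //; rewrite nnegrE ltW// (lt_le_trans A0).
apply: ge0_subset_integral => //.
- exact: measurable_gamma_integrand.
- by move=> u _; rewrite lee_fin mulr_ge0 ?powR_ge0 ?expR_ge0.
- by move=> u /=; rewrite !in_itv/= andbT => /andP[Au _]; exact: lt_le_trans Au.
Qed.

Lemma Gamma_gt0 q : 0 <= q -> 0 < Defs.Gamma (1 + q).
Proof.
move=> q0; apply: lt_le_trans (Gamma_lower_bound q0 ltr01).
by rewrite mulr_gt0 ?powR_gt0 ?expR_gt0.
Qed.

Lemma mittag_leffler1 (z : R) : mittag_leffler 1 z = expR z.
Proof.
rewrite /mittag_leffler /expR; congr (limn (series _)); apply/funext => n.
by rewrite mulr1 Gamma_nat exp_coeffE mulrC.
Qed.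

End GammaFunction.

(** * Laws determined by their Laplace transforms *)

Section BoundedConvergence.
Context (R : realType) (d : measure_display) (Omega : measurableType d)
  (P : probability Omega R).

Lemma bounded_convergence (f_ : nat -> Omega -> R) (f : Omega -> R) M :
  (forall n, measurable_fun setT (f_ n)) -> (forall n w, `|f_ n w| <= M) ->
  (forall w, f_ ^~ w @ \oo --> f w) ->
  (\int[P]_w (f_ n w)%:E)%E @[n --> \oo] --> (\int[P]_w (f w)%:E)%E.
Proof.
move=> mf bf cf.
have [] // := @dominated_convergence _ _ _ P setT measurableT (fun n w => (f_ n w)%:E)
  (EFin \o f) (cst M%:E).
- by move=> n; exact/measurable_EFinP.
- apply/measurable_EFinP; apply: (measurable_fun_cvg mf) => w _; exact: cf.
- by apply: aeW => w _; apply: cvg_EFin; [exact: nearW|exact: cf].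
- exact: finite_measure_integrable_cst.
- by apply: aeW => w n _; rewrite lee_fin.
Qed.

Lemma integral_bool_measure (A : set Omega) (b : Omega -> bool) : measurable A ->
  (forall w, A w <-> b w) -> (\int[P]_w (b w)%:R%:E = P A)%E.
Proof.
move=> mA Ab; rewrite -[in RHS](setIT A) -integral_indic//.
apply: eq_integral => w _; rewrite indicE; congr (_%:R%:E); congr nat_of_bool.
by apply/idP/idP => [/Ab h|]; [rewrite inE|rewrite inE => /Ab].
Qed.

End BoundedConvergence.

Lemma series_exp_coeff_le (R : realType) (z : R) N :
  `|series (exp_coeff z) N| <= expR `|z|.
Proof.
have h : `|series (exp_coeff z) N| <= series (exp_coeff `|z|) N.
  rewrite seriesEord; apply: (le_trans (ler_norm_sum _ _ _)); rewrite seriesEord.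
  by apply: ler_sum => k _; rewrite !exp_coeffE normrM normrX ger0_norm ?invr_ge0.
apply: (le_trans h); rewrite /expR; apply: nondecreasing_cvgn_le.
  by apply: nondecreasing_series => k _ _; exact: exp_coeff_ge0.
exact: is_cvg_series_exp_coeff.
Qed.

Section LaplaceUniqueness.
Context (R : realType) (d : measure_display) (Omega : measurableType d)
  (P : probability Omega R) (X Y : Omega -> R).
Hypotheses (mX : measurable_fun setT X) (mY : measurable_fun setT Y).

Section Nonnegative.
Hypotheses (X0 : forall w, 0 <= X w) (Y0 : forall w, 0 <= Y w).

Let same (f : R -> R) := (\int[P]_w (f (X w))%:E = \int[P]_w (f (Y w))%:E)%E.

Let same_lim (f_ : nat -> R -> R) f M :
  (forall n, measurable_fun setT (f_ n)) ->
  (forall n x, 0 <= x -> `|f_ n x| <= M) ->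
  (forall x, 0 <= x -> f_ ^~ x @ \oo --> f x) ->
  (forall n, same (f_ n)) -> same f.
Proof.
move=> mf bf cf sf.
have cX : (\int[P]_w (f_ n (X w))%:E)%E @[n --> \oo] --> (\int[P]_w (f (X w))%:E)%E.
  apply: (@bounded_convergence _ _ _ _ (fun n w => f_ n (X w)) _ M) => [n|n w|w].
  - exact: (measurableT_comp (mf n)).
  - exact: bf.
  - exact: cf.
have cY : (\int[P]_w (f_ n (Y w))%:E)%E @[n --> \oo] --> (\int[P]_w (f (Y w))%:E)%E.
  apply: (@bounded_convergence _ _ _ _ (fun n w => f_ n (Y w)) _ M) => [n|n w|w].
  - exact: (measurableT_comp (mf n)).
  - exact: bf.
  - exact: cf.
rewrite /same -(cvg_lim (@ereal_hausdorff R) cX) -(cvg_lim (@ereal_hausdorff R) cY).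
by congr (limn _); apply/funext => n; exact: sf.
Qed.

Let same_sum N (c : nat -> R) (e : nat -> R -> R) :
  (forall k, measurable_fun setT (e k)) -> (forall k x, 0 <= x -> `|e k x| <= 1) ->
  (forall k, same (e k)) -> same (fun x => \sum_(k < N) c k * e k x).
Proof.
move=> me be se.
have E (Z : Omega -> R) : measurable_fun setT Z -> (forall w, 0 <= Z w) ->
    (\int[P]_w (\sum_(k < N) c k * e k (Z w))%:E =
     \sum_(k < N) (c k)%:E * \int[P]_w (e k (Z w))%:E)%E.
  move=> mZ Z0.
  have ie k : P.-integrable setT (fun w => (e k (Z w))%:E).
    apply: (@bounded_probability_integrable _ _ _ P (fun w => e k (Z w)) 1).
      exact: (measurableT_comp (me k)).
    by move=> w; exact: be.
  under eq_integral do rewrite -sumEFin.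
  rewrite integral_sum//=; last first.
    by move=> k; under eq_fun do rewrite EFinM; exact: integrableZl.
  apply: eq_bigr => k _.
  by under eq_integral do rewrite EFinM; rewrite integralZl.
rewrite /same E// E//; apply: eq_bigr => k _; by rewrite se.
Qed.

Hypothesis XY : forall n : nat, same (fun x => expR (- (n%:R * x))).

(** exp (- e^(n (a - x))) is a power series in e^(-n x), so its mean only depends
    on the Laplace transform at the multiples of n. *)
Let same_double_exp (a : R) (n : nat) : same (fun x => expR (- expR (n%:R * (a - x)))).
Proof.
pose z x := - expR (n%:R * (a - x)).
have zE x : z x = - expR (n%:R * a) * expR (- (n%:R * x)).
  by rewrite /z mulrBr expRD mulNr.
pose c k := (- expR (n%:R * a)) ^+ k / k`!%:R.
pose e (k : nat) (x : R) := expR (- ((n * k)%:R * x)).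
have sE N (x : R) : series (exp_coeff (z x)) N = \sum_(k < N) c k * e k x.
  rewrite seriesEord; apply: eq_bigr => k _.
  have h : expR (- (n%:R * x)) ^+ k = e k x.
    by rewrite -expRM_natl /e; congr expR; rewrite natrM; ring.
  by rewrite exp_coeffE zE exprMn h /c; ring.
have me k : measurable_fun setT (e k).
  have m : measurable_fun setT (fun x : R => (n * k)%:R * x) by exact: measurable_funM.
  exact: (measurableT_comp (@measurable_expRN R) m).
apply: (@same_lim (fun N x => series (exp_coeff (z x)) N) _ (expR (expR (n%:R * a)))).
- move=> N; under eq_fun do rewrite sE.
  by apply: measurable_sum => k; apply: measurable_funM.
- move=> N x x0; apply: (le_trans (series_exp_coeff_le _ _)).
  rewrite ler_expR normrN ger0_norm ?expR_ge0// ler_expR ler_wpM2l//.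
  by rewrite gerBl.
- move=> x x0; exact: is_cvg_series_exp_coeff.
- move=> N; rewrite (_ : (fun x => _) = (fun x => \sum_(k < N) c k * e k x)); last first.
    by apply/funext => x; rewrite sE.
  apply: same_sum => //.
  + move=> k x x0; rewrite ger0_norm ?expR_ge0// -(expR0) ler_expR oppr_le0.
    by rewrite mulr_ge0.
  + by move=> k; exact: XY.
Qed.

(** The double exponentials are smoothed indicators: as [n] grows they tend to
    1 above [a], to 0 below it, and to 1/e at it. *)
Let theta (a x : R) : R := (a < x)%R%:R + (x == a)%:R * expR (- 1).

Let theta_lim (a x : R) : (fun n : nat => expR (- expR (n%:R * (a - x)))) @ \oo --> theta a x.
Proof.
rewrite /theta; have [ax|xa|->] := (ltgtP a x); last first.
- rewrite add0r mul1r; under eq_fun do rewrite subrr mulr0 expR0.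
  exact: cvg_cst.
- rewrite mul0r addr0 -[X in _ --> X]/(0 : R); apply: (@squeeze_cvgr _ _ _ _ (cst 0)
    (fun n : nat => expR (x - a) ^+ n)).
  + near=> n => /=; rewrite expR_ge0/= -expRM_natl -ler_ln ?posrE ?expR_gt0//.
    rewrite !expRK -[x - a]opprB mulrN lerN2.
    by apply: le_trans (expR_ge1Dx _); rewrite lerDr.
  + exact: cvg_cst.
  + by apply: cvg_expr; rewrite ger0_norm ?expR_ge0// expR_lt1 subr_lt0.
- rewrite mul0r addr0 (_ : _%:R = expR (- 0)); last by rewrite oppr0 expR0.
  have g0 : (fun n : nat => expR (n%:R * (a - x))) @ \oo --> (0 : R).
    under eq_fun do rewrite expRM_natl.
    by apply: cvg_expr; rewrite ger0_norm ?expR_ge0// expR_lt1 subr_lt0.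
  have ce : {for (0 : R), continuous (fun y : R => expR (- y))}.
    by apply: continuous_comp; [exact: continuousN|exact: continuous_expR].
  exact: (cvg_comp _ _ g0 ce).
Unshelve. all: by end_near. Qed.

Let expR_le1 (x : R) : x <= 0 -> `|expR x| <= 1.
Proof. by move=> x0; rewrite ger0_norm ?expR_ge0// -expR0 ler_expR. Qed.

Let measurable_double_exp (a : R) (n : nat) :
  measurable_fun setT (fun x : R => expR (- expR (n%:R * (a - x)))).
Proof.
apply: continuous_measurable_fun => x.
apply: (@continuous_comp _ _ _ (fun x => expR (n%:R * (a - x))) (fun y => expR (- y))).
  apply: (@continuous_comp _ _ _ (fun x => n%:R * (a - x)) expR).
    by apply: cvgM; [exact: cvg_cst|apply: cvgB; [exact: cvg_cst|exact: cvg_id]].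
  exact: continuous_expR.
by apply: continuous_comp; [exact: continuousN|exact: continuous_expR].
Qed.

Let measurable_theta (a : R) : measurable_fun setT (theta a).
Proof.
apply: (measurable_fun_cvg (measurable_double_exp a)) => x _; exact: theta_lim.
Qed.

Let same_theta a : same (theta a).
Proof.
apply: (@same_lim (fun n x => expR (- expR (n%:R * (a - x)))) _ 1) => //.
by move=> n x _; apply: expR_le1; rewrite oppr_le0 expR_ge0.
Qed.

(** Approaching [a] from above by [theta] removes the value 1/e at [a] itself. *)
Let same_ray a : same (fun x => (a < x)%R%:R).
Proof.
apply: (@same_lim (fun n => theta (a + n.+1%:R^-1)) _ 1) => //.
- move=> n x _; rewrite /theta; case: ltgtP => _; rewrite ?mul0r ?mul1r ?addr0 ?add0r;
    rewrite ?normr0 ?normr1//; apply: expR_le1; by rewrite lerN10.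
- move=> x _; have [ax|xa] := ltP a x; last first.
    apply: cvg_near_cst; near=> n; rewrite /theta.
    have h : x < a + n.+1%:R^-1 by apply: (le_lt_trans xa); rewrite ltrDl invr_gt0.
    by rewrite ltNge (ltW h)/= lt_eqF// mul0r addr0.
  apply: cvg_near_cst; near=> n; rewrite /theta.
  have h : a + n.+1%:R^-1 < x.
    rewrite -ltrBrDl invf_plt ?posrE ?subr_gt0//.
    apply: (lt_le_trans (truncnS_gt _)); rewrite ler_nat ltnS.
    by near: n; exact: nbhs_infty_ge.
  by rewrite h gt_eqF// mul0r addr0.
Unshelve. all: by end_near. Qed.

(** Already the values of the Laplace transform at the integers determine the
    law of a nonnegative random variable. *)
Lemma laplace_unique a : P [set w | a < X w] = P [set w | a < Y w].
Proof.
have mray (Z : Omega -> R) : measurable_fun setT Z -> measurable [set w | a < Z w].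
  move=> mZ; rewrite -[X in measurable X]setTI.
  rewrite (_ : mkset _ = Z @^-1` `]a, +oo[); first exact: mZ.
  by apply/seteqP; split=> w /=; rewrite in_itv/= andbT.
rewrite -(integral_bool_measure (b := fun w => a < X w) P (mray _ mX))//.
rewrite -(integral_bool_measure (b := fun w => a < Y w) P (mray _ mY))//.
exact: same_ray.
Qed.

End Nonnegative.

(** Rays generate the Borel sets, so equal distribution functions give equal
    laws. *)
Lemma same_law_integral (f : R -> \bar R) :
  (forall a, P [set w | X w < a] = P [set w | Y w < a]) ->
  measurable_fun setT f ->
  (\int[P]_w f (X w) = \int[P]_w f (Y w))%E.
Proof.
move=> XYa mf.
pose X' : {RV P >-> R} := HB.pack X (isMeasurableFun.Build _ _ _ _ _ mX).
pose Y' : {RV P >-> R} := HB.pack Y (isMeasurableFun.Build _ _ _ _ _ mY).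
rewrite -(integral_distribution_measurable X' mf).
rewrite -(integral_distribution_measurable Y' mf).
apply: eq_measure_integral => A mA _.
pose G : set (set (measurableTypeR R)) := [set B | exists r, B = `]-oo, r[%classic].
have GI : setI_closed G.
  move=> _ _ [r ->] [s ->]; exists (Num.min r s).
  by apply/seteqP; split=> x /=; rewrite !in_itv/= lt_min => /andP.
have Gcover : \bigcup_(n : nat) `]-oo, (n%:R : R)[%classic = [set: measurableTypeR R].
  apply/seteqP; split=> // x _; exists (Num.truncn x).+1 => //=.
  by rewrite in_itv/=; exact: truncnS_gt.
have Gn (n : nat) : G `]-oo, n%:R[%classic by exists n%:R.
have H := @measure_unique _ R R _ _ (RGenInftyO.measurableE R) GI Gn
  Gcover.
apply: (H (distribution P X') (distribution P Y')) => //.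
- move=> _ [r ->].
  have E (Z : Omega -> R) : Z @^-1` `]-oo, r[%classic = [set w | Z w < r].
    by apply/seteqP; split=> w /=; rewrite in_itv.
  exact: (etrans (congr1 P (E X)) (etrans (XYa r) (congr1 P (esym (E Y))))).
- move=> n; apply: (le_lt_trans (probability_le1 _ _)); last exact: ltry.
  exact: measurable_itv.
Qed.

End LaplaceUniqueness.

(** * The inverse stable subordinator *)

Section NullEvents.
Context (R : realType) (d : measure_display) (Omega : measurableType d)
  (P : probability Omega R).

Lemma measure_le_integral (A : set Omega) (f : Omega -> R) : measurable A ->
  measurable_fun setT f -> (forall w, 0 <= f w) -> (forall w, A w -> 1 <= f w) ->
  (P A <= \int[P]_w (f w)%:E)%E.
Proof.
move=> mA mf f0 f1; rewrite -(setIT A) -integral_indic//.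
apply: ge0_le_integral => //.
- by apply/measurable_EFinP; exact: measurable_indic.
- exact/measurable_EFinP.
- move=> w _; rewrite lee_fin indicE; case: (boolP (w \in A)) => wA; last exact: f0.
  by apply: f1; move: wA; rewrite inE.
Qed.

Lemma measure0_of_exp (A : set Omega) (c : R) : 0 < c ->
  (forall n : nat, P A <= (c * expR (- n%:R))%:E)%E -> P A = 0%E.
Proof.
move=> c0 PA; apply/eqP; rewrite eq_le measure_ge0 andbT leNgt; apply/negP => A0.
have Af : (P A \is a fin_num)%E.
  by rewrite ge0_fin_numE//; apply: le_lt_trans (PA 0%N) _; exact: ltry.
have p0 : 0 < fine (P A) by rewrite fine_gt0// A0 -ge0_fin_numE.
pose n := (Num.truncn (- ln (fine (P A) / c))).+1.
have := PA n; rewrite -(fineK Af) lee_fin leNgt => /negP; apply.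
rewrite mulrC -ltr_pdivlMr// -ltr_ln ?posrE ?expR_gt0 ?divr_gt0// expRK ltrNl.
exact: truncnS_gt.
Qed.

End NullEvents.

Section InverseStableSubordinator.
Context (R : realType) (d : measure_display) (Omega : measurableType d)
  (P : probability Omega R) (nu T : R) (H : R -> Omega -> R).
Local Notation lambda := (@lebesgue_measure R).
Hypotheses (nu0 : 0 < nu) (nu1 : nu < 1) (T0 : 0 < T)
  (HH : stable_subordinator P nu H).

Local Notation L := (inverse_subordinator nu H T).

Lemma measurable_sub s : 0 <= s -> measurable_fun setT (H s).
Proof. exact: (sub_measurable HH). Qed.

Lemma nondecreasing_sub w s u : 0 <= s -> s <= u -> H s w <= H u w.
Proof. exact: (sub_nondecreasing HH). Qed.

Lemma sub_ge0 s w : 0 <= s -> 0 <= H s w.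
Proof. by move=> s0; rewrite -(sub_start HH w); exact: nondecreasing_sub. Qed.

Lemma laplace_sub s t : 0 <= s -> 0 <= t ->
  (\int[P]_w (expR (- (s * H t w)))%:E = (expR (- (t * s `^ nu)))%:E)%E.
Proof. by move=> s0 t0; rewrite -(sub_laplace HH)// unlock. Qed.

Lemma measurable_exp_scale (Z : Omega -> R) s : measurable_fun setT Z ->
  measurable_fun setT (fun w => expR (- (s * Z w))).
Proof.
move=> mZ; have msZ : measurable_fun setT (fun w => s * Z w) by exact: measurable_funM.
exact: (measurableT_comp (@measurable_expRN R) msZ).
Qed.

Lemma measurable_le_ray (Z : Omega -> R) a : measurable_fun setT Z -> measurable [set w | Z w <= a].
Proof.
move=> mZ; rewrite -[X in measurable X]setTI.
rewrite (_ : mkset _ = Z @^-1` `]-oo, a]); first exact: mZ.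
by apply/seteqP; split=> w /=; rewrite in_itv.
Qed.

Lemma measurable_lt_ray (Z : Omega -> R) a : measurable_fun setT Z -> measurable [set w | Z w < a].
Proof.
move=> mZ; rewrite -[X in measurable X]setTI.
rewrite (_ : mkset _ = Z @^-1` `]-oo, a[); first exact: mZ.
by apply/seteqP; split=> w /=; rewrite in_itv.
Qed.

(** P (H 1 <= 0) is at most E e^(-s H_1) = e^(-s^nu) for every s; the parameter
    below makes s^nu equal to n. *)
Lemma sub1_null : P [set w | H 1 w <= 0] = 0%E.
Proof.
apply: (@measure0_of_exp _ _ _ _ _ 1) => // n.
pose s : R := n%:R `^ nu^-1.
have s0 : 0 <= s by exact: powR_ge0.
have -> : 1 * expR (- n%:R) = expR (- (1 * s `^ nu)).
  by rewrite !mul1r /s -powRrM mulVf ?gt_eqF// powRr1.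
rewrite -(laplace_sub s0 ler01); apply: measure_le_integral => [|||w /= h].
- exact/measurable_le_ray/measurable_sub.
- exact/measurable_exp_scale/measurable_sub.
- by move=> w; exact: expR_ge0.
- have -> : H 1 w = 0 by apply/eqP; rewrite eq_le h sub_ge0.
  by rewrite mulr0 oppr0 expR0.
Qed.

(** H 1 is almost surely positive; changing it on the exceptional event makes its
    negative powers meaningful everywhere. *)
Definition pos_H1 w := if 0 < H 1 w then H 1 w else 1.

Lemma pos_H1_gt0 w : 0 < pos_H1 w.
Proof. by rewrite /pos_H1; case: ifP. Qed.

Lemma measurable_pos_H1 : measurable_fun setT pos_H1.
Proof.
apply: measurable_fun_ifT; [|exact: measurable_sub|exact: measurable_cst].
by apply: measurable_fun_ltr; [exact: measurable_cst|exact: measurable_sub].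
Qed.

Lemma laplace_pos_H1 s : 0 <= s ->
  (\int[P]_w (expR (- (s * pos_H1 w)))%:E = (expR (- (s `^ nu)))%:E)%E.
Proof.
move=> s0; rewrite -[s `^ nu]mul1r -(laplace_sub s0 ler01).
apply: ae_eq_integral => //.
- by apply/measurable_EFinP; apply: measurable_exp_scale; exact: measurable_pos_H1.
- by apply/measurable_EFinP; apply/measurable_exp_scale/measurable_sub.
exists [set w | H 1 w <= 0].
split; [exact/measurable_le_ray/measurable_sub|exact: sub1_null|].
move=> w /= nw; rewrite leNgt; apply/negP => H1; apply: nw => _.
by rewrite /pos_H1 H1.
Qed.

(** Self-similarity: H_tau has the law of tau^(1/nu) H_1, both having the Laplace
    transform e^(-tau s^nu). *)
Lemma tail_sub tau a : 0 < tau ->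
  P [set w | a < H tau w] = P [set w | a < tau `^ nu^-1 * pos_H1 w].
Proof.
move=> tau0; have t0 := ltW tau0.
apply: laplace_unique.
- exact: measurable_sub.
- by apply: measurable_funM; [exact: measurable_cst|exact: measurable_pos_H1].
- by move=> w; exact: sub_ge0.
- by move=> w; rewrite mulr_ge0 ?powR_ge0// ltW// pos_H1_gt0.
move=> n; rewrite laplace_sub//.
under eq_integral do rewrite mulrA.
rewrite laplace_pos_H1 ?mulr_ge0 ?powR_ge0// powRM ?powR_ge0// -powRrM mulVf ?gt_eqF//.
by rewrite powRr1// mulrC.
Qed.

(** (T / H_1)^nu, which turns out to have the law of L. *)
Definition scaling_law w := T `^ nu * pos_H1 w `^ (- nu).

Lemma measurable_scaling_law : measurable_fun setT scaling_law.
Proof.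
apply: measurable_funM; first exact: measurable_cst.
exact: (measurableT_comp (measurable_powR _) measurable_pos_H1).
Qed.

Lemma scaling_law_gt0 w : 0 < scaling_law w.
Proof. by rewrite mulr_gt0// powR_gt0// pos_H1_gt0. Qed.

Lemma scaling_law_lt w tau : 0 < tau -> (scaling_law w < tau) = (T < tau `^ nu^-1 * pos_H1 w).
Proof.
move=> tau0; have hw := pos_H1_gt0 w.
have -> : (T < tau `^ nu^-1 * pos_H1 w) = (T `^ nu < (tau `^ nu^-1 * pos_H1 w) `^ nu).
  have th0 : 0 <= tau `^ nu^-1 * pos_H1 w by rewrite mulr_ge0 ?powR_ge0// ltW.
  apply/idP/idP => k; first by rewrite gt0_ltr_powR// nnegrE ltW.
  rewrite ltNge; apply/negP => le; move: k; rewrite ltNge => /negP; apply.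
  by apply: (ge0_ler_powR (ltW nu0)) => //; rewrite nnegrE ltW.
rewrite powRM ?powR_ge0 ?ltW// -powRrM mulVf ?gt_eqF// powRr1 ?ltW//.
by rewrite /scaling_law powRN ltr_pdivrMr// powR_gt0.
Qed.

Lemma nu_neq1 : nu != 1. Proof. by rewrite lt_eqF. Qed.

Lemma measurable_L : measurable_fun setT L.
Proof.
exact: (measurable_inverse_subordinator nondecreasing_sub nu_neq1 (ltW T0) measurable_sub).
Qed.

(** By Markov's inequality, P (H_n <= T) <= e^T E e^(-H_n) = e^(T - n). *)
Lemma bounded_sub_null : P (\bigcap_(n : nat) [set w | H n.+1%:R w <= T]) = 0%E.
Proof.
have mb : measurable (\bigcap_(n : nat) [set w | H n.+1%:R w <= T]).
  by apply: bigcapT_measurable => n; apply/measurable_le_ray/measurable_sub.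
apply: (@measure0_of_exp _ _ _ _ _ (expR T)); first exact: expR_gt0.
move=> n.
have E : (\int[P]_w (expR T * expR (- (1 * H n.+1%:R w)))%:E =
    (expR T * expR (- n.+1%:R))%:E)%E.
  under eq_integral do rewrite EFinM.
  rewrite ge0_integralZl_EFin//.
  - by rewrite laplace_sub// powR1 mulr1 -EFinM.
  - by apply/measurable_EFinP; apply/measurable_exp_scale/measurable_sub.
apply: (@le_trans _ _ (expR T * expR (- n.+1%:R))%:E); last first.
  by rewrite lee_fin ler_wpM2l ?expR_ge0// ler_expR lerN2 ler_nat.
rewrite -E; apply: measure_le_integral => //.
- by apply: measurable_funM => //; apply/measurable_exp_scale/measurable_sub.
- move=> w /(_ n I) /= hT; rewrite -expRD mul1r -[leLHS]expR0 ler_expR subr_ge0.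
  exact: hT.
Qed.

(** Up to the null event of bounded paths,
    [T < H u] is contained in [L < tau] for u < tau, and [L < tau] in
    [T < H tau]. By self-similarity the outer events have the probabilities of
    [scaling_law < u] and [scaling_law < tau], and the former increases to the
    latter as u increases to tau. *)
Lemma law_L tau : P [set w | L w < tau] = P [set w | scaling_law w < tau].
Proof.
have [tau0|tau0] := leP tau 0.
  rewrite (_ : [set w | L w < tau] = set0).
    rewrite (_ : [set w | scaling_law w < tau] = set0)//; apply/seteqP; split=> w //=.
    by rewrite ltNge (le_trans tau0)// ltW// scaling_law_gt0.
  apply/seteqP; split=> w //=.
  by rewrite ltNge (le_trans tau0)// inverse_subordinator_ge0// ltW.
have mr u : 0 < u -> measurable [set w | T < H u w].
  move=> u0; rewrite -[X in measurable X]setTI.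
  rewrite (_ : mkset _ = H u @^-1` `]T, +oo[); first exact: (measurable_sub (ltW u0)).
  by apply/seteqP; split=> w /=; rewrite in_itv/= andbT.
have VH u : 0 < u -> P [set w | scaling_law w < u] = P [set w | T < H u w].
  move=> u0; rewrite tail_sub//; congr (P _).
  by apply/seteqP; split=> w /=; rewrite scaling_law_lt.
apply/eqP; rewrite eq_le; apply/andP; split.
  rewrite VH//.
  have mb : measurable (\bigcap_(n : nat) [set w | H n.+1%:R w <= T]).
    by apply: bigcapT_measurable => n; apply/measurable_le_ray/measurable_sub.
  apply: (@le_trans _ _ (P ([set w | T < H tau w] `|`
      \bigcap_(n : nat) [set w | H n.+1%:R w <= T]))).
    apply: le_measure; rewrite ?inE.
    - exact/measurable_lt_ray/measurable_L.
    - by apply: measurableU => //; exact: mr.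
    move=> w /= /(lt_inverse_subordinator T nondecreasing_sub nu_neq1 w tau0).
    move=> [[u /andP[u0 ut] Tu]|hn].
      by left; apply: (lt_le_trans Tu); apply: nondecreasing_sub; exact: ltW.
    by right => n _; exact: hn.
  by rewrite (measureU0 (mr _ tau0) mb bounded_sub_null).
pose u n : R := tau * (n.+1%:R / n.+2%:R).
have u0 n : 0 < u n by rewrite /u mulr_gt0// divr_gt0.
have ut n : u n < tau by rewrite /u gtr_pMr// ltr_pdivrMr// mul1r ltr_nat.
have cV : P [set w | scaling_law w < u n] @[n --> \oo] -->
    P (\bigcup_n [set w | scaling_law w < u n]).
  apply: nondecreasing_cvg_mu.
  - by move=> n; exact/measurable_lt_ray/measurable_scaling_law.
  - by apply: bigcupT_measurable => n; exact/measurable_lt_ray/measurable_scaling_law.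
  - apply/nondecreasing_seqP => n; apply/subsetPset => w /= Vu.
    apply: (lt_le_trans Vu); rewrite /u ler_pM2l// ler_pdivrMr// mulrAC ler_pdivlMr//.
    by rewrite -!natrM ler_nat; lia.
have -> : [set w | scaling_law w < tau] = \bigcup_n [set w | scaling_law w < u n].
  apply/seteqP; split=> w /=; last by move=> [n _ /= Vu]; exact: lt_trans Vu (ut n).
  move=> Vt; pose n := Num.truncn (tau / (tau - scaling_law w)); exists n => //=.
  have hn : tau / (tau - scaling_law w) < n.+1%:R by apply: truncnS_gt.
  rewrite ltr_pdivrMr ?subr_gt0// in hn.
  rewrite /u mulrA ltr_pdivlMr// -[n.+2%:R]natr1.
  by move: (n.+1%:R) hn (scaling_law_gt0 w) => M hM V0; nra.
have <- := cvg_lim (@ereal_hausdorff R) cV.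
apply: lime_le; first by apply/cvg_ex; eexists; exact: cV.
apply: nearW => n; rewrite VH//.
apply: le_measure; rewrite ?inE; [exact: mr|exact/measurable_lt_ray/measurable_L|].
move=> w /= Tw; apply/(lt_inverse_subordinator T nondecreasing_sub nu_neq1 w tau0); left.
by exists (u n) => //; rewrite u0 ut.
Qed.

Lemma measurable_pow_H1 q : measurable_fun setT (fun w => pos_H1 w `^ q).
Proof. exact: (measurableT_comp (measurable_powR q) measurable_pos_H1). Qed.

(** Integrate s^(q-1) e^(-s H_1), with q = n nu, over s and over the probability
    space. Integrating first in s gives Gamma (q) H_1^(-q); first in the
    probability space, the Laplace transform e^(-s^nu), whose Mellin transform
    is again a Gamma integral. *)
Lemma negative_moment (n : nat) :
  (\int[P]_w (pos_H1 w `^ (- (n%:R * nu)))%:E =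
   (n`!%:R / Defs.Gamma (1 + n%:R * nu))%:E)%E.
Proof.
have [->|n0] := eqVneq n 0%N.
  rewrite mul0r oppr0; under eq_integral do rewrite powRr0.
  rewrite integral_cst// [X in (_ * X)%E](probability_setT P) mule1.
  by have := Gamma_nat R 0; rewrite addr0 => ->; rewrite divr1.
set q := n%:R * nu.
have q0 : 0 < q by rewrite mulr_gt0// ltr0n lt0n.
pose J (z : Omega * R) : \bar R :=
  if 0 < z.2 then (z.2 `^ (q - 1) * expR (- (pos_H1 z.1 * z.2)))%:E else 0%E.
have mJ : measurable_fun setT J.
  apply: measurable_fun_ifT; last exact: measurable_cst.
    by apply: measurable_fun_ltr; [exact: measurable_cst|exact: measurable_snd].
  apply/measurable_EFinP; apply: measurable_funM.
    exact: (measurableT_comp (measurable_powR (q - 1)) measurable_snd).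
  have mhs : measurable_fun setT (fun z : Omega * R => pos_H1 z.1 * z.2).
    apply: measurable_funM; last exact: measurable_snd.
    exact: (measurableT_comp measurable_pos_H1 measurable_fst).
  exact: (measurableT_comp (@measurable_expRN R) mhs).
have J0 z : (0 <= J z)%E.
  by rewrite /J; case: ifP => // _; rewrite lee_fin mulr_ge0 ?powR_ge0 ?expR_ge0.
have inner1 w : (\int[lambda]_s J (w, s) =
    (Defs.Gamma (1 + q) / q)%:E * (pos_H1 w `^ (- q))%:E)%E.
  transitivity (\int[lambda]_(s in `]0%R, +oo[)
      (s `^ (q - 1) * expR (- (pos_H1 w * s `^ 1)))%:E)%E.
    rewrite [RHS]integral_mkcond; apply: eq_integral => s _.
    rewrite patchE mem_setE/= in_itv/= andbT /J/=; case: ifP => // s0.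
    by rewrite powRr1// ltW.
  rewrite integral_powR_expR ?pos_H1_gt0// divr1 -/(gamma_integral q).
  rewrite gamma_integralE ?(ltW q0)// -!EFinM; congr EFin; ring.
have inner2 s : (\int[P]_w J (w, s) =
    ((fun s => (s `^ (q - 1) * expR (- (1 * s `^ nu)))%:E) \_ `]0%R, +oo[) s)%E.
  rewrite patchE mem_setE/= in_itv/= andbT; case: ifPn => s0; last first.
    by apply: integral0_eq => w _; rewrite /J/= (negbTE s0).
  transitivity (\int[P]_w ((s `^ (q - 1))%:E * (expR (- (s * pos_H1 w)))%:E))%E.
    by apply: eq_integral => w _; rewrite /J/= s0 EFinM [pos_H1 _ * _]mulrC.
  rewrite ge0_integralZl_EFin; last exact: powR_ge0.
  - by rewrite laplace_pos_H1 ?(ltW s0)// mul1r -EFinM.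
  - exact: measurableT.
  - by move=> w _; rewrite lee_fin expR_ge0.
  - by apply/measurable_EFinP; apply: measurable_exp_scale; exact: measurable_pos_H1.
have E1 : (\int[P]_w \int[lambda]_s J (w, s) =
    (Defs.Gamma (1 + q) / q)%:E * \int[P]_w (pos_H1 w `^ (- q))%:E)%E.
  under eq_integral do rewrite inner1.
  rewrite ge0_integralZl_EFin => //.
  - by move=> w _; rewrite lee_fin powR_ge0.
  - by apply/measurable_EFinP; exact: measurable_pow_H1.
  - by rewrite divr_ge0 ?ltW// Gamma_gt0// ltW.
have E2 : (\int[lambda]_s \int[P]_w J (w, s) = (n`!%:R / q)%:E)%E.
  under eq_integral do rewrite inner2.
  rewrite -integral_mkcond integral_powR_expR// -/(gamma_integral (q / nu)).
  rewrite {2}/q mulfK ?gt_eqF// gamma_integral_nat powR1 -EFinM div1r.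
  by rewrite mulrC.
have E12 := @fubini_tonelli _ _ _ _ R P lambda J mJ J0.
have : ((Defs.Gamma (1 + q) / q)%:E * \int[P]_w (pos_H1 w `^ (- q))%:E = (n`!%:R / q)%:E)%E.
  by rewrite -E1 -E2; exact: E12.
move=> {E12 E1 E2 inner1 inner2 J mJ J0}.
have G0 : 0 < Defs.Gamma (1 + q) by apply: Gamma_gt0; exact: ltW.
move=> /(congr1 (fun e => ((q / Defs.Gamma (1 + q))%:E * e)%E)).
rewrite muleA -!EFinM mulrA divfK ?gt_eqF// divff ?gt_eqF// mul1e => ->.
by congr EFin; field; rewrite !gt_eqF.
Qed.

Lemma moment_scaling_law (n : nat) :
  (\int[P]_w (scaling_law w ^+ n)%:E =
   (n`!%:R * (T `^ nu) ^+ n / Defs.Gamma (1 + n%:R * nu))%:E)%E.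
Proof.
transitivity (\int[P]_w (((T `^ nu) ^+ n)%:E * (pos_H1 w `^ (- (n%:R * nu)))%:E))%E.
  apply: eq_integral => w _; rewrite -EFinM /scaling_law exprMn; congr ((_ * _)%:E).
  by rewrite -powR_mulrn ?powR_ge0// -powRrM; congr (_ `^ _); ring.
rewrite ge0_integralZl_EFin => //.
- by rewrite negative_moment -EFinM mulrA [_ * n`!%:R]mulrC.
- by move=> w _; rewrite lee_fin powR_ge0.
- by apply/measurable_EFinP; exact: measurable_pow_H1.
- by rewrite exprn_ge0// powR_ge0.
Qed.

End InverseStableSubordinator.

Section MittagLeffler.
Context (R : realType) (d : measure_display) (Omega : measurableType d)
  (P : probability Omega R).

(** [Gamma_lower_bound] with A^nu = 2 z + 1 dominates the series by a geometric
    one of ratio 1/2. *)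
Lemma mittag_leffler_partial_sum_bound (nu z : R) : 0 < nu -> 0 <= z ->
  exists M, forall N, \sum_(k < N) z ^+ k / Defs.Gamma (1 + k%:R * nu) <= M.
Proof.
move=> nu0 z0.
pose b : R := 2 * z + 1; pose A := b `^ nu^-1.
have b0 : 0 < b by rewrite /b ltr_wpDl// mulr_ge0.
have A0 : 0 < A by exact: powR_gt0.
have term k : z ^+ k / Defs.Gamma (1 + k%:R * nu) <= expR (A + 1) * 2^-1 ^+ k.
  have kn0 : 0 <= k%:R * nu by rewrite mulr_ge0// ltW.
  have := Gamma_lower_bound kn0 A0.
  rewrite /A -powRrM [k%:R * nu]mulrC mulKf ?gt_eqF// powR_mulrn ?(ltW b0)// -/A => G.
  rewrite ler_pdivrMr; last by apply: lt_le_trans G; rewrite mulr_gt0 ?exprn_gt0 ?expR_gt0.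
  apply: (@le_trans _ _ (expR (A + 1) * 2^-1 ^+ k * (b ^+ k * expR (- (A + 1))))).
    have -> : expR (A + 1) * 2^-1 ^+ k * (b ^+ k * expR (- (A + 1))) = (2^-1 * b) ^+ k.
      have e : expR (A + 1) * expR (- (A + 1)) = 1 by rewrite -expRD subrr expR0.
      by rewrite exprMn -[RHS]mul1r -[X in _ = X * _]e; ring.
    apply: lerXn2r; rewrite ?nnegrE ?mulr_ge0 ?invr_ge0 ?(ltW b0)//.
    by rewrite mulrC ler_pdivlMr// /b; lra.
  by rewrite ler_wpM2l// mulr_ge0 ?expR_ge0 ?exprn_ge0 ?invr_ge0.
exists (expR (A + 1) * 2) => N.
apply: (@le_trans _ _ (\sum_(k < N) expR (A + 1) * 2^-1 ^+ k)).
  by apply: ler_sum => k _; exact: term.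
rewrite -mulr_sumr ler_wpM2l ?expR_ge0//.
suff -> : \sum_(k < N) 2^-1 ^+ k = 2 - 2 * 2^-1 ^+ N :> R.
  by rewrite gerBl mulr_ge0 ?exprn_ge0 ?invr_ge0.
elim: N => [|N IH]; first by rewrite big_ord0 expr0 mulr1 subrr.
by rewrite big_ord_recr/= IH exprS mulrA divff// mul1r; ring.
Qed.

(** If the n-th moment of a nonnegative variable is n! z^n / Gamma (1 + n nu),
    summing the exponential series gives the Mittag-Leffler function; the series
    of absolute values is summable by the previous bound. *)
Lemma mittag_leffler_of_moments (nu z lam : R) (V : Omega -> R) :
  0 < nu -> 0 <= z -> 0 <= lam ->
  measurable_fun setT V -> (forall w, 0 <= V w) ->
  (forall n : nat, \int[P]_w (V w ^+ n)%:E =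
     (n`!%:R * z ^+ n / Defs.Gamma (1 + n%:R * nu))%:E)%E ->
  (\int[P]_w (expR (- (lam * V w)))%:E = (mittag_leffler nu (- lam * z))%:E)%E.
Proof.
move=> nu0 z0 lam0 mV V0 EV.
have Vn n : P.-integrable setT (fun w => (V w ^+ n)%:E).
  apply/integrableP; split; first by apply/measurable_EFinP; exact: measurable_funX.
  under eq_integral => w _ do rewrite gee0_abs ?lee_fin ?exprn_ge0//.
  by rewrite EV ltry.
pose S (c : R) (N : nat) (w : Omega) := series (exp_coeff (c * V w)) N.
have SE c N w : S c N w = \sum_(k < N) c ^+ k / k`!%:R * V w ^+ k.
  by rewrite /S seriesEord; apply: eq_bigr => k _; rewrite exp_coeffE exprMn; ring.
have mS c N : measurable_fun setT (S c N).
  rewrite (_ : S c N = fun w => \sum_(k < N) c ^+ k / k`!%:R * V w ^+ k); last first.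
    by apply/funext => w; rewrite SE.
  by apply: measurable_sum => k; apply: measurable_funM => //; exact: measurable_funX.
have ES c N : (\int[P]_w (S c N w)%:E =
    (\sum_(k < N) (c * z) ^+ k / Defs.Gamma (1 + k%:R * nu))%:E)%E.
  under eq_integral do rewrite SE -sumEFin.
  rewrite integral_sum//=; last first.
    by move=> k; under eq_fun do rewrite EFinM; exact: integrableZl.
  rewrite -sumEFin; apply: eq_bigr => k _.
  under eq_integral do rewrite EFinM.
  rewrite integralZl// EV -EFinM; congr EFin; rewrite exprMn.
  have f0 : k`!%:R != 0 :> R by rewrite pnatr_eq0 -lt0n fact_gt0.
  have g0 : Defs.Gamma (1 + k%:R * nu) != 0.
    by rewrite gt_eqF// Gamma_gt0// mulr_ge0// ltW.
  by field; rewrite ?f0 ?g0.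
have Sexp c w : S c ^~ w @ \oo --> expR (c * V w) by exact: is_cvg_series_exp_coeff.
have iexp : P.-integrable setT (fun w => (expR (lam * V w))%:E).
  have mexp : measurable_fun setT (fun w => (expR (lam * V w))%:E).
    by apply/measurable_EFinP; apply: (measurable_fun_cvg (mS lam)) => w _; exact: Sexp.
  apply/integrableP; split => //.
  under eq_integral => w _ do rewrite gee0_abs ?lee_fin ?expR_ge0//.
  have [M SM] := mittag_leffler_partial_sum_bound nu0 (mulr_ge0 lam0 z0).
  have mc := @monotone_convergence _ _ _ P setT measurableT (fun N w => (S lam N w)%:E).
  have lv w : 0 <= lam * V w by rewrite mulr_ge0.
  rewrite (_ : (fun w => _) = (fun w => limn (fun N => (S lam N w)%:E))); last first.
    apply/funext => w; apply/esym/cvg_lim => //.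
    by apply: cvg_EFin; [exact: nearW|exact: Sexp].
  rewrite mc.
  - apply: (@le_lt_trans _ _ M%:E); last exact: ltry.
    apply: lime_le.
      apply: ereal_nondecreasing_is_cvgn; apply/nondecreasing_seqP => N.
      rewrite !ES lee_fin big_ord_recr/= lerDl divr_ge0 ?exprn_ge0 ?mulr_ge0//.
      by apply/ltW/Gamma_gt0; rewrite mulr_ge0// ltW.
    by apply: nearW => N; rewrite ES lee_fin.
  - by move=> N; exact/measurable_EFinP.
  - move=> N w _; rewrite lee_fin SE; apply: sumr_ge0 => k _.
    by rewrite mulr_ge0 ?divr_ge0 ?exprn_ge0.
  - move=> w _; apply/nondecreasing_seqP => N; rewrite lee_fin !SE big_ord_recr/= lerDl.
    by rewrite mulr_ge0 ?divr_ge0 ?exprn_ge0.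
have mlim : measurable_fun setT (fun w => expR (- lam * V w)).
  by apply: (measurable_fun_cvg (mS (- lam))) => w _; exact: Sexp.
have [] := @dominated_convergence _ _ _ P setT measurableT (fun N w => (S (- lam) N w)%:E)
  (fun w => (expR (- lam * V w))%:E) (fun w => (expR (lam * V w))%:E).
- by move=> N; exact/measurable_EFinP.
- exact/measurable_EFinP.
- by apply: aeW => w _; apply: cvg_EFin; [exact: nearW|exact: Sexp].
- exact: iexp.
- apply: aeW => w N _; rewrite lee_fin (le_trans (series_exp_coeff_le _ _))//.
  by rewrite ler_expR mulNr normrN ger0_norm// mulr_ge0.
move=> ilim _; rewrite [X in X @ _ --> _](_ : _ =
    EFin \o series (fun n => (- lam * z) ^+ n / Defs.Gamma (1 + n%:R * nu))); last first.
  by apply/funext => N; rewrite /= ES seriesEord.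
have fin := integrable_fin_num measurableT ilim.
rewrite -(fineK fin) => /fine_cvg c.
under eq_integral do rewrite -mulNr.
rewrite -(fineK fin); congr EFin; apply/esym/cvg_lim; [exact: Rhausdorff|exact: c].
Qed.

(** Laplace transform of the inverse stable subordinator; for [nu = 1] the clock
    is deterministic and the Mittag-Leffler function is the exponential. *)
Lemma laplace_inverse_subordinator (nu T lam : R) (H : R -> Omega -> R) :
  0 < nu <= 1 -> 0 < T -> 0 <= lam ->
  (nu < 1 -> stable_subordinator P nu H) ->
  (\int[P]_w (expR (- (lam * inverse_subordinator nu H T w)))%:E =
   (mittag_leffler nu (- lam * T `^ nu))%:E)%E.
Proof.
move=> /andP[nu0]; rewrite le_eqVlt => /predU1P[->|nu1] T0 lam0 hH.
  rewrite /inverse_subordinator eqxx integral_cst// [X in (_ * X)%E](probability_setT P).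
  by rewrite mule1 mittag_leffler1 powRr1 ?(ltW T0)// mulNr.
have HH := hH nu1.
rewrite (same_law_integral (measurable_L nu1 T0 HH) (measurable_scaling_law T HH)
  (f := fun r => (expR (- (lam * r)))%:E)).
- apply: mittag_leffler_of_moments => //.
  + exact: powR_ge0.
  + exact: (measurable_scaling_law T HH).
  + by move=> w; apply/ltW; exact: scaling_law_gt0.
  + by move=> n; rewrite moment_scaling_law.
- exact: (law_L nu0 nu1 T0 HH).
- apply/measurable_EFinP.
  have m : measurable_fun setT (fun r : R => lam * r) by exact: measurable_funM.
  exact: (measurableT_comp (@measurable_expRN R) m).
Qed.

End MittagLeffler.

(** * Time-changed Brownian motion *)

Section GeneratedSigmaAlgebra.
Context (I : Type) (d d' : measure_display) (Omega : measurableType d)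
  (E : measurableType d').
Implicit Types (D : set I) (X : I -> Omega -> E) (G : set (set Omega)).

Lemma sigma_process_algebra D X : sigma_algebra setT (sigma_process D X).
Proof. exact: smallest_sigma_algebra. Qed.

Lemma sigma_process_preimage D X i (A : set E) : D i -> measurable A ->
  sigma_process D X (X i @^-1` A).
Proof.
by move=> Di mA; apply: sub_sigma_algebra; exists i => //; exists A => //; rewrite setTI.
Qed.

Lemma sigma_process_sub D X : (forall i, D i -> measurable_fun setT (X i)) ->
  sigma_process D X `<=` measurable.
Proof.
move=> mX; apply: smallest_sub; first exact: sigma_algebra_measurable.
by move=> _ [i Di [A mA <-]]; exact: mX.
Qed.

Lemma measurable_sigma_process D X i : D i ->
  measurable_fun setT (X i : g_sigma_algebraType (sigma_process D X) -> E).
Proof.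
move=> Di _ A mA; rewrite setTI; apply: sub_sigma_algebra.
exact: sigma_process_preimage.
Qed.

Lemma measurable_g_sigma_algebra G (A : set Omega) : sigma_algebra setT G ->
  measurable (A : set (g_sigma_algebraType G)) -> G A.
Proof. by move=> sG; rewrite /measurable/= sigma_algebra_id. Qed.

Lemma measurable_id_g_sigma_algebra G : sigma_algebra setT G -> G `<=` measurable ->
  measurable_fun setT (id : Omega -> g_sigma_algebraType G).
Proof.
move=> sG GM _ A mA; rewrite setTI; apply: GM.
exact: measurable_g_sigma_algebra.
Qed.

End GeneratedSigmaAlgebra.

Section TimeChangedBrownianMotion.
Context (R : realType) (d : measure_display) (Omega : measurableType d)
  (P : probability Omega R) (nu t0 t : R).
Variables (B : R -> Omega -> sphere R) (H : R -> Omega -> R) (x : sphere R).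
Hypotheses (hnu : 0 < nu <= 1) (ht : t0 < t) (hB : sphere_brownian_motion P x B).
Hypothesis hH : nu < 1 -> stable_subordinator P nu H /\
  indep_sigma P (sigma_process `[0, +oo[ B) (sigma_process `[0, +oo[ H).

Local Notation T := (t - t0).
Local Notation L := (inverse_subordinator nu H T).
Local Notation FB := (sigma_process `[0, +oo[ B).
Local Notation FH := (sigma_process `[0, +oo[ H).

Lemma elapsed_gt0 : 0 < T. Proof. by rewrite subr_gt0. Qed.

Lemma brownian_sigma_sub : FB `<=` measurable.
Proof.
apply: sigma_process_sub => s /=; rewrite in_itv/= andbT.
exact: (sbm_measurable hB).
Qed.

(** Joint measurability of (w, s) |-> B_s w already holds for the sigma-algebra
    of [B], the one known to be independent of the clock. *)
Lemma measurable_brownian_joint :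
  measurable_fun setT (fun z : g_sigma_algebraType FB * R => B (Num.max 0 z.2) z.1).
Proof.
apply: (@measurable_sphere_process _ _ (g_sigma_algebraType FB)) => [s s0|w].
  by apply: measurable_sigma_process; rewrite /= in_itv/= s0.
exact: (sbm_continuous hB).
Qed.

Lemma time_changed_joint w :
  time_changed nu t0 B H t w = B (Num.max 0 (L w)) w.
Proof.
rewrite /time_changed max_r//; have [nu1|nu1] := eqVneq nu 1.
  by rewrite /inverse_subordinator nu1 eqxx ltW// elapsed_gt0.
by apply: inverse_subordinator_ge0; exact/ltW/elapsed_gt0.
Qed.

Lemma measurable_clock_sigma (A : set R) : nu < 1 -> measurable A -> FH (L @^-1` A).
Proof.
move=> nu1 mA; have [HH _] := hH nu1.
apply: measurable_g_sigma_algebra; first exact: sigma_process_algebra.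
rewrite -[X in measurable X]setTI.
have nuN1 : nu != 1 by rewrite lt_eqF.
apply: (@measurable_inverse_subordinator _ _ (g_sigma_algebraType FH) H nu T) => //.
- exact: (sub_nondecreasing HH).
- exact/ltW/elapsed_gt0.
- by move=> s s0; apply: measurable_sigma_process; rewrite /= in_itv/= s0.
Qed.

Lemma measurable_clock : measurable_fun setT L.
Proof.
have [nu1|nu1] := eqVneq nu 1.
  by rewrite /inverse_subordinator nu1 eqxx; exact: measurable_cst.
have {}nu1 : nu < 1 by rewrite lt_neqAle nu1; case/andP: hnu.
have [HH _] := hH nu1.
exact: (measurable_L nu1 elapsed_gt0 HH).
Qed.

Lemma measurable_time_changed : measurable_fun setT (time_changed nu t0 B H t).
Proof.
have mid := measurable_id_g_sigma_algebra (sigma_process_algebra `[0, +oo[ B)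
  brownian_sigma_sub.
rewrite (_ : time_changed _ _ _ _ _ =
    (fun z : g_sigma_algebraType FB * R => B (Num.max 0 z.2) z.1) \o (fun w => (w, L w)));
  last by apply/funext => w; exact: time_changed_joint.
apply: (measurableT_comp measurable_brownian_joint).
by apply: measurable_fun_pair; [exact: mid|exact: measurable_clock].
Qed.

(** Conditioning on the independent clock averages the heat semigroup factor
    e^(-mu L) into a Mittag-Leffler function. *)
Lemma expectation_zonal_time_changed l v :
  (\int[P]_w (zonal (legendre R l) v (time_changed nu t0 B H t w))%:E =
   (mittag_leffler nu (- mu_ R l * T `^ nu) * zonal (legendre R l) v x)%:E)%E.
Proof.
have mu0 : 0 <= mu_ R l by rewrite /mu_ ler0n.
have ML := laplace_inverse_subordinator hnu elapsed_gt0 mu0 (fun nu1 => (hH nu1).1).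
set g := zonal (legendre R l) v.
have E s : 0 <= s -> (\int[P]_w (g (B s w))%:E = (expR (- (mu_ R l * s)) * g x)%:E)%E.
  exact: expectation_zonal_brownian.
have mexp : measurable_fun setT (fun w => expR (- (mu_ R l * L w))).
  have m : measurable_fun setT (fun w => mu_ R l * L w).
    by apply: measurable_funM; [exact: measurable_cst|exact: measurable_clock].
  exact: (measurableT_comp (@measurable_expRN R) m).
have L0 w : 0 <= Num.max 0 (L w) by rewrite le_max lexx.
have LE w : Num.max 0 (L w) = L w.
  apply: max_r; have [nu1|nu1] := eqVneq nu 1.
    by rewrite /inverse_subordinator nu1 eqxx ltW// elapsed_gt0.
  by apply: inverse_subordinator_ge0; exact/ltW/elapsed_gt0.
suff -> : (\int[P]_w (g (time_changed nu t0 B H t w))%:E =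
    \int[P]_w ((g x)%:E * (expR (- (mu_ R l * L w)))%:E))%E.
  rewrite integralZl//; last first.
    apply: (@bounded_probability_integrable _ _ _ _ _ 1) => // w.
    by rewrite ger0_norm ?expR_ge0// -[leRHS]expR0 ler_expR oppr_le0 mulr_ge0// -LE.
  by rewrite ML -EFinM mulrC.
have [nu1|nu1] := eqVneq nu 1.
  have LT w : L w = T by rewrite /inverse_subordinator nu1 eqxx.
  under eq_integral do rewrite time_changed_joint LE LT.
  rewrite E ?(ltW elapsed_gt0)//.
  under eq_integral do rewrite LT -EFinM.
  by rewrite integral_cst// [X in (_ * X)%E](probability_setT P) mule1 mulrC.
have {}nu1 : nu < 1 by rewrite lt_neqAle nu1; case/andP: hnu.
have [HH BH] := hH nu1.
pose f (z : g_sigma_algebraType FB * R) : \bar R := (g (B (Num.max 0 z.2) z.1))%:E.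
have mf : measurable_fun setT f.
  apply/measurable_EFinP.
  exact: (measurableT_comp (measurable_zonal _ v) measurable_brownian_joint).
have mid := measurable_id_g_sigma_algebra (sigma_process_algebra `[0, +oo[ B)
  brownian_sigma_sub.
have ind A C : measurable A -> measurable C ->
    (P ((id : Omega -> g_sigma_algebraType FB) @^-1` A `&` L @^-1` C) =
     P ((id : Omega -> g_sigma_algebraType FB) @^-1` A) * P (L @^-1` C))%E.
  move=> mA mC; apply: BH; last exact: measurable_clock_sigma.
  exact: (measurable_g_sigma_algebra (sigma_process_algebra _ _) mA).
have fM w : (\int[P]_w' `|f (w', L w)| <= 1%:E)%E.
  rewrite -[leRHS]mul1e -[X in (_ * X)%E](probability_setT P).
  apply: integral_le_bound => //; last by apply: aeW => w' _; exact: zonal_legendre_le1.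
  exact: (measurableT_comp (measurable_fun_pair1 (L w) mf) mid).
have [_] := indep_integral_bound mid measurable_clock ind mf fM.
rewrite /f /= => FZ.
under eq_integral do rewrite time_changed_joint.
rewrite FZ; apply: eq_integral => w _.
by rewrite E// LE EFinM muleC.
Qed.

End TimeChangedBrownianMotion.

(** * Square-integrable random variables *)

Section SquareIntegrable.
Context (R : realType) (d : measure_display) (Omega : measurableType d)
  (P : probability Omega R).
Implicit Types X Y Z : Omega -> R.

Definition square_integrable X :=
  measurable_fun setT X /\ (\int[P]_w (X w ^+ 2)%:E < +oo)%E.

(** E(XY), the inner product of L^2. *)
Definition corr X Y : R := \int[P]_w (X w * Y w).

Lemma square_integrable_sqr X : square_integrable X ->
  P.-integrable setT (fun w => (X w ^+ 2)%:E).
Proof.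
move=> [mX X2]; apply/integrableP; split; first by apply/measurable_EFinP; exact: measurable_funX.
by under eq_integral => w _ do rewrite gee0_abs ?lee_fin ?sqr_ge0//.
Qed.

Lemma normrM_le_sqrD (x y : R) : `|x * y| <= x ^+ 2 + y ^+ 2.
Proof.
rewrite normrM -(real_normK (num_real x)) -(real_normK (num_real y)).
have := sqr_ge0 (`|x| - `|y|); have : 0 <= `|x| * `|y| by rewrite mulr_ge0.
by rewrite sqrrB; lra.
Qed.

Lemma square_integrable_mul X Y : square_integrable X -> square_integrable Y ->
  P.-integrable setT (fun w => (X w * Y w)%:E).
Proof.
move=> hX hY.
have := integrableD measurableT (square_integrable_sqr hX) (square_integrable_sqr hY).
apply: le_integrable => //.
  by apply/measurable_EFinP; apply: measurable_funM; [exact: hX.1|exact: hY.1].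
move=> w _ /=; rewrite lee_fin [leRHS]ger0_norm; first exact: normrM_le_sqrD.
by rewrite addr_ge0 ?sqr_ge0.
Qed.

Lemma corrE X Y : square_integrable X -> square_integrable Y ->
  (\int[P]_w (X w * Y w)%:E = (corr X Y)%:E)%E.
Proof.
move=> hX hY; rewrite /corr /Rintegral fineK//.
exact: (integrable_fin_num measurableT (square_integrable_mul hX hY)).
Qed.

Lemma square_integrableZ (a : R) X : square_integrable X ->
  square_integrable (fun w => a * X w).
Proof.
move=> hX; split; first by apply: measurable_funM; [exact: measurable_cst|exact: hX.1].
under eq_integral do rewrite exprMn EFinM.
rewrite integralZl//; last exact: square_integrable_sqr.
have /fin_numP[] := integrable_fin_num measurableT (square_integrable_sqr hX).
by case: (\int[P]_w _)%E => // r _ _; rewrite -EFinM ltry.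
Qed.

Lemma square_integrableD X Y : square_integrable X -> square_integrable Y ->
  square_integrable (fun w => X w + Y w).
Proof.
move=> hX hY; split; first by apply: measurable_funD; [exact: hX.1|exact: hY.1].
have i : P.-integrable setT (fun w => ((X w + Y w) ^+ 2)%:E).
  under eq_fun do rewrite expr2 mulrDl !mulrDr !EFinD.
  by apply: integrableD => //; apply: integrableD => //; exact: square_integrable_mul.
have /integrableP[_] := i.
by under eq_integral => w _ do rewrite gee0_abs ?lee_fin ?sqr_ge0//.
Qed.

Lemma square_integrable0 : square_integrable (fun=> 0).
Proof.
split; first exact: measurable_cst.
by under eq_integral do rewrite expr0n/=; rewrite integral0 ltry.
Qed.

Lemma square_integrable_sum (I : Type) (s : seq I) (Q : pred I) (X : I -> Omega -> R) :
  (forall i, Q i -> square_integrable (X i)) ->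
  square_integrable (fun w => \sum_(i <- s | Q i) X i w).
Proof.
move=> hX; elim: s => [|i s IH].
  by under eq_fun do rewrite big_nil; exact: square_integrable0.
have [Qi|nQi] := boolP (Q i); last by under eq_fun do rewrite big_cons (negbTE nQi).
by under eq_fun do rewrite big_cons Qi; apply: square_integrableD => //; exact: hX.
Qed.

Lemma corrC X Y : corr X Y = corr Y X.
Proof. by apply: eq_Rintegral => w _; rewrite mulrC. Qed.

Lemma corrZl (a : R) X Y : square_integrable X -> square_integrable Y ->
  corr (fun w => a * X w) Y = a * corr X Y.
Proof.
move=> hX hY; rewrite /corr -RintegralZl//; last exact: square_integrable_mul.
by apply: eq_Rintegral => w _; rewrite mulrA.
Qed.

Lemma corrDl X Y Z : square_integrable X -> square_integrable Y -> square_integrable Z ->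
  corr (fun w => X w + Y w) Z = corr X Z + corr Y Z.
Proof.
move=> hX hY hZ; rewrite /corr -RintegralD//; try exact: square_integrable_mul.
by apply: eq_Rintegral => w _; rewrite mulrDl.
Qed.

Lemma corr_suml (I : Type) (s : seq I) (Q : pred I) (X : I -> Omega -> R) Z :
  (forall i, Q i -> square_integrable (X i)) -> square_integrable Z ->
  corr (fun w => \sum_(i <- s | Q i) X i w) Z = \sum_(i <- s | Q i) corr (X i) Z.
Proof.
move=> hX hZ; elim: s => [|i s IH].
  rewrite big_nil -[RHS](mul0r (fine (P setT))) -Rintegral_cst//.
  by apply: eq_Rintegral => w _; rewrite big_nil mul0r.
rewrite big_cons -IH; case: ifPn => Qi; last first.
  by apply: eq_Rintegral => w _; rewrite big_cons (negbTE Qi).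
rewrite -corrDl//; [|exact: hX|exact: square_integrable_sum].
by apply: eq_Rintegral => w _; rewrite big_cons Qi.
Qed.

(** Continuity of the inner product, from
    |xz| <= x^2 / e + e z^2 with a small [e]. *)
Lemma corr_cvg (X_ : nat -> Omega -> R) X Z :
  (forall n, square_integrable (X_ n)) -> square_integrable X -> square_integrable Z ->
  (\int[P]_w ((X w - X_ n w) ^+ 2)%:E)%E @[n --> \oo] --> 0%E ->
  corr (X_ n) Z @[n --> \oo] --> corr X Z.
Proof.
move=> hX_ hX hZ cX.
pose D n w := X w + (-1) * X_ n w.
have hD n : square_integrable (D n).
  by apply: square_integrableD => //; exact: square_integrableZ.
pose a n := \int[P]_w (D n w ^+ 2).
have aE n : (\int[P]_w ((X w - X_ n w) ^+ 2)%:E = (a n)%:E)%E.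
  rewrite /a /Rintegral fineK; last first.
    exact: (integrable_fin_num measurableT (square_integrable_sqr (hD n))).
  by apply: eq_integral => w _; rewrite /D mulN1r.
have ca : a @ \oo --> 0.
  rewrite (_ : a = fine \o (fun n => \int[P]_w ((X w - X_ n w) ^+ 2)%:E)%E).
    exact: (fine_cvg cX).
  by apply/funext => n /=; rewrite aE.
pose c := \int[P]_w (Z w ^+ 2).
have c0 : 0 <= c by apply: Rintegral_ge0 => w _; exact: sqr_ge0.
have bound n e : 0 < e -> `|corr X Z - corr (X_ n) Z| <= a n / e + e * c.
  move=> e0; have -> : corr X Z - corr (X_ n) Z = corr (D n) Z.
    rewrite /D corrDl//; last exact: square_integrableZ.
    by rewrite corrZl// mulN1r.
  apply: (le_trans (le_normr_Rintegral measurableT (square_integrable_mul (hD n) hZ))).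
  have i1 : P.-integrable setT (fun w => (e^-1 * D n w ^+ 2)%:E).
    by under eq_fun do rewrite EFinM; apply: integrableZl => //; exact: square_integrable_sqr.
  have i2 : P.-integrable setT (fun w => (e * Z w ^+ 2)%:E).
    by under eq_fun do rewrite EFinM; apply: integrableZl => //; exact: square_integrable_sqr.
  rewrite mulrC /a /c -!RintegralZl//; try exact: square_integrable_sqr.
  rewrite -RintegralD//; apply: le_Rintegral => //.
  - exact: (integrable_norm (square_integrable_mul (hD n) hZ)).
  - exact: (integrableD measurableT i1 i2).
  move=> w _.
  have s0 : 0 < Num.sqrt e by rewrite sqrtr_gt0.
  have := normrM_le_sqrD ((Num.sqrt e)^-1 * D n w) (Num.sqrt e * Z w).
  rewrite !exprMn exprVn sqr_sqrtr ?(ltW e0)//.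
  by rewrite mulrACA mulVf ?gt_eqF// mul1r.
apply/cvgrPdist_lt => e e0.
pose eps := e / (2 * (c + 1)).
have eps0 : 0 < eps by rewrite divr_gt0// mulr_gt0// ltr_wpDl.
have p0 : 0 < eps * (e / 2) by rewrite mulr_gt0// divr_gt0.
have /cvgrPdist_lt/(_ _ p0) na := ca; near=> n.
apply: (le_lt_trans (bound n _ eps0)).
have an : a n < eps * (e / 2).
  have : `|0 - a n| < eps * (e / 2) by near: n.
  by rewrite sub0r normrN; apply: le_lt_trans; exact: ler_norm.
have h1 : a n / eps < e / 2 by rewrite ltr_pdivrMr// mulrC.
have h2 : eps * c <= e / 2.
  rewrite /eps mulrAC ler_pdivrMr ?mulr_gt0 ?ltr_wpDl//.
  have -> : e / 2 * (2 * (c + 1)) = e * (c + 1) by field.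
  by rewrite ler_wpM2l ?(ltW e0)// lerDl.
by lra.
Unshelve. all: by end_near. Qed.

End SquareIntegrable.

(** * Covariance of the field *)

Section Rotations.
Context (R : realType).

Lemma inner_rotate (g : SO3 R) (u v : sphere R) :
  inner (rotate g u) (rotate g v) = inner u v.
Proof.
have gTg : (so3_mx g)^T *m so3_mx g = 1%:M by exact/mulmx1C/so3_orthogonal.
by rewrite !innerE /= trmx_mul trmxK mulmxA -(mulmxA (u : 'rV_3)) gTg mulmx1.
Qed.

Definition so3_id : SO3 R.
Proof. by exists 1%:M; rewrite ?trmx1 ?mulmx1 ?det1. Defined.

Lemma rotate_id (u : sphere R) : rotate so3_id u = u.
Proof. by apply/val_inj; rewrite /= trmx1 mulmx1. Qed.

Definition entries3 (a00 a01 a02 a10 a11 a12 a20 a21 a22 : R) : 'M[R]_3 :=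
  \matrix_(i < 3, j < 3) nth 0 (nth [::]
    [:: [:: a00; a01; a02]; [:: a10; a11; a12]; [:: a20; a21; a22]] i) j.

Lemma det_entries3 a00 a01 a02 a10 a11 a12 a20 a21 a22 :
  \det (entries3 a00 a01 a02 a10 a11 a12 a20 a21 a22) =
  a00 * (a11 * a22 - a12 * a21) - a01 * (a10 * a22 - a12 * a20)
  + a02 * (a10 * a21 - a11 * a20).
Proof.
rewrite (expand_det_row _ ord0) !big_ord_recl big_ord0 !mxE /=.
rewrite /cofactor !(expand_det_row _ ord0) !big_ord_recl !big_ord0 !mxE /=.
rewrite /cofactor !det_mx11 !mxE /=.
rewrite !(expr0, expr1, exprS, mulr1) /=.
ring.
Qed.

(** Off the south pole, rotate in the plane spanned by [v] and the north pole;
    at the south pole, turn upside down. *)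
Lemma rotate_to_north (v : sphere R) : exists g : SO3 R, rotate g v = north R.
Proof.
pose a := (v : 'rV_3) 0 0; pose b := (v : 'rV_3) 0 1; pose c := (v : 'rV_3) 0 2%:R.
have abc : a ^+ 2 + b ^+ 2 + c ^+ 2 = 1.
  rewrite -(inner_pos v) /inner !big_ord_recl big_ord0 addr0 addrA -!expr2.
  by congr (_ ^+ 2 + _ ^+ 2 + _ ^+ 2); congr ((v : 'rV_3) _ _); apply/val_inj.
have vE i : (v : 'rV_3) 0 i = if i == 0 :> nat then a else if i == 1 :> nat then b else c.
  by case: i => -[|[|[|//]]] i /=; congr ((v : 'rV_3) _ _); apply/val_inj.
have [cN1|cN1] := eqVneq c (-1).
  have ab0 : a ^+ 2 + b ^+ 2 = 0 by move: abc; rewrite cN1 sqrrN expr1n; lra.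
  have a0 : a = 0.
    by apply/eqP; rewrite -sqrf_eq0 eq_le sqr_ge0 andbT; have := sqr_ge0 b; lra.
  have b0 : b = 0.
    by apply/eqP; rewrite -sqrf_eq0 eq_le sqr_ge0 andbT; have := sqr_ge0 a; lra.
  pose M := entries3 1 0 0 0 (-1) 0 0 0 (-1).
  have MO : M *m M^T = 1%:M.
    apply/matrixP => i j; rewrite !mxE !big_ord_recl big_ord0 !mxE /=.
    by case: i => -[|[|[|//]]] i; case: j => -[|[|[|//]]] j; rewrite /= -?val_eqE /=;
      ring.
  have Md : \det M = 1 by rewrite det_entries3; ring.
  exists (MkSO3 MO Md); apply/val_inj/rowP => i.
  rewrite /= !mxE !big_ord_recl big_ord0 !mxE !vE /= a0 b0 cN1.
  by case: i => -[|[|[|//]]] i /=; ring.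
have c1 : 1 + c != 0 by apply: contra cN1; rewrite addrC addr_eq0.
pose k := (1 + c)^-1.
have h2 : k * (1 + c) - 1 = 0 by rewrite mulVf// subrr.
have h1 : k * (a ^+ 2 + b ^+ 2) - (1 - c) = 0.
  rewrite (_ : a ^+ 2 + b ^+ 2 = (1 + c) * (1 - c)); last by move: abc; lra.
  by rewrite mulKf// subrr.
have h3 : a ^+ 2 + b ^+ 2 + c ^+ 2 - 1 = 0 by rewrite abc subrr.
pose M := entries3 (1 - a ^+ 2 * k) (- a * b * k) (- a) (- a * b * k) (1 - b ^+ 2 * k) (- b)
  a b c.
(* The entries agree modulo the relations h1, h2 and h3; y1, y2 and y3 are the
   multipliers of these relations in the difference of the two sides. *)
have zero (x y1 y2 y3 z : R) : x = z + y1 * (k * (a ^+ 2 + b ^+ 2) - (1 - c))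
    + y2 * (k * (1 + c) - 1) + y3 * (a ^+ 2 + b ^+ 2 + c ^+ 2 - 1) -> x = z.
  by rewrite h1 h2 h3 !mulr0 !addr0.
have MO : M *m M^T = 1%:M.
  apply/matrixP => i j; rewrite !mxE !big_ord_recl big_ord0 !mxE /=.
  case: i => -[|[|[|//]]] i; case: j => -[|[|[|//]]] j; rewrite /= -?val_eqE /=.
  - apply: (zero _ (a ^+ 2 * k) (- a ^+ 2) 0); ring.
  - apply: (zero _ (a * b * k) (- (a * b)) 0); ring.
  - apply: (zero _ (- a) 0 0); ring.
  - apply: (zero _ (a * b * k) (- (a * b)) 0); ring.
  - apply: (zero _ (b ^+ 2 * k) (- b ^+ 2) 0); ring.
  - apply: (zero _ (- b) 0 0); ring.
  - apply: (zero _ (- a) 0 0); ring.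
  - apply: (zero _ (- b) 0 0); ring.
  - apply: (zero _ 0 0 1); ring.
have Md : \det M = 1 by rewrite det_entries3; apply: (zero _ (- c) 0 1); ring.
exists (MkSO3 MO Md); apply/val_inj/rowP => i.
rewrite /= !mxE !big_ord_recl big_ord0 !mxE !vE /=.
case: i => -[|[|[|//]]] i /=.
- apply: (zero _ (- a) 0 0); ring.
- apply: (zero _ (- b) 0 0); ring.
- apply: (zero _ 0 0 1); ring.
Qed.

End Rotations.

Section SphericalHarmonics.
Context (R : realType).
Local Notation Re := complex.Re.
Local Notation Im := complex.Im.
Implicit Types (z w : R[i]) (l m : nat).

Lemma Re_mulc z w : Re (z * w) = Re z * Re w - Im z * Im w.
Proof. by case: z w => a b [c d]. Qed.

Lemma Im_mulc z w : Im (z * w) = Re z * Im w + Im z * Re w.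
Proof. by case: z w => a b [c d]. Qed.

Lemma Re_addc z w : Re (z + w) = Re z + Re w.
Proof. by case: z w => a b [c d]. Qed.

Lemma Im_addc z w : Im (z + w) = Im z + Im w.
Proof. by case: z w => a b [c d]. Qed.

Lemma Re_conjc z : Re (conjc z) = Re z.
Proof. by case: z. Qed.

Lemma Im_conjc z : Im (conjc z) = - Im z.
Proof. by case: z. Qed.

Definition cmeasurable d (X : measurableType d) (f : X -> R[i]) :=
  measurable_fun setT (fun x => Re (f x)) /\ measurable_fun setT (fun x => Im (f x)).

Lemma cmeasurableM d (X : measurableType d) (f g : X -> R[i]) :
  cmeasurable f -> cmeasurable g -> cmeasurable (fun x => f x * g x).
Proof.
move=> [f1 f2] [g1 g2]; split.
  under eq_fun do rewrite Re_mulc.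
  by apply: measurable_funB; apply: measurable_funM.
under eq_fun do rewrite Im_mulc.
by apply: measurable_funD; apply: measurable_funM.
Qed.

Lemma cmeasurable_cst d (X : measurableType d) (z : R[i]) : cmeasurable (fun _ : X => z).
Proof. by split; exact: measurable_cst. Qed.

Lemma cmeasurable_Ylm_nneg l m : cmeasurable (@Ylm_nneg R l m).
Proof.
apply: cmeasurableM.
  split; last exact: measurable_cst.
  apply: measurable_funM; first exact: measurable_cst.
  have mp (p : {poly R}) : measurable_fun setT (horner p).
    by apply: continuous_measurable_fun; exact: continuous_horner.
  exact: (measurableT_comp (mp _) (measurable_coord 2)).
elim: m => [|m IH].
  by under eq_fun do rewrite expr0; exact: cmeasurable_cst.
under eq_fun do rewrite exprS.
apply: cmeasurableM => //; split; first exact: (measurable_coord 0).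
exact: (measurable_coord 1).
Qed.

Lemma cmeasurable_Ylm l (m : int) : cmeasurable (@Ylm R l m).
Proof.
case: m => m; first exact: cmeasurable_Ylm_nneg.
have [m1 m2] := cmeasurable_Ylm_nneg l m.+1.
apply: cmeasurableM; first exact: cmeasurable_cst.
split; first by under eq_fun do rewrite Re_conjc.
by under eq_fun do rewrite Im_conjc; exact: measurable_funN.
Qed.

Lemma inner_north (u : sphere R) : inner u (north R) = Defs.coord 2 u.
Proof.
rewrite /inner !big_ord_recl big_ord0 !mxE /= !mulr0 !add0r mulr1 addr0 /Defs.coord.
by congr (pos u _ _); apply/val_inj; rewrite /= inordK.
Qed.

(** x_0 + i x_1 vanishes at the pole. *)
Lemma Ylm_north l (m : int) : m != 0 -> Ylm l m (north R) = 0.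
Proof.
have z0 : (Defs.coord 0 (north R) +i* Defs.coord 1 (north R))%C = 0 :> R[i].
  by rewrite /Defs.coord !mxE !inordK.
case: m => m m0; rewrite /Ylm /Ylm_nneg z0.
  by rewrite expr0n (_ : (m == 0)%N = false) ?mulr0//; apply/negbTE.
by rewrite [0 ^+ _]exprS mul0r mulr0 conjc0 mulr0.
Qed.

(** The normalising constant of the zonal harmonic Y_l0. *)
Definition zonal_cst l : R := Num.sqrt ((2 * l + 1)%:R / (4 * pi)).

Lemma Yl0E l (u : sphere R) :
  Ylm l 0 u = (zonal_cst l * (legendre R l).[inner u (north R)])%:C%C.
Proof.
rewrite -[LHS]/(Ylm_nneg l 0 u) /Ylm_nneg !expr0 !mulr1 subn0 addn0 derivn0 inner_north.
congr (Num.sqrt _ * _)%:C%C.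
by rewrite -mulrA divff ?mulr1// pnatr_eq0 -lt0n fact_gt0.
Qed.

Lemma zonal_cst_sqr l : zonal_cst l ^+ 2 = (2 * l + 1)%:R / (4 * pi).
Proof. by rewrite sqr_sqrtr// divr_ge0// mulr_ge0// pi_ge0. Qed.

End SphericalHarmonics.

Section SpectralCovariance.
Context (R : realType) (d : measure_display) (Omega : measurableType d)
  (P : probability Omega R) (T : sphere R -> Omega -> R) (C : nat -> R).
Hypothesis hT : isotropic_field P T C.
Local Notation Re := complex.Re.
Local Notation Im := complex.Im.
Implicit Types (l n : nat) (m : int) (u v : sphere R).

Lemma measurable_field_at u : measurable_fun setT (T u).
Proof. exact: (measurable_fun_pair1 u (if_measurable hT)). Qed.

Lemma measurable_Rintegral_param (Phi : Omega * sphere R -> R) :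
  measurable_fun setT Phi ->
  measurable_fun setT (fun w => \int[@surface_measure R]_x Phi (w, x)).
Proof.
move=> mPhi.
have mPhiE : measurable_fun setT (EFin \o Phi) by exact/measurable_EFinP.
have mpos : measurable_fun setT (fun w => \int[@surface_measure R]_x (EFin \o Phi)^\+ (w, x))%E.
  exact: (@measurable_fun_fubini_tonelli_F _ _ _ _ _ (@surface_measure R)
    (EFin \o Phi)^\+%E (measurable_funepos mPhiE) (fun=> funepos_ge0 _ _)).
have mneg : measurable_fun setT (fun w => \int[@surface_measure R]_x (EFin \o Phi)^\- (w, x))%E.
  exact: (@measurable_fun_fubini_tonelli_F _ _ _ _ _ (@surface_measure R)
    (EFin \o Phi)^\-%E (measurable_funeneg mPhiE) (fun=> funeneg_ge0 _ _)).
have mfine : measurable_fun setT (@fine R) by [].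
have := measurableT_comp mfine (emeasurable_funB mpos mneg).
apply: eq_measurable_fun => w _ /=; rewrite /Rintegral. rewrite [in RHS]integralE.
by congr (fine (_ - _)%E); apply: eq_integral => x _; rewrite ?funeposE ?funenegE.
Qed.

Lemma cmeasurable_alm l m : cmeasurable (alm T l m).
Proof.
have [mR mI] := cmeasurable_Ylm R l m.
split.
  apply: (measurable_Rintegral_param (Phi := fun z => T z.2 z.1 * Re (conjc (Ylm l m z.2)))).
  apply: measurable_funM; first exact: (if_measurable hT).
  under eq_fun do rewrite Re_conjc.
  exact: (measurableT_comp mR measurable_snd).
apply: (measurable_Rintegral_param (Phi := fun z => T z.2 z.1 * Im (conjc (Ylm l m z.2)))).
apply: measurable_funM; first exact: (if_measurable hT).
under eq_fun do rewrite Im_conjc.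
by apply: measurable_funN; exact: (measurableT_comp mI measurable_snd).
Qed.

Lemma expectation_alm (l1 l2 : nat) m1 m2 : (`|m1| <= l1)%N -> (`|m2| <= l2)%N ->
  let a1 := alm T l1 m1 in let a2 := alm T l2 m2 in
  (\int[P]_w (Re (a1 w) * Re (a2 w) + Im (a1 w) * Im (a2 w))%:E =
    (((l1 == l2) && (m1 == m2))%:R * C l1)%:E)%E /\
  (\int[P]_w (Im (a1 w) * Re (a2 w) - Re (a1 w) * Im (a2 w))%:E = 0)%E.
Proof.
move=> h1 h2 a1 a2.
have [/(_ l1 l2 m1 m2 h1 h2) [e1 e2] _] := if_spectrum hT.
move: e1 e2; rewrite unlock => e1 e2; split.
  transitivity (\int[P]_w (Re (a1 w * conjc (a2 w)))%:E)%E.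
    apply: eq_integral => w _; congr EFin.
    by rewrite Re_mulc Re_conjc Im_conjc; ring.
  by rewrite e1; congr EFin; case: (_ && _); rewrite ?mul1r ?mul0r.
transitivity (\int[P]_w (Im (a1 w * conjc (a2 w)))%:E)%E.
  apply: eq_integral => w _; congr EFin.
  by rewrite Im_mulc Re_conjc Im_conjc; ring.
by rewrite e2; congr EFin; case: (_ && _); rewrite ?mul1r ?mul0r.
Qed.

Lemma alm_sqr l m : (`|m| <= l)%N ->
  (\int[P]_w (Re (alm T l m w) ^+ 2 + Im (alm T l m w) ^+ 2)%:E = (C l)%:E)%E.
Proof.
move=> h; have [e _] := expectation_alm h h; move: e; rewrite !eqxx mul1r => <-.
by apply: eq_integral => w _; rewrite !expr2.
Qed.

Lemma spectrum_ge0 l : 0 <= C l.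
Proof.
rewrite -lee_fin -(@alm_sqr l 0)//; apply: integral_ge0 => w _.
by rewrite lee_fin addr_ge0 ?sqr_ge0.
Qed.

Lemma square_integrable_alm l m : (`|m| <= l)%N ->
  square_integrable P (fun w => Re (alm T l m w)) /\
  square_integrable P (fun w => Im (alm T l m w)).
Proof.
move=> h; have [mR mI] := cmeasurable_alm l m; have e := alm_sqr h.
have mS : measurable_fun setT
    (fun w => (Re (alm T l m w) ^+ 2 + Im (alm T l m w) ^+ 2)%:E).
  by apply/measurable_EFinP; apply: measurable_funD; exact: measurable_funX.
split; split => //; (apply: (@le_lt_trans _ _ (C l)%:E); last exact: ltry);
  rewrite -e; apply: ge0_le_integral => //.
- by move=> w _; rewrite lee_fin sqr_ge0.
- by apply/measurable_EFinP; exact: measurable_funX.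
- by move=> w _; rewrite lee_fin lerDl sqr_ge0.
- by move=> w _; rewrite lee_fin sqr_ge0.
- by apply/measurable_EFinP; exact: measurable_funX.
- by move=> w _; rewrite lee_fin lerDr sqr_ge0.
Qed.

(** The zonal coefficients a_l0 are real, the harmonics Y_l0 being so. *)
Definition alpha l (w : Omega) : R := Re (alm T l 0 w).

Lemma Im_alm0 l w : Im (alm T l 0 w) = 0.
Proof.
rewrite -[LHS]/(\int[@surface_measure R]_x (T x w * Im (conjc (Ylm l 0 x)))).
rewrite -[RHS](mul0r (fine (@surface_measure R setT))) -Rintegral_cst//.
by apply: eq_Rintegral => u _; rewrite Yl0E Im_conjc/= oppr0 mulr0.
Qed.

Lemma square_integrable_alpha l : square_integrable P (alpha l).
Proof. by have [] := @square_integrable_alm l 0 isT. Qed.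

Lemma corr_alm_alpha l m l' : (`|m| <= l)%N ->
  corr P (fun w => Re (alm T l m w)) (alpha l') = ((l == l') && (m == 0))%:R * C l /\
  corr P (fun w => Im (alm T l m w)) (alpha l') = 0.
Proof.
move=> h; have [hR hI] := square_integrable_alm h.
have [e1 e2] := @expectation_alm l l' m 0 h isT.
have ha := square_integrable_alpha l'.
split; apply: EFin_inj; rewrite -corrE//.
  rewrite -e1; apply: eq_integral => w _.
  by rewrite Im_alm0 mulr0 addr0.
rewrite -[RHS]e2; apply: eq_integral => w _.
by rewrite Im_alm0 mulr0 subr0.
Qed.

Lemma square_integrable_field u : square_integrable P (T u).
Proof.
split; first exact: measurable_field_at.
have [/(_ (so3_id R) u) + _] := if_weakly_isotropic2 hT.
by rewrite unlock rotate_id.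
Qed.

Let index_bound l (k : nat) : (k < l.*2.+1)%N -> (`|k%:Z - l%:Z| <= l)%N.
Proof. by lia. Qed.

Let Re_harmonic_sum n u w : Re (harmonic_sum T n u w) =
  \sum_(0 <= l < n) \sum_(0 <= k < l.*2.+1 | (k < l.*2.+1)%N)
    (Re (Ylm l (k%:Z - l%:Z) u) * Re (alm T l (k%:Z - l%:Z) w)
     + - Im (Ylm l (k%:Z - l%:Z) u) * Im (alm T l (k%:Z - l%:Z) w)).
Proof.
rewrite /harmonic_sum (big_morph (@complex.Re R) (@Re_addc R) erefl).
apply: eq_bigr => l _; rewrite (big_morph (@complex.Re R) (@Re_addc R) erefl).
by rewrite big_nat; apply: eq_bigr => k _; rewrite Re_mulc; ring.
Qed.

Let Im_harmonic_sum n u w : Im (harmonic_sum T n u w) =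
  \sum_(0 <= l < n) \sum_(0 <= k < l.*2.+1 | (k < l.*2.+1)%N)
    (Im (Ylm l (k%:Z - l%:Z) u) * Re (alm T l (k%:Z - l%:Z) w)
     + Re (Ylm l (k%:Z - l%:Z) u) * Im (alm T l (k%:Z - l%:Z) w)).
Proof.
rewrite /harmonic_sum (big_morph (@complex.Im R) (@Im_addc R) erefl).
apply: eq_bigr => l _; rewrite (big_morph (@complex.Im R) (@Im_addc R) erefl).
by rewrite big_nat; apply: eq_bigr => k _; rewrite Im_mulc; ring.
Qed.

Let square_integrable_term (a b : R) l (k : nat) : (k < l.*2.+1)%N ->
  square_integrable P (fun w => a * Re (alm T l (k%:Z - l%:Z) w)
     + b * Im (alm T l (k%:Z - l%:Z) w)).
Proof.
move=> /index_bound/square_integrable_alm[hR hI].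
by apply: square_integrableD; exact: square_integrableZ.
Qed.

Lemma square_integrable_Re_harmonic_sum n u :
  square_integrable P (fun w => Re (harmonic_sum T n u w)).
Proof.
under eq_fun do rewrite Re_harmonic_sum.
apply: square_integrable_sum => l _; apply: square_integrable_sum => k hk.
exact: square_integrable_term.
Qed.

Lemma square_integrable_Im_harmonic_sum n u :
  square_integrable P (fun w => Im (harmonic_sum T n u w)).
Proof.
under eq_fun do rewrite Im_harmonic_sum.
apply: square_integrable_sum => l _; apply: square_integrable_sum => k hk.
exact: square_integrable_term.
Qed.

Lemma Re_harmonic_sum_cvg u :
  (\int[P]_w ((T u w - Re (harmonic_sum T n u w)) ^+ 2)%:E)%E @[n --> \oo] --> 0%E.
Proof.
have [/(_ u) + _] := if_spectral hT; rewrite unlock => cv.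
have mR n := (square_integrable_Re_harmonic_sum n u).1.
have mI n := (square_integrable_Im_harmonic_sum n u).1.
have mT := measurable_field_at u.
have mD n : measurable_fun setT (fun w => (T u w - Re (harmonic_sum T n u w)) ^+ 2).
  by apply: measurable_funX; apply: measurable_funB.
apply: (squeeze_cvge _ (cvg_cst 0%E) cv); apply: nearW => n.
apply/andP; split; first by apply: integral_ge0 => w _; rewrite lee_fin sqr_ge0.
have remE w : remainder T n u w = (T u w - Re (harmonic_sum T n u w)) ^+ 2
    + Im (harmonic_sum T n u w) ^+ 2.
  rewrite /remainder /sqnormc; case: (harmonic_sum T n u w) => a b /=.
  by rewrite sub0r sqrrN.
apply: ge0_le_integral => //.
- by move=> w _; rewrite lee_fin sqr_ge0.
- exact/measurable_EFinP.
- apply/measurable_EFinP; rewrite (funext remE).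
  by apply: measurable_funD => //; exact: measurable_funX.
- by move=> w _; rewrite lee_fin remE lerDl sqr_ge0.
Qed.

(** Only the m = 0 term of degree l' is correlated with [alpha l']. *)
Lemma corr_field_alpha u l' : corr P (T u) (alpha l') = C l' * Re (Ylm l' 0 u).
Proof.
have ha := square_integrable_alpha l'.
have cv := corr_cvg (fun n => square_integrable_Re_harmonic_sum n u)
  (square_integrable_field u) ha (Re_harmonic_sum_cvg u).
rewrite -(cvg_lim (@Rhausdorff R) cv); apply: cvg_lim; first exact: Rhausdorff.
apply: cvg_near_cst; near=> n.
have ln : (l' < n)%N by near: n; exact: nbhs_infty_gt.
rewrite (funext (Re_harmonic_sum n u)).
rewrite corr_suml//; last first.
  move=> l _; apply: square_integrable_sum => k hk; exact: square_integrable_term.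
transitivity (\sum_(0 <= l < n | l == l') C l * Re (Ylm l 0 u)); last first.
  by rewrite big_nat1_eq ln.
rewrite [RHS]big_mkcond; apply: eq_bigr => l _.
rewrite corr_suml//; last by move=> k hk; exact: square_integrable_term.
transitivity (\sum_(0 <= k < l.*2.+1 | k == l) (l == l')%:R * (C l * Re (Ylm l 0 u))).
  rewrite [RHS]big_mkcond [LHS]big_nat_cond [RHS]big_nat_cond.
  apply: eq_big => [k|k /andP[_ hk]]; first by rewrite andbT; case: leqP.
  have hb := index_bound hk; have [hR hI] := square_integrable_alm hb.
  rewrite corrDl//; try exact: square_integrableZ.
  rewrite !corrZl//.
  have [-> ->] := corr_alm_alpha l' hb.
  rewrite mulr0 addr0 subr_eq0 eqz_nat; case: (eqVneq k l) => [->|kl].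
    by rewrite andbT subrr; ring.
  by rewrite andbF mul0r mulr0.
rewrite big_nat1_eq leq0n /= (_ : (l < l.*2.+1)%N); last by lia.
by case: eqVneq => _; rewrite ?mul1r ?mul0r.
Unshelve. all: by end_near. Qed.

(** By weak isotropy one of the points can be rotated to the pole, where only the
    zonal harmonics survive. *)
Lemma covariance_series u v :
  series (fun l => (2 * l + 1)%:R / (4 * pi) * C l * (legendre R l).[inner u v]) @ \oo -->
  corr P (T u) (T v).
Proof.
have [g gv] := rotate_to_north v.
have -> : corr P (T u) (T v) = corr P (T (north R)) (T (rotate g u)).
  rewrite [RHS]corrC -gv; have [_ /(_ g u v)] := if_weakly_isotropic2 hT.
  rewrite unlock !corrE; try exact: square_integrable_field.
  by move=> [].
set z := rotate g u.
have -> : inner u v = inner z (north R) by rewrite -gv inner_rotate.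
have cv := corr_cvg (fun n => square_integrable_Re_harmonic_sum n (north R))
  (square_integrable_field (north R)) (square_integrable_field z)
  (Re_harmonic_sum_cvg (north R)).
apply: cvg_trans cv; apply: near_eq_cvg; apply: nearW => n.
have E w : Re (harmonic_sum T n (north R) w) = \sum_(0 <= l < n) zonal_cst R l * alpha l w.
  rewrite Re_harmonic_sum; apply: eq_bigr => l _.
  transitivity (\sum_(0 <= k < l.*2.+1 | k == l) zonal_cst R l * alpha l w).
    rewrite [RHS]big_mkcond [LHS]big_nat_cond [RHS]big_nat_cond.
    apply: eq_big => [k|k /andP[_ hk]]; first by rewrite andbT; case: leqP.
    case: (eqVneq k l) => [->|kl].
      rewrite subrr Yl0E (inner_pos (north R)) legendre1 mulr1.
      rewrite -[Re (_%:C)%C]/(zonal_cst R l) -[Im (_%:C)%C]/(0 : R).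
      by rewrite oppr0 mul0r addr0.
    rewrite Ylm_north ?subr_eq0 ?eqz_nat// -[Re 0]/(0 : R) -[Im 0]/(0 : R).
    by rewrite oppr0 !mul0r addr0.
  by rewrite big_nat1_eq leq0n /= (_ : (l < l.*2.+1)%N)//; lia.
rewrite (funext E).
rewrite corr_suml//; last 2 first.
- by move=> l _; apply: square_integrableZ; exact: square_integrable_alpha.
- exact: square_integrable_field.
rewrite /series /=; apply: eq_bigr => l _.
rewrite corrZl//; [|exact: square_integrable_alpha|exact: square_integrable_field].
by rewrite corrC corr_field_alpha Yl0E /= -zonal_cst_sqr; ring.
Qed.

Lemma second_moment_field u : corr P (T u) (T u) = corr P (T (north R)) (T (north R)).
Proof.
have [g gu] := rotate_to_north u; rewrite -gu.
have [_ /(_ g u u)] := if_weakly_isotropic2 hT.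
by rewrite unlock !corrE; [move=> []|exact: square_integrable_field..].
Qed.

End SpectralCovariance.

(** * The composed field *)

Section ComposedField.
Context (R : realType) (d : measure_display) (Omega : measurableType d)
  (P : probability Omega R).

(** Averaging over X leaves k P_l(<x, Y>), which is zonal in Y with pole x, so
    averaging over Y produces the same factor again. *)
Lemma expectation_zonal_pair (X Y : Omega -> sphere R) (x y : sphere R) (k : R) l :
  measurable_fun setT X -> measurable_fun setT Y ->
  (forall A C, measurable A -> measurable C ->
    P (X @^-1` A `&` Y @^-1` C) = P (X @^-1` A) * P (Y @^-1` C))%E ->
  (forall v, \int[P]_w (zonal (legendre R l) v (X w))%:E =
    (k * zonal (legendre R l) v x)%:E)%E ->
  (forall v, \int[P]_w (zonal (legendre R l) v (Y w))%:E =
    (k * zonal (legendre R l) v y)%:E)%E ->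
  (\int[P]_w (zonal (legendre R l) (Y w) (X w))%:E =
   (k ^+ 2 * (legendre R l).[inner x y])%:E)%E.
Proof.
move=> mX mY ind EX EY.
pose f (z : sphere R * sphere R) : \bar R := (zonal (legendre R l) z.2 z.1)%:E.
have mf : measurable_fun setT f by apply/measurable_EFinP; exact: measurable_zonal2.
have f1 w : (\int[P]_w' `|f (X w', Y w)| <= 1%:E)%E.
  rewrite -[leRHS]mul1e -[X in (_ * X)%E](probability_setT P).
  apply: integral_le_bound => //; last by apply: aeW => w' _; exact: zonal_legendre_le1.
  exact: (measurableT_comp (measurable_fun_pair1 (Y w) mf) mX).
have [_] := indep_integral_bound mX mY ind mf f1.
rewrite /f /= => ->.
under eq_integral do rewrite EX zonalC EFinM.
rewrite integralZl//; last first.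
  apply: (@bounded_probability_integrable _ _ _ _ _ 1) => [|w].
    exact: (measurableT_comp (measurable_zonal _ _) mY).
  exact: zonal_legendre_le1.
by rewrite EY -EFinM zonalC mulrA -expr2.
Qed.

Variables (T : sphere R -> Omega -> R) (C : nat -> R).
Hypothesis hT : isotropic_field P T C.

(** [field_indep] provides a sigma-algebra for which [T] is jointly measurable,
    so its randomness can be integrated out at fixed points first. *)
Lemma expectation_composed_field (X Y : Omega -> sphere R) (F : set (set Omega)) :
  field_indep P T F -> measurable_fun setT X -> measurable_fun setT Y ->
  (forall A, measurable A -> F ((fun w => (X w, Y w)) @^-1` A)) ->
  P.-integrable setT (fun w => (composed_field T X w * composed_field T Y w)%:E) /\
  (\int[P]_w (composed_field T X w * composed_field T Y w)%:E =
   \int[P]_w (corr P (T (X w)) (T (Y w)))%:E)%E.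
Proof.
move=> [G [sG GM mTG ind]] mX mY FXY.
have mZ : measurable_fun setT (fun w => (X w, Y w)) by exact: measurable_fun_pair.
have mid := measurable_id_g_sigma_algebra sG GM.
have indZ A D : measurable A -> measurable D ->
    (P ((id : Omega -> g_sigma_algebraType G) @^-1` A `&` (fun w => (X w, Y w)) @^-1` D) =
     P ((id : Omega -> g_sigma_algebraType G) @^-1` A) * P ((fun w => (X w, Y w)) @^-1` D))%E.
  move=> mA mD; apply: ind; last exact: FXY.
  exact: (measurable_g_sigma_algebra sG mA).
pose f (z : g_sigma_algebraType G * (sphere R * sphere R)) : \bar R :=
  (T z.2.1 z.1 * T z.2.2 z.1)%:E.
have mf : measurable_fun setT f.
  have m1 : measurable_fun setT
      (fun z : g_sigma_algebraType G * (sphere R * sphere R) => (z.1, z.2.1)).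
    apply: measurable_fun_pair; first exact: measurable_fst.
    exact: (measurableT_comp measurable_fst measurable_snd).
  have m2 : measurable_fun setT
      (fun z : g_sigma_algebraType G * (sphere R * sphere R) => (z.1, z.2.2)).
    apply: measurable_fun_pair; first exact: measurable_fst.
    exact: (measurableT_comp measurable_snd measurable_snd).
  apply/measurable_EFinP; apply: measurable_funM.
    exact: (measurableT_comp mTG m1).
  exact: (measurableT_comp mTG m2).
pose M := corr P (T (north R)) (T (north R)).
have sq u : (\int[P]_w (T u w ^+ 2)%:E = M%:E)%E.
  have hu := square_integrable_field hT u.
  rewrite /M -(second_moment_field hT u) -corrE//.
have isq u : P.-integrable setT (fun w => (T u w ^+ 2)%:E).
  exact/square_integrable_sqr/(square_integrable_field hT).
have fM w : (\int[P]_w' `|f (w', (X w, Y w))| <= (M + M)%:E)%E.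
  rewrite EFinD -{1}(sq (X w)) -(sq (Y w)) -integralD//.
  apply: ge0_le_integral => //.
  - apply: measurableT_comp => //.
    exact: (measurableT_comp (measurable_fun_pair1 _ mf) mid).
  - apply: emeasurable_funD; [exact: measurable_int (isq (X w))|].
    exact: measurable_int (isq (Y w)).
  - by move=> w' _; rewrite /f /= -EFinD lee_fin normrM_le_sqrD.
have [i ->] := indep_integral_bound mid mZ indZ mf fM.
split=> //; apply: eq_integral => w _.
by rewrite /f /= corrE//; exact: (square_integrable_field hT).
Qed.

End ComposedField.

Theorem corollary1p5 (R : realType) (d : measure_display)
    (Omega : measurableType d) (P : probability Omega R)
    (T : sphere R -> Omega -> R) (C : nat -> R)
    (B : sphere R -> R -> Omega -> sphere R)
    (H : sphere R -> R -> Omega -> R)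
    (nu t0 t : R)
    (hnu : 0 < nu <= 1) (ht0 : 0 <= t0) (ht : t0 < t)
    (hT : isotropic_field P T C)
    (hB : forall x, sphere_brownian_motion P x (B x))
    (hH : nu < 1 -> forall x, stable_subordinator P nu (H x) /\
       indep_sigma P (sigma_process `[0, +oo[ (B x))
                     (sigma_process `[0, +oo[ (H x)))
    (hBB : forall x y, x != y ->
       indep_sigma P
         (sigma_process `[t0, +oo[ (time_changed nu t0 (B x) (H x)))
         (sigma_process `[t0, +oo[ (time_changed nu t0 (B y) (H y))))
    (hTB : field_indep P T
       (sigma_process [set i : sphere R * R | t0 <= i.2]
          (fun i => time_changed nu t0 (B i.1) (H i.1) i.2))) :
  let Tnu x := composed_field T (time_changed nu t0 (B x) (H x) t) in
  forall x y : sphere R, x != y ->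
    let a l := (2 * l + 1)%:R / (4 * pi) * C l
      * mittag_leffler nu (- mu_ R l * (t - t0) `^ nu) ^+ 2
      * (legendre R l).[inner x y] in
    [/\ P.-integrable setT (fun w => (Tnu x w * Tnu y w)%:E),
        cvgn (series a)
      & ('E_P[fun w => (Tnu x w * Tnu y w)%R] = (limn (series a))%:E)%E].
Proof.
move=> Tnu x y xy a.
pose k l := mittag_leffler nu (- mu_ R l * (t - t0) `^ nu).
pose X := time_changed nu t0 (B x) (H x) t.
pose Y := time_changed nu t0 (B y) (H y) t.
have hHz z nu1 := hH nu1 z.
have mX : measurable_fun setT X by exact: (measurable_time_changed hnu ht (hB x) (hHz x)).
have mY : measurable_fun setT Y by exact: (measurable_time_changed hnu ht (hB y) (hHz y)).
have tD : `[t0, +oo[%classic t by rewrite /= in_itv/= andbT ltW.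
have indXY A D : measurable A -> measurable D ->
    (P (X @^-1` A `&` Y @^-1` D) = P (X @^-1` A) * P (Y @^-1` D))%E.
  move=> mA mD; apply: (hBB x y xy).
    exact: (@sigma_process_preimage _ _ _ _ _ _ (time_changed nu t0 (B x) (H x)) t).
  exact: (@sigma_process_preimage _ _ _ _ _ _ (time_changed nu t0 (B y) (H y)) t).
have FXY (A : set (sphere R * sphere R)) : measurable A ->
    sigma_process [set i : sphere R * R | t0 <= i.2]
      (fun i => time_changed nu t0 (B i.1) (H i.1) i.2) ((fun w => (X w, Y w)) @^-1` A).
  move=> mA; apply: measurable_g_sigma_algebra; first exact: sigma_process_algebra.
  set F := sigma_process _ _.
  have mF z : measurable_fun setT
      (time_changed nu t0 (B z) (H z) t : g_sigma_algebraType F -> sphere R).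
    by apply: (@measurable_sigma_process _ _ _ _ _ _ _ (z, t)); exact: ltW.
  rewrite -[X in measurable X]setTI.
  exact: (measurable_fun_pair (mF x) (mF y)).
have [int_XY E_XY] := expectation_composed_field hT hTB mX mY FXY.
(* Partial sums of the covariance series, bounded by M since |P_l| <= 1. *)
pose S n (z : sphere R * sphere R) : R :=
  series (fun l => (2 * l + 1)%:R / (4 * pi) * C l * zonal (legendre R l) z.2 z.1) n.
have mS n : measurable_fun setT (S n).
  rewrite /S /series/=; apply: measurable_sum => l.
  by apply: measurable_funM; [exact: measurable_cst|exact: measurable_zonal2].
have C0 := spectrum_ge0 hT.
have p0 : 0 < 4 * pi :> R by rewrite mulr_gt0 ?pi_gt0.
pose M := limn (series (fun l => (2 * l + 1)%:R * C l)) / (4 * pi).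
have SM n z : `|S n z| <= M.
  have [_ cvC] := if_spectrum hT.
  apply: (le_trans (ler_norm_sum _ _ _)); rewrite /M ler_pdivlMr//.
  apply: (le_trans _ (nondecreasing_cvgn_le _ cvC n)); last first.
    by apply: nondecreasing_series => l _ _; rewrite mulr_ge0.
  rewrite mulr_suml; apply: ler_sum => l _.
  have c0 : 0 <= (2 * l + 1)%:R / (4 * pi) * C l.
    by rewrite !mulr_ge0// invr_ge0 ltW.
  rewrite normrM ger0_norm//.
  apply: (@le_trans _ _ ((2 * l + 1)%:R / (4 * pi) * C l * 1 * (4 * pi))).
    rewrite ler_wpM2r//; first exact: ltW.
    by rewrite ler_wpM2l//; exact: zonal_legendre_le1.
  by rewrite mulr1 mulrAC divfK// gt_eqF.
have mXY : measurable_fun setT (fun w => (X w, Y w)) by exact: measurable_fun_pair.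
have cvS := @bounded_convergence _ _ _ P (fun n w => S n (X w, Y w))
  (fun w => corr P (T (X w)) (T (Y w))) M (fun n => measurableT_comp (mS n) mXY)
  (fun n w => SM n _) (fun w => covariance_series hT (u := X w) (v := Y w)).
have ES n : (\int[P]_w (S n (X w, Y w))%:E = (series a n)%:E)%E.
  have mz l : measurable_fun setT (fun w => zonal (legendre R l) (Y w) (X w)).
    exact: (measurableT_comp (measurable_zonal2 (legendre R l)) mXY).
  have iz l : P.-integrable setT (fun w => (zonal (legendre R l) (Y w) (X w))%:E).
    apply: (@bounded_probability_integrable _ _ _ _ _ 1) => // w.
    exact: zonal_legendre_le1.
  rewrite /S /series/=; under eq_integral do rewrite -sumEFin.
  rewrite integral_sum//; last first.
    move=> l; under eq_fun do rewrite EFinM.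
    exact: integrableZl.
  rewrite -sumEFin; apply: eq_bigr => l _.
  under eq_integral do rewrite EFinM.
  rewrite integralZl//.
  rewrite (@expectation_zonal_pair _ _ _ _ X Y x y (k l) l mX mY indXY).
  - by rewrite -EFinM mulrA.
  - by move=> v; exact: (expectation_zonal_time_changed hnu ht (hB x) (hHz x)).
  - by move=> v; exact: (expectation_zonal_time_changed hnu ht (hB y) (hHz y)).
have finE := integrable_fin_num measurableT int_XY.
have cva : series a @ \oo --> fine (\int[P]_w (Tnu x w * Tnu y w)%:E)%E.
  apply/(@fine_cvg _ _ _ _ (EFin \o series a)); rewrite fineK//.
  by move: cvS; under eq_fun do rewrite ES; rewrite -E_XY.
split=> //; first exact: cvgP cva.
by rewrite unlock (cvg_lim (@Rhausdorff R) cva) fineK.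
Qed.
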